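(* Let $k>1$ be an integer and let $0<r<s$, with $r,s$ small enough that $T_r$ and $T_s$ are strongly pseudoconvex domains with $C^\infty$ boundary. Then $\ell_k(T_r)>\ell_k(T_s)$. In particular, $T_r$ is not biholomorphic to $T_s$.
   Context: $S^k=\{(x_0,\dots,x_k)\in\mathbb{R}^{k+1}\colon x_0^2+\dots+x_k^2=1\}\subset\mathbb{R}^{k+1}\subset\mathbb{C}^{k+1}$, and for $r>0$, $T_r=\{x+\lambda u\colon x\in S^k,\ u\in\mathbb{C}^{k+1},\ \|u\|=1,\ 0\le\lambda<r\}\subset\mathbb{C}^{k+1}$ is the tubular neighborhood of radius $r$ (Euclidean norm). Only small radii are considered, for which $T_r$ is strongly pseudoconvex with $C^\infty$ boundary ($0<r<\tfrac12$ suffices). For a metric space $(X,d)$ and $A\subset X$, the $k$-dimensional Hausdorff measure is $\mu^k_{X,d}(A)=\sup_{\epsilon>0}\inf\{\sum_{i=1}^\infty(\delta(A_i))^k\colon A=\bigcup_{i=1}^\infty A_i,\ \delta(A_i)<\epsilon\}$, where $\delta(A_i)=\sup_{p,q\in A_i}d(p,q)$. For a bounded domain $U\subset\mathbb{C}^n$, $\mu^k_{\mathrm{Kob},U}$ is the $k$-dimensional Hausdorff measure with respect to the Kobayashi distance of $U$, and $\ell_k(U)$ is the infimum of $\mu^k_{\mathrm{Kob},U}(f(S^k))$ over all continuous maps $f\colon S^k\to U$ with $\mu^k_{\mathrm{Kob},U}(f(S^k))<\infty$ that are not free-homotopic in $U$ to a constant map. *)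

(* Defs.v *)
From HB Require Import structures.
From mathcomp Require Import all_boot all_order all_algebra.
From mathcomp Require Import all_classical all_reals all_analysis.
From mathcomp Require Import complex.

Set Implicit Arguments.
Unset Strict Implicit.
Unset Printing Implicit Defensive.

Import Order.TTheory GRing.Theory Num.Theory.
Import numFieldNormedType.Exports.

Local Open Scope ring_scope.
Local Open Scope classical_set_scope.
Local Open Scope complex_scope.

(* C and C^n. The regular module R[i]^o (rather than R[i]) is the carrier on
   which the library's topology and normed-module structure are found; the
   topology of C^n is the usual one. *)
Notation Cplx R := (R[i])^o.
Notation Cspace R n := 'rV[Cplx R]_n.

Section Sphere_and_tube.
Variable R : realType.

Definition sphere (k : nat) : set 'rV[R]_k.+1 :=
  [set x | \sum_(i < k.+1) x 0 i ^+ 2 = 1].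

Definition cmod (z : R[i]) : R := complex.Re `|z|.

Definition enorm (n : nat) (z : Cspace R n) : R :=
  Num.sqrt (\sum_(i < n) cmod (z 0 i) ^+ 2).

Definition real_embed (n : nat) (x : 'rV[R]_n) : Cspace R n :=
  map_mx (fun t : R => t%:C : Cplx R) x.

Definition tube (k : nat) (r : R) : set (Cspace R k.+1) :=
  [set z | exists (x : 'rV[R]_k.+1) (u : Cspace R k.+1) (lambda : R),
     [/\ sphere x, enorm u = 1, 0 <= lambda < r
       & z = real_embed x + lambda%:C *: u]].

End Sphere_and_tube.

Arguments sphere R k : clear implicits.
Arguments tube {R} k r.

Section Holomorphic.
Variable R : realType.

(* [differentiable] is Frechet differentiability over the scalar field of the
   normed modules, here R[i], hence complex differentiability. To be used with
   A open. *)
Definition holomorphic_on (V W : normedModType R[i]) (A : set V) (f : V -> W) :=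
  forall z : V, A z -> differentiable f z.

Definition biholomorphic (n : nat) (U V : set (Cspace R n)) : Prop :=
  exists F G : Cspace R n -> Cspace R n,
    [/\ holomorphic_on U F, holomorphic_on V G,
        F @` U `<=` V, G @` V `<=` U
      & (forall z, U z -> G (F z) = z) /\ (forall z, V z -> F (G z) = z)].

End Holomorphic.

Section Strongly_pseudoconvex.
Variables (R : realType) (n : nat).
Implicit Types (rho : Cspace R n -> R) (U W : set (Cspace R n)).
Implicit Types (p z v w : Cspace R n).

Definition domain U := [/\ U !=set0, open U & connected U].

Definition bounded_domain U :=
  domain U /\ exists M : R, forall z, U z -> enorm z <= M.

Definition on_line rho z v (t : R) : R := rho (z + t%:C *: v).

(* Real directional derivative along v in C^n = R^2n. *)
Definition rderive v rho z : R := derive1 (on_line rho z v) 0.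

(* Class C^m in the real sense, to be used with W open; asking for all
   directions v amounts to asking for the 2n real coordinate directions. *)
Fixpoint Cclass (m : nat) W rho : Prop :=
  (forall z, W z -> {for z, continuous rho}) /\
  if m is m'.+1 then
    forall v, (forall z, W z -> derivable (on_line rho z v) 0 1) /\
              Cclass m' W (rderive v rho)
  else True.

Definition smooth_on W rho := forall m, Cclass m W rho.

Definition dirx (j : 'I_n) : Cspace R n := delta_mx 0 j.
Definition diry (j : 'I_n) : Cspace R n := (0 +i* 1 : R[i]) *: delta_mx 0 j.

(* d rho / d z_j = (d/dx_j - i d/dy_j) rho / 2 *)
Definition dz (j : 'I_n) rho z : R[i] :=
  (rderive (dirx j) rho z -i* rderive (diry j) rho z) / 2%:R.

(* d^2 rho / d z_j d zbar_l
   = (d/dx_j - i d/dy_j) (d/dx_l + i d/dy_l) rho / 4 *)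
Definition dzdzbar (j l : 'I_n) rho z : R[i] :=
  ((rderive (dirx j) (rderive (dirx l) rho) z
    + rderive (diry j) (rderive (diry l) rho) z)
   +i* (rderive (dirx j) (rderive (diry l) rho) z
        - rderive (diry j) (rderive (dirx l) rho) z)) / 4%:R.

Definition levi_form rho p w : R[i] :=
  \sum_(j < n) \sum_(l < n) dzdzbar j l rho p * (w 0 j : R[i]) * conjc (w 0 l).

Definition complex_tangent rho p w : Prop :=
  \sum_(j < n) dz j rho p * (w 0 j : R[i]) = 0.

(* C^oo local defining function of U on the open neighbourhood W of p. *)
Definition local_defining U p W rho :=
  [/\ open W, W p, smooth_on W rho,
      forall z, W z -> (U z <-> rho z < 0)
    & forall z, W z -> exists v, rderive v rho z != 0].

(* Bounded strongly pseudoconvex domain with C^oo boundary. The inequality on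
   R[i] includes that the Levi form is real. *)
Definition strongly_pseudoconvex U : Prop :=
  bounded_domain U /\
  forall p, (closure U `\` interior U) p ->
    exists W rho, local_defining U p W rho /\
      forall w, w != 0 -> complex_tangent rho p w -> 0 < levi_form rho p w.

End Strongly_pseudoconvex.

Section Kobayashi.
Variable R : realType.

Definition disc : set (Cplx R) := [set z | cmod z < 1].

Definition poincare (a b : R[i]) : R :=
  let t := cmod ((a - b) / (1 - conjc a * b)) in
  ln ((1 + t) / (1 - t)) / 2%:R.

(* Infimum of the Poincare lengths of the chains of holomorphic discs in U
   joining p to q (+oo if there is no such chain). *)
Definition kobayashi (n : nat) (U : set (Cspace R n)) (p q : Cspace R n)
    : \bar R :=
  ereal_inf [set d | exists (m : nat) (x : nat -> Cspace R n)
      (phi : nat -> Cplx R -> Cspace R n) (a b : nat -> Cplx R),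
    [/\ x 0%N = p, x m = q,
        forall j, (j < m)%N ->
          [/\ holomorphic_on disc (phi j), phi j @` disc `<=` U,
              disc (a j) /\ disc (b j),
              phi j (a j) = x j & phi j (b j) = x j.+1]
      & d = (\sum_(j < m) poincare (a j) (b j))%:E]].

End Kobayashi.

Section Hausdorff_measure.
Variables (R : realType) (T : Type) (d : T -> T -> \bar R).

(* The maximum with 0 only matters for the empty set, of diameter 0. *)
Definition diam (A : set T) : \bar R :=
  maxe 0%E (ereal_sup [set d pq.1 pq.2 | pq in A `*` A]).

Definition hausdorff (k : nat) (A : set T) : \bar R :=
  ereal_sup [set ereal_inf [set (\sum_(0 <= i <oo) diam (F i) ^+ k)%E
      | F in [set F : nat -> set T | A = \bigcup_i F i /\
                forall i, (diam (F i) < eps%:E)%E]]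
    | eps in [set eps : R | 0 < eps]].

End Hausdorff_measure.

Section Ell.
Variables (R : realType) (n : nat).
Implicit Types U A : set (Cspace R n).

Definition hausdorff_kob (k : nat) U A : \bar R :=
  hausdorff (kobayashi U) k A.

(* Maps S^k -> U are represented by functions on R^(k+1) whose values off S^k
   are irrelevant. *)
Definition sphere_map (k : nat) U (f : 'rV[R]_k.+1 -> Cspace R n) : Prop :=
  {within sphere R k, continuous f} /\ f @` sphere R k `<=` U.

Definition homotopic_to_cst (k : nat) U (f : 'rV[R]_k.+1 -> Cspace R n)
    : Prop :=
  exists (H : R * 'rV[R]_k.+1 -> Cspace R n) (c : Cspace R n),
    [/\ {within `[0, 1]%classic `*` sphere R k, continuous H},
        H @` (`[0, 1]%classic `*` sphere R k) `<=` U,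
        forall x, sphere R k x -> H (0, x) = f x
      & forall x, sphere R k x -> H (1, x) = c].

Definition ell (k : nat) U : \bar R :=
  ereal_inf [set hausdorff_kob k U (f @` sphere R k)
    | f in [set f : 'rV[R]_k.+1 -> Cspace R n |
        [/\ sphere_map U f,
            (hausdorff_kob k U (f @` sphere R k) < +oo)%E
          & ~ homotopic_to_cst U f]]].

End Ell.

(* Main.v *)
Require Import Defs.
From mathcomp Require Import all_boot all_order all_algebra.
From mathcomp Require Import all_classical all_reals all_analysis.
From mathcomp Require Import complex ring lra zify.

Set Implicit Arguments.
Unset Strict Implicit.
Unset Printing Implicit Defensive.

Import Order.TTheory GRing.Theory Num.Theory.
Import numFieldNormedType.Exports.

Local Open Scope ring_scope.
Local Open Scope classical_set_scope.
Local Open Scope complex_scope.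

(** Write [T_r] for [tube k r] and [z = a + i b] with [a], [b] real. Then
    [T_r] is [|b|^2 + (|a| - 1)^2 < r^2], and for [r < 1] the projection
    [z |-> a / |a|] retracts it along segments onto the sphere [S^k].

    Strict inequality of the two invariants comes from a contraction
    ([kobayashi_tube_contraction]): on [T_r] the Kobayashi distance of [T_s] is
    at most [c] times that of [T_r], for one constant [c < 1]. If [psi] is a
    holomorphic disc in [T_r] then [psi + z v] is a disc in [T_s] as soon as
    [|v| <= s - r], and such a [v] can be chosen so that [psi t] is reached at
    the parameter [c t] instead of [t], because [psi] is Lipschitz near [0]
    uniformly in [psi]. Hausdorff measures then shrink by [c^k]
    ([hausdorff_image]). A map into [T_r] that is not null-homotopic there is
    not null-homotopic in [T_s] either, both tubes being retracted on the same
    sphere ([null_homotopic_smaller_tube]). Hence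
    [ell k T_s <= c^k * ell k T_r], which is strict once [0 < ell k T_r] and
    [ell k T_s < +oo] are known.

    - [ell k T_s] is finite ([ell_tube_ltoo]) because the sphere itself
      competes: its measure is finite, since near the sphere the Kobayashi
      distance is at most a multiple of the Euclidean one, and its inclusion is
      not null-homotopic, which is Brouwer's theorem. The latter is reduced to
      a cubical Sperner lemma ([fully_labelled_cube]), whose proof is a
      computation with cup products modulo 2.
    - [ell k T_r] is positive ([ell_tube_gt0]) because the projection on the
      sphere of a map that is not null-homotopic is onto, and the projection is
      Lipschitz for the Kobayashi distance; so the image projects onto a cube
      of dimension [k], and covers of a cube have a sum of [k]-th powers of
      diameters bounded below ([cube_cover_sum]).

    Both the contraction and the lower bound of the Kobayashi distance rest on
    a uniform Lipschitz estimate for bounded holomorphic functions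
    ([bounded_holomorphic_lipschitz]), which is derived here from complex
    differentiability alone: Goursat's argument in logarithmic polar
    coordinates shows that means over circles do not depend on the radius.

    That [s < 1] follows from strong pseudoconvexity
    ([strongly_pseudoconvex_tube_lt1]): for [s >= 1] the boundary has a conical
    point with [a = 0], where no smooth defining function with non-zero
    gradient exists.

    Finally a biholomorphism preserves Kobayashi distances and null-homotopy,
    hence [ell] ([ell_biholomorphic]). *)

(** * Complex derivatives *)

Section Modulus.
Variable R : realType.
Implicit Types z w : R[i].

Lemma normCE z : `|z| = (cmod z)%:C.
Proof. by rewrite /cmod; case: z => a b. Qed.

Lemma cmod_ge0 z : 0 <= cmod z.
Proof. by rewrite -lecR -normCE; exact: normr_ge0. Qed.

Lemma cmodM z w : cmod (z * w) = cmod z * cmod w.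
Proof. by apply: complexI; rewrite rmorphM -!normCE normrM. Qed.

Lemma ler_cmodD z w : cmod (z + w) <= cmod z + cmod w.
Proof. by rewrite -lecR rmorphD -!normCE ler_normD. Qed.

Lemma cmodN z : cmod (- z) = cmod z.
Proof. by rewrite /cmod normrN. Qed.

Lemma cmod0 : cmod (0 : R[i]) = 0.
Proof. by rewrite /cmod normr0. Qed.

Lemma cmod1 : cmod (1 : R[i]) = 1.
Proof. by rewrite /cmod normr1. Qed.

Lemma cmod_eq0 z : (cmod z == 0) = (z == 0).
Proof. by rewrite -(normr_eq0 z) normCE -(inj_eq (@complexI _)). Qed.

Lemma cmod_gt0 z : (0 < cmod z) = (z != 0).
Proof. by rewrite lt_def cmod_ge0 andbT cmod_eq0. Qed.

Lemma cmodV z : cmod z^-1 = (cmod z)^-1.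
Proof. by apply: complexI; rewrite fmorphV -!normCE normfV. Qed.

Lemma cmodR (x : R) : cmod x%:C = `|x|.
Proof. by rewrite /cmod normc_def /= expr0n addr0 sqrtr_sqr. Qed.

Lemma cmod_sqr z : cmod z ^+ 2 = complex.Re z ^+ 2 + complex.Im z ^+ 2.
Proof.
by case: z => a b; rewrite /cmod normc_def /= sqr_sqrtr// addr_ge0// sqr_ge0.
Qed.

Lemma ler_Re_cmod z : `|complex.Re z| <= cmod z.
Proof.
rewrite -[leRHS]ger0_norm ?cmod_ge0// -ler_sqr ?nnegrE ?normr_ge0//.
by rewrite !real_normK ?num_real// cmod_sqr lerDl sqr_ge0.
Qed.

Lemma ler_Im_cmod z : `|complex.Im z| <= cmod z.
Proof.
rewrite -[leRHS]ger0_norm ?cmod_ge0// -ler_sqr ?nnegrE ?normr_ge0//.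
by rewrite !real_normK ?num_real// cmod_sqr lerDr sqr_ge0.
Qed.

Lemma ler_cmod_ReIm z : cmod z <= `|complex.Re z| + `|complex.Im z|.
Proof.
rewrite -ler_sqr ?nnegrE ?cmod_ge0 ?addr_ge0// cmod_sqr sqrrD.
by rewrite !real_normK ?num_real// lerD2r lerDl mulrn_wge0// mulr_ge0.
Qed.

Lemma cReD z w : complex.Re (z + w) = complex.Re z + complex.Re w.
Proof. by case: z w => ? ? [? ?]. Qed.
Lemma cImD z w : complex.Im (z + w) = complex.Im z + complex.Im w.
Proof. by case: z w => ? ? [? ?]. Qed.
Lemma cReN z : complex.Re (- z) = - complex.Re z.
Proof. by case: z. Qed.
Lemma cImN z : complex.Im (- z) = - complex.Im z.
Proof. by case: z. Qed.
Lemma cReM z w : complex.Re (z * w) =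
  complex.Re z * complex.Re w - complex.Im z * complex.Im w.
Proof. by case: z w => ? ? [? ?]. Qed.
Lemma cImM z w : complex.Im (z * w) =
  complex.Re z * complex.Im w + complex.Im z * complex.Re w.
Proof. by case: z w => ? ? [? ?]. Qed.

Lemma complex_ext z w :
  complex.Re z = complex.Re w -> complex.Im z = complex.Im w -> z = w.
Proof. by case: z w => ? ? [? ?] /= -> ->. Qed.

End Modulus.

Section Complex_derivative.
Variable R : realType.

(** Complex differentiability in the form in which Goursat's argument uses it;
    [D] is the derivative of [f] at [z]. *)
Definition cderiv (f : R[i] -> R[i]) (z D : R[i]) :=
  forall e : R, 0 < e -> exists2 d : R, 0 < d &
    forall h : R[i], cmod h < d -> cmod (f (z + h) - f z - D * h) <= e * cmod h.

Lemma gt0_complex (e : R[i]) : 0 < e -> exists2 d : R, 0 < d & e = d%:C.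
Proof.
by case: e => a b; rewrite ltcE /= => /andP[/eqP -> a0]; exists a.
Qed.

Lemma differentiable_cderiv (f : Cplx R -> Cplx R) (z : Cplx R) :
  differentiable f z -> exists D : R[i], cderiv f z D.
Proof.
move=> df; exists ((derive1 f) z) => e e0.
have := diff_locally df; rewrite diff1E // => /eqaddoP /(_ e%:C).
rewrite ltcR => /(_ e0) /nbhs_ballP[d' /= /gt0_complex[d d0 ->] Hd].
exists d => // h hd.
have /Hd /= : ball (0 : Cplx R) d%:C h.
  by rewrite -ball_normE /= sub0r normrN normCE ltcR.
rewrite !fctE /= !normCE -rmorphM lecR.
by rewrite (addrC h z) -[h *: _]/(h * _) (mulrC _ h) opprD addrA.
Qed.

Lemma cderiv_bound (f : R[i] -> R[i]) z D : cderiv f z D ->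
  exists2 d : R, 0 < d & forall h, cmod h < d ->
    cmod (f (z + h) - f z) <= (1 + cmod D) * cmod h.
Proof.
move=> /(_ 1 ltr01)[d d0 Hd]; exists d => // h /Hd; rewrite mul1r => Hh.
have -> : f (z + h) - f z = (f (z + h) - f z - D * h) + D * h by rewrite subrK.
by rewrite (le_trans (ler_cmodD _ _))// mulrDl mul1r -cmodM lerD2r.
Qed.

Lemma cderiv_comp (g f : R[i] -> R[i]) z D E :
  cderiv f z D -> cderiv g (f z) E -> cderiv (g \o f) z (E * D).
Proof.
move=> df dg e e0.
have [d1 d10 Hf] := cderiv_bound df.
have K0 : 0 < 1 + cmod D by rewrite ltr_wpDr// cmod_ge0.
have L0 : 0 < 1 + cmod E by rewrite ltr_wpDr// cmod_ge0.
have [d2 d20 Hg] := dg (e / 2 / (1 + cmod D)) ltac:(by rewrite !divr_gt0).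
have [d3 d30 Hf3] := df (e / 2 / (1 + cmod E)) ltac:(by rewrite !divr_gt0).
exists (Num.min d1 (Num.min (d2 / (1 + cmod D)) d3)).
  by rewrite !lt_min d10 d30 divr_gt0.
move=> h; rewrite !lt_min => /and3P[h1 h2 h3].
have fh : cmod (f (z + h) - f z) < d2.
  by rewrite (le_lt_trans (Hf _ h1))// mulrC -ltr_pdivlMr.
have := Hg _ fh; rewrite addrCA subrr addr0 => H1.
have H2 := Hf3 _ h3.
have -> : (g \o f) (z + h) - (g \o f) z - E * D * h =
    (g (f (z + h)) - g (f z) - E * (f (z + h) - f z))
    + E * (f (z + h) - f z - D * h) by rewrite /=; ring.
apply: le_trans (ler_cmodD _ _) _; rewrite [e]splitr mulrDl; apply: lerD.
  apply: le_trans H1 _.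
  apply: le_trans (ler_wpM2l _ (Hf _ h1)) _; first by rewrite !divr_ge0 ?ltW.
  by rewrite mulrA divfK ?lt0r_neq0.
rewrite cmodM; apply: le_trans (ler_wpM2l (cmod_ge0 _) H2) _.
rewrite mulrA ler_wpM2r ?cmod_ge0// mulrC -[leRHS](divfK (lt0r_neq0 L0)).
by rewrite ler_wpM2l ?lerDr// !divr_ge0// ltW.
Qed.

End Complex_derivative.

Section Real_derivative.
Variable R : realType.

Lemma derive_remainder (f : R -> R) (x df e : R) : is_derive x 1 f df -> 0 < e ->
  exists2 d : R, 0 < d & forall u, `|u| < d -> `|f (x + u) - f x - df * u| <= e * `|u|.
Proof.
move=> fx e0; have /derivable1_diffP dfx := @ex_derive _ _ _ _ _ _ _ fx.
have := diff_locally dfx; rewrite diff1E // => /eqaddoP /(_ e e0).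
move=> /nbhs_ballP[d /= d0 Hd]; exists d => // u ud.
have /Hd /= : ball (0 : R) d u by rewrite -ball_normE /= sub0r normrN.
rewrite !fctE /= derive1E (@derive_val _ _ _ _ _ _ _ fx).
by rewrite (addrC u x) -[u *: _]/(u * _) (mulrC _ u) opprD addrA.
Qed.
End Real_derivative.

(** * Goursat's theorem for real one-forms *)

Lemma nested_segments (R : realType) (x l : nat -> R) :
  (forall n, x n <= x n.+1) -> (forall n, x n.+1 + l n.+1 <= x n + l n) ->
  (forall n, 0 <= l n) -> exists p, forall n, x n <= p <= x n + l n.
Proof.
move=> xi xd l0.
have hx n m : (n <= m)%N -> x n <= x m by have /nondecreasing_seqP := xi; apply.
have hd n m : (n <= m)%N -> x m + l m <= x n + l n.
  by have /(nonincreasing_seqP (fun n => x n + l n)) := xd; apply.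
have ub n m : x m <= x n + l n.
  have [nm|mn] := leqP n m.
    by rewrite (le_trans _ (hd _ _ nm))// lerDl.
  by rewrite (le_trans (hx _ _ (ltnW mn)))// lerDl.
exists (sup (range x)) => n; apply/andP; split.
  apply: ub_le_sup; last by exists n.
  by exists (x 0%N + l 0%N) => _ [m _ <-].
apply: ge_sup; first by exists (x 0%N), 0%N.
by move=> _ [m _ <-].
Qed.

(** Were [good] to fail for the whole rectangle, it would fail for one of its
    quarters, for a quarter of that one, and so on; these shrink to a point,
    near which [good] holds. *)
Lemma rectangle_bisection (R : realType) (good : R -> R -> R -> Prop)
    (x0 y0 w h : R) : 0 < w -> 0 < h ->
  (forall x y t, 0 < t ->
     good x y (t / 2) -> good (x + w * (t / 2)) y (t / 2) ->
     good x (y + h * (t / 2)) (t / 2) ->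
     good (x + w * (t / 2)) (y + h * (t / 2)) (t / 2) -> good x y t) ->
  (forall p q, x0 <= p <= x0 + w -> y0 <= q <= y0 + h ->
     exists2 d : R, 0 < d & forall x y t, 0 < t < d ->
       x <= p <= x + w * t -> y <= q <= y + h * t -> good x y t) ->
  good x0 y0 1.
Proof.
move=> w0 h0 quarters small; apply: contrapT => bad0.
have step (s : R * R * R) : exists s' : R * R * R,
    0 < s.2 -> ~ good s.1.1 s.1.2 s.2 ->
    [/\ s'.2 = s.2 / 2, ~ good s'.1.1 s'.1.2 s'.2,
        s.1.1 <= s'.1.1 /\ s'.1.1 + w * s'.2 <= s.1.1 + w * s.2
      & s.1.2 <= s'.1.2 /\ s'.1.2 + h * s'.2 <= s.1.2 + h * s.2].
  case: s => [[x y] t] /=.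
  have [t0|] := pselect (0 < t); last by exists (x, y, t).
  have wt : 0 < w * t by rewrite mulr_gt0.
  have ht : 0 < h * t by rewrite mulr_gt0.
  have wt2 : w * (t / 2) = w * t / 2 by rewrite mulrA.
  have ht2 : h * (t / 2) = h * t / 2 by rewrite mulrA.
  have [g1|b1] := pselect (good x y (t / 2)); last first.
    by exists (x, y, t / 2) => _ _ /=; rewrite wt2 ht2; split => //; lra.
  have [g2|b2] := pselect (good (x + w * (t / 2)) y (t / 2)); last first.
    exists (x + w * (t / 2), y, t / 2) => _ _ /=.
    by rewrite wt2 ht2; split => //; rewrite -?wt2//; lra.
  have [g3|b3] := pselect (good x (y + h * (t / 2)) (t / 2)); last first.
    exists (x, y + h * (t / 2), t / 2) => _ _ /=.
    by rewrite wt2 ht2; split => //; rewrite -?ht2//; lra.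
  have [g4|b4] := pselect
      (good (x + w * (t / 2)) (y + h * (t / 2)) (t / 2)); last first.
    exists (x + w * (t / 2), y + h * (t / 2), t / 2) => _ _ /=.
    by rewrite wt2 ht2; split => //; rewrite -?wt2 -?ht2//; lra.
  by exists (x, y, t) => _ []; exact: quarters.
have /choice[next nextP] := step.
pose s := fix s n := if n is n'.+1 then next (s n') else (x0, y0, 1).
have sP n : (s n).2 = 2^-1 ^+ n /\ ~ good (s n).1.1 (s n).1.2 (s n).2.
  elim: n => [|n [IHt IHb]]; first by rewrite expr0.
  have s0 : 0 < (s n).2 by rewrite IHt exprn_gt0.
  by have [tE ? _ _] := nextP _ s0 IHb; split=> //=; rewrite tE IHt exprSr.
have s0 n : 0 < (s n).2 by rewrite (sP n).1 exprn_gt0.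
have sS n := nextP _ (s0 n) (sP n).2.
have [p pP] : exists p, forall n, (s n).1.1 <= p <= (s n).1.1 + w * (s n).2.
  apply: (@nested_segments _ (fun n => (s n).1.1)) => n.
  - by have [_ _ [? ?] _] := sS n.
  - by have [_ _ [? ?] _] := sS n.
  - by rewrite mulr_ge0// ltW.
have [q qP] : exists p, forall n, (s n).1.2 <= p <= (s n).1.2 + h * (s n).2.
  apply: (@nested_segments _ (fun n => (s n).1.2)) => n.
  - by have [_ _ _ [? ?]] := sS n.
  - by have [_ _ _ [? ?]] := sS n.
  - by rewrite mulr_ge0// ltW.
have [] := small p q; first by have := pP 0%N; rewrite /= mulr1.
  by have := qP 0%N; rewrite /= mulr1.
move=> d d0 goodd.
have [n nd] : exists n, (s n).2 < d.
  have : (fun n : nat => (2^-1 : R) ^+ n) @ \oo --> (0 : R).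
    apply: cvg_expr; have : (0 : R) < 2^-1 by rewrite invr_gt0 ltr0n.
    by move=> t0; rewrite gtr0_norm//; lra.
  move=> /cvgrPdist_lt /(_ _ d0) [n _ /(_ n (leqnn n))].
  rewrite sub0r normrN ger0_norm ?exprn_ge0// => nd.
  by exists n; rewrite (sP n).1.
by apply: (sP n).2; apply: goodd => //; rewrite s0.
Qed.

(** The mean value theorem applied to [f] minus the primitive of an affine
    function. *)
Lemma increment_affine_bound (R : realType) (f df : R -> R) (a b c0 c1 p e : R) :
  a <= b -> (forall x, a <= x <= b -> is_derive x 1 f (df x)) ->
  (forall x, a <= x <= b -> `|df x - (c0 + c1 * (x - p))| <= e) ->
  `|f b - f a - (c0 * (b - a) + c1 / 2 * ((b - p) ^+ 2 - (a - p) ^+ 2))|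
    <= e * (b - a).
Proof.
move=> ab fdf dfe.
pose g x := f x - (c0 * x + c1 / 2 * (x - p) ^+ 2).
have gdg x : a <= x <= b -> is_derive x 1 g (df x - (c0 + c1 * (x - p))).
  move=> /fdf fx.
  have -> : g = f - (c0 *: id + (c1 / 2) *: (id - cst p) ^+ 2).
    by apply/funext => y; rewrite /g !fctE.
  have dl : is_derive x 1 (c0 *: id) (c0 *: 1) by exact: is_deriveZ.
  have di : is_derive x 1 (id - cst p) (1 - 0) by exact: is_deriveB.
  have dq := is_deriveX 2 di.
  have dZq := is_deriveZ (c1 / 2) dq.
  have dg := is_deriveB fx (is_deriveD dl dZq).
  move: dg; congr (is_derive _ _ _ _).
  rewrite /GRing.scale /=.
  congr (_ - (_ + _)); first by rewrite mulr1.
  by rewrite -[(_ - _ : _ -> _) x]/(x - p) expr1; field.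
have cg : {within `[a, b], continuous g}.
  apply: derivable_within_continuous => x; rewrite in_itv /= => xab.
  by have [] := gdg x xab.
have gdg' x : x \in `]a, b[%R -> is_derive x 1 g (df x - (c0 + c1 * (x - p))).
  by rewrite in_itv /= => /andP[ax xb]; apply: gdg; rewrite !ltW.
have [x xab gE] := MVT_segment ab gdg' cg.
have -> : f b - f a - (c0 * (b - a) + c1 / 2 * ((b - p) ^+ 2 - (a - p) ^+ 2))
    = g b - g a by rewrite /g; ring.
rewrite gE normrM [`|b - a|]ger0_norm ?subr_ge0//.
by rewrite ler_wpM2r ?subr_ge0// dfe// -in_itv.
Qed.

Lemma half_segment (R : realFieldType) (a l x d : R) : 0 < d -> a <= x ->
  x + d <= a + l ->
  [/\ x + d / 2 <= a + l, a <= x + d / 2 & x + d / 2 + d / 2 <= a + l].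
Proof. by move=> d0 ax xl; split; lra. Qed.

Lemma dist_in_segment (R : realFieldType) (x d u v : R) :
  x <= u <= x + d -> x <= v <= x + d -> `|u - v| <= d.
Proof.
by move=> /andP[xu ux] /andP[xv vx]; rewrite ler_norml; apply/andP; split; lra.
Qed.

(** The boundary integral of [A dx + B dy] over a rectangle, when [P] and [Q]
    are primitives of [A] in [x] and of [B] in [y]. *)
Definition circulation (R : realType) (P Q : R -> R -> R) (x y w h : R) : R :=
  (P (x + w) y - P x y) + (Q (x + w) (y + h) - Q (x + w) y)
  - (P (x + w) (y + h) - P x (y + h)) - (Q x (y + h) - Q x y).

(** Goursat's version of Cauchy's theorem, where the derivatives of [A] and [B]
    need not be continuous: near each point the linear parts contribute
    nothing, so that the circulation around a small rectangle is small compared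
    with its area; this property survives assembling four quarters, so it holds
    for the whole rectangle. *)
Lemma circulation_closed_form (R : realType) (A B P Q : R -> R -> R)
    (x0 y0 w h : R) : 0 < w -> 0 < h ->
  let D x y := (x0 <= x <= x0 + w) && (y0 <= y <= y0 + h) in
  (forall x y, D x y -> is_derive x 1 (P ^~ y) (A x y)) ->
  (forall x y, D x y -> is_derive y 1 (Q x) (B x y)) ->
  (forall p q, D p q -> exists a b c, forall e : R, 0 < e ->
     exists2 d : R, 0 < d & forall x y, `|x - p| < d -> `|y - q| < d ->
       `|A x y - (A p q + a * (x - p) + c * (y - q))|
          <= e * (`|x - p| + `|y - q|) /\
       `|B x y - (B p q + c * (x - p) + b * (y - q))|
          <= e * (`|x - p| + `|y - q|)) ->
  circulation P Q x0 y0 w h = 0.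
Proof.
move=> w0 h0 D dP dQ dAB; apply/eqP; rewrite -normr_le0.
apply/ler_addgt0Pl => e e0; rewrite addr0.
(* a bound by the area, so that it adds up over the four quarters *)
pose good x y t := x0 <= x -> x + w * t <= x0 + w ->
  y0 <= y -> y + h * t <= y0 + h ->
  `|circulation P Q x y (w * t) (h * t)| <= e * t ^+ 2.
suff : good x0 y0 1 by rewrite /good !mulr1 expr1n mulr1; exact.
apply: (rectangle_bisection w0 h0) => [x y t t0|p q pw qh].
  have wt : 0 < w * t by rewrite mulr_gt0.
  have ht : 0 < h * t by rewrite mulr_gt0.
  have wt2 : w * (t / 2) = w * t / 2 by rewrite mulrA.
  have ht2 : h * (t / 2) = h * t / 2 by rewrite mulrA.
  rewrite /good !wt2 !ht2 => g1 g2 g3 g4 x1 x2 y1 y2.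
  have [hx1 hx2 hx3] := half_segment wt x1 x2.
  have [hy1 hy2 hy3] := half_segment ht y1 y2.
  have {g1} := g1 x1 hx1 y1 hy1; have {g2} := g2 hx2 hx3 y1 hy1.
  have {g3} := g3 x1 hx1 hy2 hy3; have {g4} := g4 hx2 hx3 hy2 hy3.
  set c4 := circulation _ _ _ _ _ _; set c3 := circulation _ _ _ _ _ _.
  set c2 := circulation _ _ _ _ _ _; set c1 := circulation _ _ _ _ _ _.
  have -> : circulation P Q x y (w * t) (h * t) = c1 + c2 + c3 + c4.
    rewrite /c1 /c2 /c3 /c4 /circulation -!addrA -!splitr; ring.
  have -> : e * (t / 2) ^+ 2 = e * t ^+ 2 / 4 by field.
  rewrite !ler_norml => /andP[? ?] /andP[? ?] /andP[? ?] /andP[? ?].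
  by apply/andP; split; lra.
have Dpq : D p q by rewrite /D pw qh.
have [a [b [c dABpq]]] := dAB _ _ Dpq.
have wh0 : 0 < w + h by rewrite addr_gt0.
pose e' := e / (2 * (w + h) ^+ 2).
have e'0 : 0 < e' by rewrite divr_gt0// mulr_gt0// exprn_gt0.
have [d d0 Hd] := dABpq _ e'0.
exists (d / (w + h)); first by rewrite divr_gt0.
move=> x y t /andP[t0]; rewrite ltr_pdivlMr// => td /andP[xp px] /andP[yq qy].
move=> xl xr yl yr.
have wt : 0 < w * t by rewrite mulr_gt0.
have ht : 0 < h * t by rewrite mulr_gt0.
move: td; rewrite mulrDr (mulrC t) (mulrC t) => td.
set w' := w * t in wt td px xr *; set h' := h * t in ht td qy yr *.
have wd : w' < d by apply: le_lt_trans td; rewrite lerDl ltW.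
have hd : h' < d by apply: le_lt_trans td; rewrite lerDr ltW.
have x_in : x <= x <= x + w' by rewrite lexx lerDl ltW.
have xw_in : x <= x + w' <= x + w' by rewrite lexx lerDl ltW.
have y_in : y <= y <= y + h' by rewrite lexx lerDl ltW.
have yh_in : y <= y + h' <= y + h' by rewrite lexx lerDl ltW.
have near u v : x <= u <= x + w' -> y <= v <= y + h' ->
    [/\ D u v, `|A u v - (A p q + a * (u - p) + c * (v - q))| <= e' * (w' + h')
      & `|B u v - (B p q + c * (u - p) + b * (v - q))| <= e' * (w' + h')].
  move=> ux vy.
  have up : `|u - p| <= w' by apply: (dist_in_segment ux); rewrite xp.
  have vq : `|v - q| <= h' by apply: (dist_in_segment vy); rewrite yq.
  have [HA HB] := Hd u v (le_lt_trans up wd) (le_lt_trans vq hd).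
  have le_e : e' * (`|u - p| + `|v - q|) <= e' * (w' + h').
    by rewrite ler_pM2l// lerD.
  split; [|exact: le_trans HA le_e|exact: le_trans HB le_e].
  case/andP: ux vy => xu ux /andP[yv vy].
  rewrite /D (le_trans xl xu) (le_trans ux xr) (le_trans yl yv).
  exact: le_trans vy yr.
have hP v : y <= v <= y + h' -> `|P (x + w') v - P x v
    - ((A p q + c * (v - q)) * (x + w' - x)
       + a / 2 * ((x + w' - p) ^+ 2 - (x - p) ^+ 2))|
    <= e' * (w' + h') * (x + w' - x).
  move=> vh; apply: (@increment_affine_bound _ (P ^~ v) (A ^~ v)).
  - by rewrite lerDl ltW.
  - by move=> u uw; have [] := near u v uw vh => Du _ _; exact: dP.
  - move=> u uw; have [_ + _] := near u v uw vh.
    by congr (`|_ - _| <= _); ring.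
have hQ u : x <= u <= x + w' -> `|Q u (y + h') - Q u y
    - ((B p q + c * (u - p)) * (y + h' - y)
       + b / 2 * ((y + h' - q) ^+ 2 - (y - q) ^+ 2))|
    <= e' * (w' + h') * (y + h' - y).
  move=> uw; apply: (@increment_affine_bound _ (Q u) (B u)).
  - by rewrite lerDl ltW.
  - by move=> v vh; have [] := near u v uw vh => Du _ _; exact: dQ.
  - by move=> v vh; have [_ _ +] := near u v uw vh.
have -> : e * t ^+ 2 = 2 * (e' * (w' + h') * w') + 2 * (e' * (w' + h') * h').
  by rewrite /e' /w' /h'; field; rewrite gt_eqF.
have {hP} := conj (hP _ y_in) (hP _ yh_in).
have {hQ} := conj (hQ _ x_in) (hQ _ xw_in).
have -> : x + w' - x = w' by ring.
have -> : y + h' - y = h' by ring.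
rewrite !ler_norml => -[/andP[? ?] /andP[? ?]] [/andP[? ?] /andP[? ?]].
rewrite /circulation; apply/andP; split; nra.
Qed.

(** * The complex exponential *)

Section Polar.
Variable R : realType.

Definition cexp (w : R[i]) : R[i] :=
  (expR (complex.Re w))%:C * (cos (complex.Im w) +i* sin (complex.Im w)).

Lemma cexpD w w' : cexp (w + w') = cexp w * cexp w'.
Proof.
rewrite /cexp cReD cImD expRD cosD sinD; apply: complex_ext; rewrite ?cReM ?cImM /= ?cReM ?cImM /=; ring.
Qed.

Lemma cmod_cexp w : cmod (cexp w) = expR (complex.Re w).
Proof.
have c1 (t : R) : cmod (cos t +i* sin t) = 1.
  by rewrite /cmod normc_def /= cos2Dsin2 sqrtr1.
by rewrite /cexp cmodM cmodR ger0_norm ?expR_ge0// c1 mulr1.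
Qed.

Lemma cexp_periodic x : cexp (x +i* (pi *+ 2)) = cexp (x +i* 0).
Proof. by rewrite /cexp /= cos2pi sin2pi cos0 sin0. Qed.

Lemma cderiv_cexp w : cderiv cexp w (cexp w).
Proof.
suff d0 : cderiv cexp 0 1.
  have K0 : 0 < cmod (cexp w) by rewrite cmod_cexp expR_gt0.
  move=> e e0; have [d dgt0 Hd] := d0 (e / cmod (cexp w)) ltac:(by rewrite divr_gt0).
  exists d => // h /Hd.
  have -> : cexp (w + h) - cexp w - cexp w * h
    = cexp w * (cexp (0 + h) - cexp 0 - 1 * h).
    rewrite add0r cexpD.
    have -> : cexp 0 = 1 by rewrite /cexp /= expR0 cos0 sin0 mulr1.
    by ring.
  rewrite cmodM => /(ler_wpM2l (ltW K0)); rewrite [X in _ <= X -> _]mulrA.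
  by rewrite (mulrC (cmod (cexp w)) (e / _)) divfK ?gt_eqF.
(* each remainder below is at most [m] times its argument, and with [m <= 1]
   the total is at most [9 m |h|] *)
move=> e e0; pose m := Num.min e 1 / 9.
have m0 : 0 < m by rewrite divr_gt0// lt_min e0 ltr01.
have me : 9 * m <= e by rewrite /m mulrC divfK ?pnatr_eq0// ge_min lexx.
have m1 : m <= 1 / 9 by rewrite /m ler_pM2r ?invr_gt0// ge_min lexx orbT.
have [d1 d10 H1] := derive_remainder (is_derive_expR 0) m0.
have [d2 d20 H2] := derive_remainder (is_derive_cos 0) m0.
have [d3 d30 H3] := derive_remainder (is_derive_sin 0) m0.
exists (Num.min m (Num.min d1 (Num.min d2 d3))).
  by rewrite !lt_min m0 d10 d20 d30.
case=> u v; rewrite !lt_min => /and4P[hm h1 h2 h3].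
have uh := ler_Re_cmod (u +i* v); have vh := ler_Im_cmod (u +i* v).
move: uh vh hm h1 h2 h3; set n := cmod _ => /= uh vh hm h1 h2 h3.
have := H1 _ (le_lt_trans uh h1); have := H2 _ (le_lt_trans vh h2).
have := H3 _ (le_lt_trans vh h3).
rewrite !add0r expR0 cos0 sin0 subr0 oppr0 mul0r subr0 !mul1r => S C X.
have um : `|u| <= m by apply: ltW; apply: le_lt_trans hm.
have X1 : `|expR u - 1| <= 2 * `|u|.
  have -> : expR u - 1 = (expR u - 1 - u) + u by ring.
  apply: le_trans (ler_normD _ _) _.
  have : m * `|u| <= 1 * `|u| by rewrite ler_wpM2r// (le_trans m1)//; lra.
  lra.
have X2 : expR u <= 2.
  by have := ler_norm (expR u - 1); lra.
have X0 := expR_gt0 u.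
apply: le_trans (ler_cmod_ReIm _) _.
rewrite /cexp /= expR0 cos0 sin0; simpc => /=.
have -> : expR u * cos v - 1 - u = (expR u - 1 - u) + expR u * (cos v - 1) by ring.
have -> : expR u * sin v - v = expR u * (sin v - v) + (expR u - 1) * v by ring.
have b1 : `|expR u * (cos v - 1)| <= 2 * (m * `|v|).
  by rewrite normrM (ger0_norm (ltW X0)) ler_pM// ltW.
have b2 : `|expR u * (sin v - v)| <= 2 * (m * `|v|).
  by rewrite normrM (ger0_norm (ltW X0)) ler_pM// ltW.
have b3 : `|(expR u - 1) * v| <= (2 * m) * `|v|.
  by rewrite normrM ler_wpM2r// (le_trans X1)// ler_pM2l.
have n1 : m * `|u| <= m * n by rewrite ler_pM2l.
have n2 : m * `|v| <= m * n by rewrite ler_pM2l.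
have n3 : 9 * m * n <= e * n by rewrite ler_wpM2r// cmod_ge0.
have := ler_normD (expR u - 1 - u) (expR u * (cos v - 1)).
have := ler_normD (expR u * (sin v - v)) ((expR u - 1) * v).
have mn0 : 0 <= m * n by rewrite mulr_ge0 ?cmod_ge0 ?ltW.
lra.
Qed.

Lemma continuous_primitive (f : R -> R) (a b : R) : 
  (forall x, a <= x <= b -> {for x, continuous f}) ->
  forall x, a < x < b ->
    is_derive x 1 (fun x => \int[lebesgue_measure]_(t in `[a, x]) f t) (f x).
Proof.
move=> cf x /andP[ax xb].
have [||dF FE] := @continuous_FTC1_closed R f a x b xb _ ax.
- apply: continuous_compact_integrable; first exact: segment_compact.
  apply/continuous_in_subspaceT => y; rewrite inE /= in_itv /=; exact: cf.
- by apply: cf; rewrite !ltW.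
exact: (DeriveDef dF (etrans (esym (derive1E _ _)) FE)).
Qed.

End Polar.

(** * Mean values of holomorphic functions over circles *)

Section MeanValue.
Variable R : realType.

Lemma continuous_at_lipschitz (f : R -> R) (x d K : R) : 0 < d ->
  (forall u, `|u| < d -> `|f (x + u) - f x| <= K * `|u|) -> {for x, continuous f}.
Proof.
move=> d0 fK; apply/cvgrPdist_le => e e0.
have K0 : 0 < `|K| + 1 by rewrite ltr_wpDl.
near=> y.
have yd : `|y - x| < d.
  rewrite distrC; near: y.
  by apply/nbhs_ballP; exists d => //= y; rewrite -ball_normE.
have ye : `|y - x| < e / (`|K| + 1).
  rewrite distrC; near: y.
  by apply/nbhs_ballP; exists (e / (`|K| + 1)); rewrite /= ?divr_gt0// => y; rewrite -ball_normE.
have := fK _ yd; rewrite addrCA subrr addr0 distrC => /le_trans; apply.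
move: ye; rewrite ltr_pdivlMr// mulrC => /ltW; apply: le_trans.
by rewrite ler_wpM2r// (le_trans (ler_norm _))// lerDl.
Unshelve. all: by end_near. Qed.

(** Pull [f] back by the exponential: the circulation of [f (exp w) dw] around
    a rectangle of height [2 pi] vanishes, and its horizontal sides
    cancel by periodicity. Hence the mean of [f] over a circle does not depend
    on the radius, and is the limit of [f] at the centre. *)
Lemma punctured_mean_bound (f : R[i] -> R[i]) (L : R[i]) (rho M : R) :
  (forall z, 0 < cmod z < 1 -> exists D, cderiv f z D) ->
  (forall e : R, 0 < e -> exists2 d : R, 0 < d &
     forall z, 0 < cmod z < d -> cmod (f z - L) <= e) ->
  0 < rho < 1 -> (forall z, cmod z = rho -> `|complex.Re (f z)| <= M) ->
  `|complex.Re L| <= M.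
Proof.
move=> df fL /andP[rho0 rho1] fM.
have [T pi2 Tper] : exists2 T : R, 0 < T & forall x, cexp (x +i* T) = cexp (x +i* 0).
  by exists (pi *+ 2); [rewrite pmulrn_lgt0 ?pi_gt0|exact: cexp_periodic].
apply/ler_addgt0Pl => e e0.
have [d d0 fLd] := fL _ e0.
pose x2 := ln rho.
have x20 : x2 < 0 by rewrite /x2 ln_lt0// rho0.
(* a radius so small that [f] is within [e] of [L] on its circle *)
pose x1 := Num.min (x2 - 1) (ln d - 1).
have x12 : x1 < x2 by rewrite gt_min ltrBlDr ltrDl ltr01.
have x1d : expR x1 < d.
  rewrite -[ltRHS](lnK d0) ltr_expR; apply: (@le_lt_trans _ _ (ln d - 1)).
    by rewrite ge_min lexx orbT.
  by rewrite ltrBlDr ltrDl ltr01.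
pose g w := f (cexp w).
have dg (w : R[i]) : complex.Re w < 0 -> exists D, cderiv g w D.
  move=> w0; have [|E dE] := df (cexp w).
    by rewrite cmod_cexp expR_gt0 expR_lt1.
  exists (E * cexp w); apply: (cderiv_comp (cderiv_cexp w)); exact: dE.
pose A (x y : R) := complex.Im (g (x +i* y)).
pose B (x y : R) := complex.Re (g (x +i* y)).
(* the primitives start from a point outside the rectangle, so that they are
   differentiable on the whole of it *)
pose P (x y : R) := \int[lebesgue_measure]_(t in `[x1 - 1, x]) A t y.
pose Q (x y : R) := \int[lebesgue_measure]_(t in `[- 1, y]) B x t.
have cA (x y : R) : x < 0 -> {for x, continuous (A ^~ y)}.
  move=> x0; have [D /cderiv_bound[d' d'0 H]] := dg (x +i* y) x0.
  apply: (@continuous_at_lipschitz _ _ d' (1 + cmod D)) => // u ud.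
  have ui : cmod (u +i* 0) = `|u| by rewrite -cmodR.
  have := H (u +i* 0); rewrite ui => /(_ ud); apply: le_trans.
  rewrite /A; simpc; rewrite -cImN -cImD; exact: ler_Im_cmod.
have cB (x y : R) : x < 0 -> {for y, continuous (B x)}.
  move=> x0; have [D /cderiv_bound[d' d'0 H]] := dg (x +i* y) x0.
  apply: (@continuous_at_lipschitz _ _ d' (1 + cmod D)) => // u ud.
  have ui : cmod (0 +i* u) = `|u|.
    by rewrite /cmod normc_def /= expr0n add0r sqrtr_sqr.
  have := H (0 +i* u); rewrite ui => /(_ ud); apply: le_trans.
  rewrite /B; simpc; rewrite -cReN -cReD; exact: ler_Re_cmod.
have dP (x y : R) : x1 <= x <= x2 -> is_derive x 1 (P ^~ y) (A x y).
  move=> /andP[xa xb]; apply: (@continuous_primitive _ (A ^~ y) (x1 - 1) (x2 / 2)).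
    by move=> t /andP[_ t2]; apply: cA; lra.
  by apply/andP; split; lra.
have dQ (x y : R) : x <= x2 -> 0 <= y <= T -> is_derive y 1 (Q x) (B x y).
  move=> xb /andP[y0 y1].
  apply: (@continuous_primitive _ (B x) (- 1) (T + 1)).
    by move=> t _; apply: cB; lra.
  by apply/andP; split; lra.
pose Rc (x y : R) := (x1 <= x <= x1 + (x2 - x1)) && (0 <= y <= 0 + T).
have hP (x y : R) : Rc x y -> is_derive x 1 (P ^~ y) (A x y).
  by move=> /andP[xx _]; apply: dP; rewrite addrC subrK in xx.
have hQ (x y : R) : Rc x y -> is_derive y 1 (Q x) (B x y).
  by rewrite /Rc addrC subrK add0r => /andP[/andP[_ ?] ?]; apply: dQ.
have circ0 : circulation P Q x1 0 (x2 - x1) T = 0.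
  have w0 : 0 < x2 - x1 by rewrite subr_gt0.
  have dAB (p q : R) : Rc p q -> exists a b c, forall e : R, 0 < e ->
     exists2 d : R, 0 < d & forall x y, `|x - p| < d -> `|y - q| < d ->
       `|A x y - (A p q + a * (x - p) + c * (y - q))|
          <= e * (`|x - p| + `|y - q|) /\
       `|B x y - (B p q + c * (x - p) + b * (y - q))|
          <= e * (`|x - p| + `|y - q|).
    move=> /andP[pp qq]; rewrite addrC subrK in pp.
    have [|D dD] := dg (p +i* q); first by move: pp => /andP[_ /=]; lra.
    (* the Cauchy-Riemann equations *)
    exists (complex.Im D), (- complex.Im D), (complex.Re D) => e' e'0.
    have e'2 : 0 < e' / 2 by rewrite divr_gt0.
    have [d' d'0 H] := dD _ e'2.
    exists (d' / 2); first by rewrite divr_gt0.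
    move=> x y xd yd.
    have hd : cmod ((x - p) +i* (y - q)) < d'.
      by apply: le_lt_trans (ler_cmod_ReIm _) _; rewrite /=; lra.
    have hle := ler_cmod_ReIm ((x - p) +i* (y - q)).
    have := H _ hd; set r := g _ - _ - _ => rle.
    have xyE : p +i* q + ((x - p) +i* (y - q)) = x +i* y.
      by simpc; congr (_ +i* _); ring.
    have r1 : cmod r <= e' * (`|x - p| + `|y - q|).
      apply: le_trans rle _; rewrite ler_pM ?cmod_ge0//; first by lra.
      by lra.
    split.
    + apply: le_trans r1; apply: le_trans (ler_Im_cmod _).
      rewrite le_eqVlt; apply/orP; left; apply/eqP; congr `|_|.
      by rewrite /r xyE !cImD !cImN cImM /A /=; ring.
    + apply: le_trans r1; apply: le_trans (ler_Re_cmod _).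
      rewrite le_eqVlt; apply/orP; left; apply/eqP; congr `|_|.
      by rewrite /r xyE !cReD !cReN cReM /B /=; ring.
  exact: (circulation_closed_form w0 pi2 hP hQ dAB).
have Pper (x : R) : P x T = P x 0.
  congr (Rintegral _ _ _); apply/funext => t.
  by rewrite /A /g Tper.
have Jeq : Q x2 T - Q x2 0 = Q x1 T - Q x1 0.
  move: circ0; rewrite /circulation (addrC x1) subrK add0r !Pper.
  move: (P x2 0) (P x1 0) (Q x2 T) (Q x2 0) (Q x1 T) (Q x1 0) => *; lra.
have mean (x c b : R) : x <= x2 ->
    (forall y, `|B x y - c| <= b) ->
    `|Q x T - Q x 0 - c * T| <= b * T.
  move=> xx2 Bc.
  have dQx (y : R) : 0 <= y <= T -> is_derive y 1 (Q x) (B x y) by exact: dQ.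
  have bx (y : R) : 0 <= y <= T -> `|B x y - (c + 0 * (y - 0))| <= b.
    by move=> _; rewrite mul0r addr0.
  have := increment_affine_bound (ltW pi2) dQx bx.
  by rewrite !mul0r !subr0 addr0.
have m1 : `|Q x1 T - Q x1 0 - complex.Re L * T| <= e * T.
  apply: mean; first exact: ltW.
  move=> y; rewrite /B -cReN -cReD; apply: le_trans (ler_Re_cmod _) _.
  by apply: fLd; rewrite cmod_cexp /= expR_gt0.
have m2 : `|Q x2 T - Q x2 0| <= M * T.
  rewrite -[X in `|X|]subr0 -{2}(mul0r T); apply: mean => // y.
  by rewrite subr0; apply: fM; rewrite cmod_cexp /= lnK.
rewrite -(ler_pM2r pi2) -[X in _ * X]ger0_norm ?(ltW pi2)// -normrM.
rewrite Jeq in m2; have := lerB_dist.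
have -> : complex.Re L * T = Q x1 T - Q x1 0
  - (Q x1 T - Q x1 0 - complex.Re L * T) by ring.
move=> _; apply: le_trans (ler_normB _ _) _.
by rewrite mulrDl addrC lerD// ger0_norm// ltW.
Qed.
End MeanValue.

(** * Lipschitz estimate for bounded holomorphic functions *)

Section Cauchy_estimate.
Variable R : realType.

Lemma is_derive_remainder (f : R -> R) (x D : R) :
  (forall e : R, 0 < e -> exists2 d : R, 0 < d &
     forall u, `|u| < d -> `|f (x + u) - f x - D * u| <= e * `|u|) ->
  is_derive x 1 f D.
Proof.
move=> H.
have C : (fun h : R => h^-1 *: (f (h *: (1 : R) + x) - f x)) @ 0^' --> D.
  apply/cvgrPdist_le => e e0; have [d d0 Hd] := H _ e0.
  near=> u.
  have u0 : u != 0 by near: u; exact: nbhs_dnbhs_neq.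
  have ud : `|u| < d.
    near: u; apply/nbhs_ballP; exists d => //= u.
    by rewrite -ball_normE /= sub0r normrN.
  have := Hd _ ud.
  rewrite -[u *: 1]/(u * 1) mulr1 (addrC u x) => {}Hd.
  have -> : D - u^-1 *: (f (x + u) - f x) = - (u^-1 * (f (x + u) - f x - D * u)).
    by rewrite -[_ *: _]/(_ * _); field.
  rewrite normrN normrM normfV mulrC ler_pdivrMr ?normr_gt0//.
apply: DeriveDef; last exact/cvg_lim.
by apply/cvg_ex; exists D.
Unshelve. all: by end_near. Qed.

Lemma disc_holomorphic_cderiv (f : Cplx R -> Cplx R) (z : R[i]) :
  holomorphic_on (@disc R) f -> cmod z < 1 -> exists D, cderiv f z D.
Proof. by move=> hf z1; apply: differentiable_cderiv; exact: hf. Qed.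

(** The derivative at [0] is the value at the puncture of the difference
    quotient [(f z - f 0) / z], whose mean over circles is constant. *)
Lemma cauchy_estimate_Re (f : Cplx R -> Cplx R) (M : R) (D : R[i]) :
  holomorphic_on (@disc R) f -> (forall z, disc z -> cmod (f z) <= M) ->
  cderiv f 0 D -> `|complex.Re D| <= 4 * M.
Proof.
move=> hf fM fD.
pose h : Cplx R -> Cplx R := fun z => (f z - f 0) / z.
have d0 : @disc R 0 by rewrite /disc /= cmod0.
apply: (@punctured_mean_bound _ h D (1 / 2)).
- move=> z /andP[z0 z1]; apply: (@differentiable_cderiv _ h).
  apply: differentiableM.
    by apply: differentiableB => //; exact: hf.
  by apply: (@differentiableV _ _ id) => //; rewrite -cmod_gt0.
- move=> e e0; have [d dgt0 Hd] := fD _ e0; exists d => // z /andP[z0 zd].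
  have := Hd _ zd; rewrite add0r.
  have zn0 : z != 0 by rewrite -cmod_gt0.
  have -> : h z - D = (f z - f 0 - D * z) / z by rewrite /h; field.
  by rewrite cmodM cmodV ler_pdivrMr.
- by apply/andP; split; lra.
move=> z z2; apply: le_trans (ler_Re_cmod _) _.
rewrite /h cmodM cmodV z2.
have z1 : disc z by rewrite /disc /= z2; lra.
have := ler_cmodD (f z) (- f 0); rewrite cmodN.
have := fM _ z1; have := fM _ d0; lra.
Qed.

Lemma bounded_holomorphic_lipschitz_Re (f : Cplx R -> Cplx R) (M s t : R) :
  holomorphic_on (@disc R) f -> (forall z, disc z -> cmod (f z) <= M) ->
  0 <= s <= t -> t <= 1 / 2 ->
  `|complex.Re (f t%:C) - complex.Re (f s%:C)| <= 8 * M * (t - s).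
Proof.
move=> hf fM /andP[s0 st] t2.
(* the discs of radius [1/2] around the points of the segment lie in the unit
   disc; rescaling them doubles the constant of the estimate at the centre *)
have D8 (x : R) : 0 <= x <= 1 / 2 -> exists2 D, cderiv f x%:C D &
    `|complex.Re D| <= 8 * M.
  move=> /andP[x0 x2].
  have [|D fD] := @disc_holomorphic_cderiv f x%:C hf.
    by rewrite cmodR ger0_norm//; lra.
  exists D => //; pose l : Cplx R -> Cplx R := fun z => x%:C + (1 / 2)%:C * z.
  have ld z : disc z -> disc (l z).
    rewrite /disc /l /= => z1; apply: le_lt_trans (ler_cmodD _ _) _.
    by rewrite cmodM !cmodR !ger0_norm//; lra.
  have dl z : differentiable l z.
    by apply: differentiableD => //; apply: differentiableM.
  have fl : cderiv (f \o l) 0 (D * (1 / 2)%:C).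
    apply: cderiv_comp; last by rewrite /l mulr0 addr0.
    move=> e e0; exists 1 => // h _.
    rewrite /l add0r; have -> : x%:C + (1 / 2)%:C * h - (x%:C + (1 / 2)%:C * 0) - (1 / 2)%:C * h = 0 by ring.
    by rewrite cmod0 mulr_ge0 ?cmod_ge0 ?ltW.
  have := @cauchy_estimate_Re (f \o l) M _ _ _ fl.
  rewrite cReM /= mulr0 subr0 normrM [`|1 / 2|]ger0_norm ?divr_ge0//.
  have : holomorphic_on (@disc R) (f \o l).
    by move=> z /ld lz; apply: differentiable_comp => //; exact: hf.
  move=> h1 h2; have {h2} := h2 h1 (fun z dz => fM _ (ld z dz)); lra.
pose df (x : R) : R := if pselect (0 <= x <= 1 / 2) is left xP then complex.Re (sval (cid2 (D8 x xP))) else 0.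
have fdf (x : R) : 0 <= x <= 1 / 2 -> is_derive x 1 (fun x : R => complex.Re (f x%:C)) (df x) /\ `|df x| <= 8 * M.
  rewrite /df; case: pselect => // xP _; case: cid2 => D /= fD D8M; split => //.
  apply: is_derive_remainder => e e0; have [d d0 H] := fD _ e0.
  exists d => // u ud; have := H u%:C; rewrite cmodR => /(_ ud); apply: le_trans.
  rewrite rmorphD; apply: le_trans (ler_Re_cmod _); rewrite le_eqVlt.
  by apply/orP; left; rewrite !cReD !cReN cReM /= mulr0 subr0.
have dd (x : R) : s <= x <= t -> is_derive x 1 (fun x : R => complex.Re (f x%:C)) (df x).
  by move=> /andP[xs xt]; apply: (fdf x _).1; apply/andP; split; lra.
have db (x : R) : s <= x <= t -> `|df x - (0 + 0 * (x - 0))| <= 8 * M.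
  by rewrite mul0r addr0 subr0 => /andP[xs xt]; apply: (fdf x _).2; apply/andP; split; lra.
by have := increment_affine_bound st dd db; rewrite !mul0r addr0 subr0.
Qed.

Lemma bounded_holomorphic_lipschitz (f : Cplx R -> Cplx R) (M s t : R) :
  holomorphic_on (@disc R) f -> (forall z, disc z -> cmod (f z) <= M) ->
  0 <= s <= t -> t <= 1 / 2 ->
  cmod (f t%:C - f s%:C) <= 16 * M * (t - s).
Proof.
move=> hf fM st t2.
(* the imaginary part of [f] is the real part of [- i f] *)
pose ni : R[i] := 0 +i* (- 1).
pose g : Cplx R -> Cplx R := fun z => (ni : Cplx R) * f z.
have hg : holomorphic_on (@disc R) g.
  by move=> z dz; apply: differentiableM => //; exact: hf.
have gM z : disc z -> cmod (g z) <= M.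
  move=> dz; rewrite /g cmodM.
  have -> : cmod ni = 1 by rewrite /cmod normc_def /= expr0n add0r sqrrN expr1n sqrtr1.
  by rewrite mul1r fM.
have Re1 := bounded_holomorphic_lipschitz_Re hf fM st t2.
have Im1 := bounded_holomorphic_lipschitz_Re hg gM st t2.
apply: le_trans (ler_cmod_ReIm _) _.
rewrite cReD cImD cReN cImN.
move: Im1; rewrite /g !cReM /= !mul0r !sub0r !mulN1r !opprK => Im1.
lra.
Qed.
End Cauchy_estimate.

(** * A cubical Sperner lemma *)
Section Cubical.
Variable n : nat.
Local Notation point := ('I_n -> nat).
Implicit Types (v w : point) (J : {set 'I_n}) (i j l : 'I_n).

Definition update v j (t : nat) : point := fun i => if i == j then t else v i.
Definition step v j : point := update v j (v j).+1.

Lemma stepC v j l : step (step v j) l = step (step v l) j.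
Proof.
have [->//|jl] := eqVneq j l.
apply/funext => i; rewrite /step /update (negbTE jl) [l == j]eq_sym (negbTE jl).
by have [->|//] := eqVneq i l; rewrite eq_sym (negbTE jl).
Qed.

(** [cup hs v J] is the value, on the face of the unit cube at [v] spanned by
    the directions in [J], of the cup product of the coboundaries of the
    functions [hs], taken modulo 2. *)
Fixpoint cup (hs : seq (point -> 'F_2)) v J : 'F_2 :=
  if hs is h :: hs' then
    \sum_(j in J) (h (step v j) + h v) * cup hs' (step v j) (J :\ j)
  else 1.

Lemma addF2 (x : 'F_2) : x + x = 0.
Proof. by rewrite -mulr2n -mulr_natr pchar_Zp // mulr0. Qed.

(** Each unordered pair occurs twice. *)
Lemma sum_sym_pairs (F : 'I_n -> 'I_n -> 'F_2) J :
  (forall j l, F j l = F l j) -> \sum_(j in J) \sum_(l in J :\ j) F j l = 0.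
Proof.
move=> Fsym.
have E j : \sum_(l in J :\ j) F j l =
    \sum_(l in J | (l < j)%N) F j l + \sum_(l in J | (j < l)%N) F j l.
  rewrite (bigID (fun l : 'I_n => (l < j)%N)) /=.
  by congr (_ + _); apply: eq_bigl => l; rewrite !inE -val_eqE /=;
    case: ltngtP; rewrite ?andbT ?andbF.
have swap : \sum_(j in J) \sum_(l in J | (j < l)%N) F j l =
    \sum_(j in J) \sum_(l in J | (l < j)%N) F j l.
  rewrite (exchange_big_dep (fun j => j \in J)) //=; last by move=> ? ? ? /andP[].
  by apply: eq_bigr => j jJ; apply: eq_big => [l|l _]; [rewrite jJ|exact: Fsym].
by rewrite (eq_bigr _ (fun j _ => E j)) big_split /= swap addF2.
Qed.

(** [cup hs] is a cocycle. In the sum over pairs of directions all the terms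
    that are symmetric in the pair cancel modulo 2, and those that remain are
    cocycle identities for the product of the other factors. *)
Lemma cup_closed hs v J : \sum_(j in J) cup hs (step v j) (J :\ j) =
  \sum_(j in J) cup hs v (J :\ j).
Proof.
elim: hs v J => [//|h hs IH] v J /=.
pose W w j l := cup hs w (J :\ j :\ l).
have Wsym w j l : W w j l = W w l j by rewrite /W !finset.setDDl finset.setUC.
have diag (G : 'I_n -> 'I_n -> 'F_2) : \sum_(j in J) \sum_(l in J :\ j) G j l =
    \sum_(j in J) \sum_(l in J :\ j) G l j.
  rewrite (exchange_big_dep (fun l => l \in J)) /=; last first.
    by move=> j l _; rewrite !inE => /andP[].
  apply: eq_bigr => l lJ; apply: eq_bigl => j.
  by rewrite !inE lJ andbT eq_sym andbC.
have lhs : \sum_(j in J) \sum_(l in J :\ j)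
      (h (step (step v j) l) + h (step v j)) * W (step (step v j) l) j l =
    \sum_(j in J) \sum_(l in J :\ j) h (step v j) * W (step v j) j l.
  under eq_bigr do under eq_bigr do rewrite mulrDl.
  under eq_bigr do rewrite big_split /=.
  rewrite big_split /= sum_sym_pairs ?add0r; last first.
    by move=> j l; rewrite stepC Wsym.
  by apply: eq_bigr => j jJ; rewrite -!mulr_sumr IH.
have rhs : \sum_(j in J) \sum_(l in J :\ j)
      (h (step v l) + h v) * W (step v l) j l =
    \sum_(j in J) \sum_(l in J :\ j) h (step v l) * W (step v l) j l.
  under eq_bigr do under eq_bigr do rewrite mulrDl.
  under eq_bigr do rewrite big_split /=.
  rewrite big_split /= [X in _ + X](_ : _ = 0) ?addr0//.
  under eq_bigr do rewrite -mulr_sumr IH mulr_sumr.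
  by apply: sum_sym_pairs => j l; rewrite -/(W v j l) Wsym.
rewrite lhs rhs diag; apply: eq_bigr => j _; apply: eq_bigr => l _.
by rewrite Wsym.
Qed.

(** A factor that is constant along the hyperplane through the face has a zero
    coboundary there. *)
Lemma cup_eq0 hs h v J j (c : nat) (a : 'F_2) : h \in hs ->
  (forall w, w j = c -> h w = a) -> v j = c -> j \notin J -> cup hs v J = 0.
Proof.
elim: hs v J => [//|g hs IH] v J; rewrite inE => /orP[/eqP <-|hhs] ha vj jJ /=;
  apply: big1 => l lJ; have jl : j != l by apply: contraNneq jJ => ->.
  by rewrite !ha ?addF2 ?mul0r// /step /update (negbTE jl).
rewrite IH ?mulr0//; last by rewrite !inE (negbTE jJ) andbF.
by rewrite /step /update (negbTE jl).
Qed.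

Definition in_cube v J w := forall j, (v j <= w j <= v j + (j \in J))%N.

Lemma cup_neq0 hs h v J : cup hs v J != 0 -> h \in hs ->
  exists w w', [/\ in_cube v J w, in_cube v J w' & h w != h w'].
Proof.
elim: hs v J => [//|g hs IH] v J /= nz hhs.
have [j jJ] : exists2 j, j \in J &
    (g (step v j) + g v) * cup hs (step v j) (J :\ j) != 0.
  apply/exists_inP; apply: contraNT nz => /exists_inPn nz.
  by rewrite big1// => j jJ; apply/eqP; rewrite -[_ == _]negbK; exact: nz.
rewrite mulf_eq0 negb_or => /andP[gne cne].
have step_j i : step v j i = (v i + (i == j))%N.
  by rewrite /step /update; case: eqVneq => [->|]; rewrite ?addn1 ?addn0.
move: hhs; rewrite inE => /orP[/eqP ->|hhs].
  exists (step v j), v; split.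
  - move=> i; rewrite step_j leq_addr leq_add2l /=.
    by case: eqVneq => [->|//]; rewrite jJ.
  - by move=> i; rewrite leqnn leq_addr.
  - by apply: contraNneq gne => ->; rewrite addF2.
have [w [w' [cw cw' ww']]] := IH _ _ cne hhs.
have sub u : in_cube (step v j) (J :\ j) u -> in_cube v J u.
  move=> cu i; have := cu i; rewrite step_j !inE; case: eqVneq => [->|_] /=.
    by rewrite jJ addn0 => /andP[lo ->]; rewrite (leq_trans _ lo)// leq_addr.
  by rewrite addn0.
by exists w, w'; split => //; exact: sub.
Qed.

Variable N : nat.

(** Iterated over the coordinates in [s], so that one of them at a time can be
    summed by parts. *)
Fixpoint box_sum (s : seq 'I_n) (F : point -> 'F_2) v : 'F_2 :=
  if s is j :: s' then \sum_(t < N) box_sum s' F (update v j t) else F v.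

Lemma eq_box_sum s F G v : F =1 G -> box_sum s F v = box_sum s G v.
Proof. by move=> /funext ->. Qed.

Lemma box_sum0 s v : box_sum s (fun=> 0) v = 0.
Proof. by elim: s v => [//|j s IH] v /=; apply: big1 => t _; exact: IH. Qed.

Lemma box_sum_sum s (I : finType) (P : pred I) (F : I -> point -> 'F_2) v :
  box_sum s (fun w => \sum_(i | P i) F i w) v =
  \sum_(i | P i) box_sum s (F i) v.
Proof.
elim: s v => [//|j s IH] v /=; rewrite exchange_big /=.
by apply: eq_bigr => t _; rewrite IH.
Qed.

Lemma updateC v j l (t u : nat) : j != l ->
  update (update v j t) l u = update (update v l u) j t.
Proof.
move=> jl; apply/funext => i; rewrite /update.
by have [->|//] := eqVneq i l; rewrite eq_sym (negbTE jl).
Qed.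

Lemma box_sum_update s F v j (t : nat) : j \notin s ->
  box_sum s F (update v j t) = box_sum s (fun w => F (update w j t)) v.
Proof.
elim: s v => [//|l s IH] v /=; rewrite inE negb_or => /andP[jl js].
by apply: eq_bigr => u _; rewrite -IH// updateC.
Qed.

Lemma box_sum_telescope s F v j : uniq s -> j \in s ->
  box_sum s (fun w => F (step w j) + F w) v =
  box_sum (rem j s) (fun w => F (update w j N) + F (update w j 0%N)) v.
Proof.
elim: s v => [//|l s IH] v /= /andP[ls us]; rewrite inE.
have [-> _|jl /= js] := eqVneq j l; last first.
  by apply: eq_bigr => t _; exact: IH.
under eq_bigr do rewrite box_sum_update//.
rewrite -(@box_sum_sum s 'I_N xpredT
  (fun t w => F (step (update w l t) l) + F (update w l t))).
apply: eq_box_sum => w.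
have upd t : step (update w l t) l = update w l t.+1.
  by apply/funext => i; rewrite /step /update eqxx; case: eqP.
under eq_bigr do rewrite upd.
have opp2 (x : 'F_2) : - x = x by apply/eqP; rewrite eq_sym -addr_eq0 addF2.
rewrite -[F (update w l 0%N)]opp2 -(telescope_sumr (fun t => F (update w l t)) (leq0n N)).
by rewrite big_mkord; apply: eq_bigr => t _; rewrite opp2.
Qed.

Lemma box_sum_neq0 s F v : box_sum s F v != 0 -> exists w, F w != 0 /\
  forall j, if j \in s then (w j < N)%N else w j == v j.
Proof.
elim: s v => [v Fv|j s IH v /= nz]; first by exists v; split => // j; rewrite in_nil.
have [t] : exists t : 'I_N, box_sum s F (update v j t) != 0.
  apply/existsP; apply: contraNT nz => /existsPn nz.
  by rewrite big1// => t _; apply/eqP; rewrite -[_ == _]negbK; exact: nz.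
move=> /IH[w [Fw wv]]; exists w; split => // i; have := wv i.
rewrite inE /update; have [->|_] := eqVneq i j => /=; last by [].
by case: ifP => // _ /eqP ->.
Qed.

(** Stokes: the coboundary of the first factor is summed by parts, and of the
    boundary terms only the one on the face where that factor is 1 survives,
    which is the same sum in one dimension less. *)
Lemma box_sum_cup (h : 'I_n -> point -> 'F_2) (s : seq 'I_n) v : uniq s ->
  (forall j w, w j = 0%N -> h j w = 0) -> (forall j w, w j = N -> h j w = 1) ->
  (forall j, j \notin s -> v j = N) ->
  box_sum s (fun w => cup (map h s) w [set j in s]) v = 1.
Proof.
move=> + h0 h1; elim: s v => [//|j0 s IH] v us vN.
have [j0s us'] : j0 \notin s /\ uniq s by apply/andP.
pose J := [set j in j0 :: s].
pose G j w := h j0 w * cup (map h s) w (J :\ j).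
have J0 : J :\ j0 = [set j in s].
  by apply/setP => i; rewrite !inE; case: eqVneq => [->|//]; rewrite (negbTE j0s).
have FG w : cup (map h (j0 :: s)) w J = \sum_(j in J) (G j (step w j) + G j w).
  rewrite /= big_split /= -(mulr_sumr _ _ _ (h j0 w)) -cup_closed mulr_sumr -big_split /=.
  by apply: eq_bigr => j _; rewrite mulrDl.
rewrite (eq_box_sum _ _ FG) box_sum_sum.
have Jj0 : j0 \in J by rewrite !inE eqxx.
have term j : j \in J -> box_sum (j0 :: s) (fun w => G j (step w j) + G j w) v =
    box_sum (rem j (j0 :: s)) (fun w => G j (update w j N) + G j (update w j 0%N)) v.
  by rewrite inE => jJ; exact: box_sum_telescope.
have updE w j t : update w j t j = t by rewrite /update eqxx.
rewrite (eq_bigr _ term) (bigD1 j0)//= eqxx big1 ?addr0; last first.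
  move=> j /andP[jJ jj0].
  have js : j \in s by move: jJ; rewrite !inE (negbTE jj0).
  have G0 w : G j (update w j N) + G j (update w j 0%N) = 0.
    have z c a : (forall u, u j = c -> h j u = a) ->
        cup (map h s) (update w j c) (J :\ j) = 0.
      move=> ha; apply: (cup_eq0 (map_f h js) ha (updE _ _ _)).
      by rewrite !inE eqxx.
    by rewrite /G (z N 1 (h1 j)) (z 0%N 0 (h0 j)) !mulr0 addr0.
  by rewrite (eq_box_sum _ _ G0) box_sum0.
have G1 w : G j0 (update w j0 N) + G j0 (update w j0 0%N) =
    cup (map h s) (update w j0 N) [set j in s].
  by rewrite /G (h0 _ _ (updE _ _ _)) (h1 _ _ (updE _ _ _)) mul0r mul1r addr0 J0.
rewrite (eq_box_sum _ _ G1) -(box_sum_update (fun w => cup (map h s) w _))//.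
apply: IH => // j js; rewrite /update; case: eqVneq => // jj0.
by apply: vN; rewrite inE negb_or jj0.
Qed.

(** A discrete form of the Poincare-Miranda theorem. If on every cube one of the
    labels were constant, all the terms of the sum in [box_sum_cup] would
    vanish. *)
Lemma fully_labelled_cube (h : 'I_n -> point -> bool) :
  (forall j w, w j = 0%N -> h j w = false) -> (forall j w, w j = N -> h j w) ->
  exists v, (forall j, (v j < N)%N) /\ forall j, exists w w',
    [/\ in_cube v finset.setT w, in_cube v finset.setT w' & h j w != h j w'].
Proof.
move=> h0 h1; pose hF j w : 'F_2 := (h j w)%:R.
have J1 : [set j in enum 'I_n] = finset.setT.
  by apply/setP => j; rewrite !inE mem_enum.
have F1 : box_sum (enum 'I_n) (fun w => cup (map hF (enum 'I_n)) w finset.setT)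
    (fun=> N) = 1.
  rewrite -J1; apply: box_sum_cup => //; first exact: enum_uniq.
  - by move=> j w /h0 hj; rewrite /hF hj.
  - by move=> j w /h1 hj; rewrite /hF hj.
have [v [cv vN]] := box_sum_neq0 (etrans (congr1 (fun x => x != 0) F1) isT).
exists v; split=> j; first by have := vN j; rewrite mem_enum.
have hj : hF j \in map hF (enum 'I_n) by rewrite map_f ?mem_enum.
have [w [w' [cw cw' ww']]] := cup_neq0 cv hj.
by exists w, w'; split => //; apply: contraNneq ww'; rewrite /hF => ->.
Qed.
End Cubical.

(** * Euclidean norms and continuity by coordinates *)
Section Euclidean_norm.
Variable R : realType.

Definition l2 (n : nat) (x : 'rV[R]_n) : R := Num.sqrt (\sum_(i < n) x 0 i ^+ 2).

Variable n : nat.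
Implicit Types (x y : 'rV[R]_n) (z w : Cspace R n).

Lemma sum_sqr_ge0 x : 0 <= \sum_(i < n) x 0 i ^+ 2.
Proof. by apply: sumr_ge0 => i _; exact: sqr_ge0. Qed.

Lemma l2_ge0 x : 0 <= l2 x.
Proof. exact: sqrtr_ge0. Qed.

Lemma l2_sqr x : l2 x ^+ 2 = \sum_(i < n) x 0 i ^+ 2.
Proof. by rewrite sqr_sqrtr// sum_sqr_ge0. Qed.

Lemma l2Z (a : R) x : l2 (a *: x) = `|a| * l2 x.
Proof.
rewrite /l2 -sqrtr_sqr -sqrtrM ?sqr_ge0// mulr_sumr.
by congr Num.sqrt; apply: eq_bigr => i _; rewrite mxE exprMn.
Qed.

Lemma l2N x : l2 (- x) = l2 x.
Proof. by rewrite -scaleN1r l2Z normrN1 mul1r. Qed.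

Lemma l2_coord x i : `|x 0 i| <= l2 x.
Proof.
rewrite -sqrtr_sqr ler_wsqrtr// (bigD1 i)//= lerDl.
by apply: sumr_ge0 => j _; exact: sqr_ge0.
Qed.

Lemma l2_eq0 x : (l2 x == 0) = (x == 0).
Proof.
apply/eqP/eqP => [x0|->]; last first.
  by rewrite /l2 big1 ?sqrtr0// => i _; rewrite mxE expr0n.
apply/rowP => i; rewrite mxE; apply/eqP.
by rewrite -normr_le0 -x0 l2_coord.
Qed.

Lemma l2_gt0 x : (0 < l2 x) = (x != 0).
Proof. by rewrite lt_def l2_ge0 andbT l2_eq0. Qed.

Lemma dot_le_l2 x y : \sum_(i < n) x 0 i * y 0 i <= l2 x * l2 y.
Proof.
have [->|x0] := eqVneq x 0.
  rewrite [X in X <= _]big1 ?mulr_ge0 ?l2_ge0// => i _; by rewrite mxE mul0r.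
have [->|y0] := eqVneq y 0.
  rewrite [X in X <= _]big1 ?mulr_ge0 ?l2_ge0// => i _; by rewrite mxE mulr0.
have lx : 0 < l2 x by rewrite l2_gt0.
have ly : 0 < l2 y by rewrite l2_gt0.
(* this sum is [2 |x| |y| (|x| |y| - <x, y>)] *)
have : 0 <= \sum_(i < n) (l2 y * x 0 i - l2 x * y 0 i) ^+ 2.
  by apply: sumr_ge0 => i _; exact: sqr_ge0.
have -> : \sum_(i < n) (l2 y * x 0 i - l2 x * y 0 i) ^+ 2 =
  l2 y ^+ 2 * (\sum_(i < n) x 0 i ^+ 2) - (2 * l2 x * l2 y) * (\sum_(i < n) x 0 i * y 0 i)
  + l2 x ^+ 2 * (\sum_(i < n) y 0 i ^+ 2).
  rewrite !mulr_sumr -sumrB -big_split /=; apply: eq_bigr => i _; ring.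
rewrite -!l2_sqr => H.
have {H} : 0 <= (2 * l2 x * l2 y) * (l2 x * l2 y - \sum_(i < n) x 0 i * y 0 i).
  by apply: le_trans H _; rewrite le_eqVlt; apply/orP; left; apply/eqP; ring.
by rewrite pmulr_rge0 ?mulr_gt0// subr_ge0.
Qed.

Lemma ler_l2D x y : l2 (x + y) <= l2 x + l2 y.
Proof.
rewrite -ler_sqr ?nnegrE ?addr_ge0 ?l2_ge0//.
rewrite l2_sqr sqrrD !l2_sqr.
have -> : \sum_(i < n) (x + y) 0 i ^+ 2 = \sum_(i < n) x 0 i ^+ 2
   + (\sum_(i < n) x 0 i * y 0 i) *+ 2 + \sum_(i < n) y 0 i ^+ 2.
  rewrite -sumrMnl -!big_split /=; apply: eq_bigr => i _.
  by rewrite mxE sqrrD.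
by rewrite lerD2r lerD2l ler_wMn2r// dot_le_l2.
Qed.

Lemma ler_l2_sum x : l2 x <= \sum_(i < n) `|x 0 i|.
Proof.
have s0 : 0 <= \sum_(i < n) `|x 0 i| by apply: sumr_ge0.
rewrite -ler_sqr ?nnegrE ?l2_ge0// l2_sqr expr2 mulr_suml.
apply: ler_sum => i _; rewrite -real_normK ?num_real// expr2 ler_wpM2l//.
by rewrite (bigD1 i)//= lerDl; apply: sumr_ge0.
Qed.

Lemma l2B_dist x y : `|l2 x - l2 y| <= l2 (x - y).
Proof.
rewrite ler_norml; apply/andP; split.
  have := ler_l2D x (y - x); rewrite addrCA subrr addr0 -(l2N (y - x)) opprB.
  lra.
have := ler_l2D y (x - y); rewrite addrCA subrr addr0; lra.
Qed.

Definition reV z : 'rV[R]_n := map_mx (@complex.Re R) z.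
Definition imV z : 'rV[R]_n := map_mx (@complex.Im R) z.

Lemma enorm_sqr z : enorm z ^+ 2 = l2 (reV z) ^+ 2 + l2 (imV z) ^+ 2.
Proof.
rewrite /enorm sqr_sqrtr; last by apply: sumr_ge0 => i _; exact: sqr_ge0.
by rewrite !l2_sqr -big_split; apply: eq_bigr => i _ /=; rewrite cmod_sqr !mxE.
Qed.

Lemma enorm_ge0 z : 0 <= enorm z. Proof. exact: sqrtr_ge0. Qed.

End Euclidean_norm.

Lemma sphereP (R : realType) k (x : 'rV[R]_k.+1) : sphere R k x <-> l2 x = 1.
Proof.
rewrite /sphere /= -l2_sqr; split=> [/eqP|->]; last by rewrite expr1n.
by rewrite sqrp_eq1 ?l2_ge0// => /eqP.
Qed.

Section Enorm.
Variables (R : realType) (n : nat).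
Implicit Types (z w : Cspace R n).

(** The triangle inequality for [enorm] is read off from this identification
    of [C^n] with [R^(2n)]. *)
Lemma enormE z : enorm z = l2 (row_mx (reV z) (imV z)).
Proof.
apply/eqP; rewrite -(eqrXn2 (ltn0Sn 1)) ?enorm_ge0 ?l2_ge0// enorm_sqr !l2_sqr.
rewrite big_split_ord /=; apply/eqP; congr (_ + _).
  by apply: eq_bigr => i _; rewrite row_mxEl.
by apply: eq_bigr => i _; rewrite row_mxEr.
Qed.

Lemma reVD z w : reV (z + w) = reV z + reV w.
Proof. by apply/rowP => i; rewrite !mxE cReD. Qed.
Lemma imVD z w : imV (z + w) = imV z + imV w.
Proof. by apply/rowP => i; rewrite !mxE cImD. Qed.

Lemma ler_enormD z w : enorm (z + w) <= enorm z + enorm w.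
Proof. by rewrite !enormE reVD imVD -add_row_mx ler_l2D. Qed.

Lemma enormZ (a : Cplx R) z : enorm (a *: z) = cmod a * enorm z.
Proof.
rewrite /enorm -[cmod a]ger0_norm ?cmod_ge0// -sqrtr_sqr -sqrtrM ?sqr_ge0//.
rewrite mulr_sumr; congr Num.sqrt; apply: eq_bigr => i _.
by rewrite mxE -exprMn -cmodM.
Qed.

Lemma cmod_le_enorm z i : cmod (z 0 i) <= enorm z.
Proof.
rewrite -[leLHS]ger0_norm ?cmod_ge0// -sqrtr_sqr ler_wsqrtr// (bigD1 i)//= lerDl.
by apply: sumr_ge0 => j _; exact: sqr_ge0.
Qed.

Lemma enorm_le_sum z : enorm z <= \sum_(i < n) cmod (z 0 i).
Proof.
have s0 : 0 <= \sum_(i < n) cmod (z 0 i) by apply: sumr_ge0 => i _; exact: cmod_ge0.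
rewrite -ler_sqr ?nnegrE ?enorm_ge0// /enorm sqr_sqrtr; last first.
  by apply: sumr_ge0 => i _; exact: sqr_ge0.
rewrite expr2 mulr_suml; apply: ler_sum => i _.
rewrite expr2 ler_wpM2l ?cmod_ge0//.
by rewrite (bigD1 i)//= lerDl; apply: sumr_ge0 => j _; exact: cmod_ge0.
Qed.

Lemma enorm_eq0 z : (enorm z == 0) = (z == 0).
Proof.
apply/eqP/eqP => [z0|->]; last first.
  by rewrite /enorm big1 ?sqrtr0// => i _; rewrite mxE cmod0 expr0n.
apply/rowP => i; rewrite mxE; apply/eqP; rewrite -cmod_eq0 eq_le cmod_ge0 andbT.
by rewrite -z0 cmod_le_enorm.
Qed.

End Enorm.

Section Continuity_by_coordinates.
Variable R : realType.

Lemma cvg_row (T : topologicalType) (U : Type) (F : set_system U) (FF : Filter F)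
    n (f : U -> 'rV[T]_n) (l : 'rV[T]_n) :
  (forall i, f x 0 i @[x --> F] --> l 0 i) -> f @ F --> l.
Proof.
move=> fl A [P lP PA].
apply: filterS (@filter_forall _ _ (fun i x => P 0 i (f x 0 i)) F FF
  (fun i => fl i _ (lP 0 i))) => x Px.
by apply: PA => i j; rewrite (ord1 i); exact: Px.
Qed.

Lemma nbhs_cplx (z : Cplx R) (A : set (Cplx R)) : nbhs z A <->
  exists2 d : R, 0 < d & forall w : Cplx R, cmod (w - z) < d -> A w.
Proof.
split=> [/nbhs_ballP[e /= /gt0_complex[d d0 ->] dA]|[d d0 dA]].
  exists d => // w zw; apply: dA; rewrite -ball_normE /=.
  by rewrite distrC normCE ltcR.
apply/nbhs_ballP; exists d%:C; rewrite /= ?ltcR// => w.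
by rewrite -ball_normE /= distrC normCE ltcR; exact: dA.
Qed.

Lemma continuous_cRe : continuous (fun z : Cplx R => complex.Re z : R).
Proof.
move=> z A /nbhs_ballP[e /= e0 eA]; apply/nbhs_cplx; exists e => // w we.
apply: eA; rewrite -ball_normE /=; apply: le_lt_trans we.
by rewrite distrC -cReN -cReD ler_Re_cmod.
Qed.

Lemma continuous_cIm : continuous (fun z : Cplx R => complex.Im z : R).
Proof.
move=> z A /nbhs_ballP[e /= e0 eA]; apply/nbhs_cplx; exists e => // w we.
apply: eA; rewrite -ball_normE /=; apply: le_lt_trans we.
by rewrite distrC -cImN -cImD ler_Im_cmod.
Qed.

Lemma cvg_cplx (U : Type) (F : set_system U) (FF : Filter F)
    (f : U -> Cplx R) (l : Cplx R) :
  (complex.Re (f x) : R) @[x --> F] --> (complex.Re l : R) ->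
  (complex.Im (f x) : R) @[x --> F] --> (complex.Im l : R) -> f @ F --> l.
Proof.
move=> /cvgrPdist_lt fR /cvgrPdist_lt fI A /nbhs_cplx[d d0 dA].
have d2 : 0 < d / 2 by rewrite divr_gt0.
apply: filterS2 (fR _ d2) (fI _ d2) => x xR xI; apply: dA.
apply: le_lt_trans (ler_cmod_ReIm _) _.
by rewrite cReD cImD cReN cImN distrC (distrC (complex.Im _)); lra.
Qed.

Lemma continuous_reV n : continuous (@reV R n).
Proof.
move=> z; apply: (@cvg_row _ _ (nbhs z) _) => i.
rewrite (_ : (fun x => _) = (fun x : Cspace R n => complex.Re (x 0 i) : R)); last first.
  by apply/funext => x; rewrite mxE.
rewrite mxE; apply: (@cvg_comp _ _ _ _ (fun z : Cplx R => complex.Re z : R)).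
  exact: coord_continuous.
exact: continuous_cRe.
Qed.

End Continuity_by_coordinates.

(** * The identity of the sphere is not null-homotopic *)

Section Sphere_topology.
Variable R : realType.

Lemma within_continuous_comp (T U V : topologicalType) (A : set T) (B : set U)
    (f : T -> U) (g : U -> V) :
  {within A, continuous f} -> {within B, continuous g} ->
  (forall x, A x -> B (f x)) -> {within A, continuous (g \o f)}.
Proof.
move=> /subspace_continuousP cf /subspace_continuousP cg AB.
apply/subspace_continuousP => x Ax O Ogfx.
have := cf x Ax _ (cg (f x) (AB _ Ax) _ Ogfx).
rewrite /nbhs /= /within /=; apply: filterS => y yO Ay; exact: yO Ay (AB _ Ay).
Qed.

Lemma cvg_maxr (U : Type) (F : set_system U) (FF : Filter F) (f g : U -> R) (a b : R) :
  f @ F --> a -> g @ F --> b -> Num.max (f x) (g x) @[x --> F] --> Num.max a b.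
Proof.
move=> fa gb; rewrite maxr_absE.
rewrite (_ : (fun x => _) = (fun x => (f x + g x + `|f x - g x|) / 2)); last first.
  by apply/funext => x; rewrite maxr_absE.
apply: cvgM; last exact: cvg_cst.
by apply: cvgD; [exact: cvgD|apply: cvg_norm; exact: cvgB].
Qed.

Lemma nbhs_row n (x : 'rV[R]_n) (A : set 'rV[R]_n) (e : R) : 0 < e ->
  (forall y : 'rV[R]_n, (forall i, `|x 0 i - y 0 i| < e) -> A y) -> nbhs x A.
Proof.
move=> e0 H; apply/nbhs_ballP; exists e => // y [_ xy]; apply: H => i.
by have := xy 0 i; rewrite -ball_normE.
Qed.

Lemma continuous_l2 n : continuous (@l2 R n).
Proof.
move=> x; apply/(@cvgrPdist_lt _ _ _ (nbhs x) _) => e e0.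
have n0 : 0 < (n.+1%:R : R) by rewrite ltr0n.
apply: (@nbhs_row _ _ _ (e / n.+1%:R)); first by rewrite divr_gt0.
move=> y xy; apply: le_lt_trans (l2B_dist _ _) _.
apply: le_lt_trans (ler_l2_sum _) _.
apply: (@le_lt_trans _ _ (\sum_(i < n) e / n.+1%:R)).
  by apply: ler_sum => i _; rewrite !mxE; exact/ltW/xy.
rewrite sumr_const card_ord -[X in X < _]mulr_natr mulrAC ltr_pdivrMr//.
by rewrite ltr_pM2l// ltr_nat.
Qed.

Definition unit_vec n (x : 'rV[R]_n) : 'rV[R]_n := (l2 x)^-1 *: x.

Lemma l2_unit_vec n (x : 'rV[R]_n) : x != 0 -> l2 (unit_vec x) = 1.
Proof.
move=> x0; rewrite /unit_vec l2Z ger0_norm ?invr_ge0 ?l2_ge0//.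
by rewrite mulVf// l2_eq0.
Qed.

Lemma continuous_unit_vec n (x : 'rV[R]_n) : x != 0 -> {for x, continuous (@unit_vec n)}.
Proof.
move=> x0; apply: (@cvg_row _ _ (nbhs x) _) => i.
rewrite (_ : (fun y => _) = (fun y : 'rV[R]_n => (l2 y)^-1 * y 0 i)); last first.
  by apply/funext => y; rewrite mxE.
rewrite mxE; apply: cvgM; last exact: coord_continuous.
by apply: cvgV; [rewrite l2_eq0|exact: continuous_l2].
Qed.

End Sphere_topology.

Section Essential_identity.
Variables (R : realType) (n : nat).
Local Notation vec := 'rV[R]_n.+1.

Definition grid_point (N : nat) (w : 'I_n.+1 -> nat) : vec :=
  \row_i ((w i)%:R * 2 / N%:R - 1).

(** The Poincare-Miranda theorem for the cube [[-1, 1]^(n+1)]. On a fine grid,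
    colour the points by the signs of the coordinates of the map; a cube
    on which every colour takes both values lies near a zero. *)
Lemma outward_map_zero (G : vec -> vec) :
  continuous G ->
  (forall (x : vec) i, x 0 i = 1 -> 0 < G x 0 i) ->
  (forall (x : vec) i, x 0 i = - 1 -> G x 0 i <= 0) ->
  exists x, G x = 0.
Proof.
move=> cG G1 GN1.
pose h N j w := 0 < G (grid_point N w) 0 j.
have cell (m : nat) : exists v : 'I_n.+1 -> nat, (forall j, (v j < m.+1)%N) /\
    forall j, exists w w', [/\ in_cube v finset.setT w,
      in_cube v finset.setT w' & h m.+1 j w != h m.+1 j w'].
  apply: fully_labelled_cube => j w wj; rewrite /h.
    by apply/negbTE; rewrite -leNgt GN1// mxE wj mul0r mul0r sub0r.
  by apply: G1; rewrite mxE wj mulrAC divff ?pnatr_eq0// mul1r; ring.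
have [v vP] := choice cell.
pose x m := grid_point m.+1 (v m).
pose K : set vec := [set y | forall i, `[- 1, 1]%classic ((y : vec) ord0 i)].
have cK : compact K.
  have := @rV_compact R n.+1 (fun=> `[- 1, 1]%classic). apply=> i; exact: segment_compact.
have xK m : K (x m).
  move=> i; rewrite /= in_itv /= mxE.
  have N0 : (0 : R) < m.+1%:R by rewrite ltr0n.
  have : 0 <= (v m i)%:R * 2 / (m.+1%:R : R) <= 2.
    rewrite divr_ge0 ?mulr_ge0//= ler_pdivrMr// mulrC ler_pM2l// ler_nat.
    exact: ltnW ((vP m).1 i).
  set t := (X in 0 <= X <= _) => /andP[t0 t1].
  rewrite -[X in X - 1]/t; by apply/andP; split; lra.
have [p [_ clp]] : K `&` cluster (x @ \oo) !=set0.
  by apply: cK; exists 0%N => // m _; exact: xK.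
exists p; apply/rowP => i; rewrite mxE; apply/eqP/negPn/negP => Gp0.
have ciG : {for p, continuous (fun y : vec => G y 0 i)}.
  apply: (@continuous_comp _ _ _ G (fun y : vec => y 0 i)); [exact: cG|].
  exact: coord_continuous.
have : \forall y \near p, (0 < G y 0 i) = (0 < G p 0 i).
  have /cvgrPdist_lt/(_ `|G p 0 i|) := ciG.
  rewrite normr_gt0 => /(_ Gp0); apply: filterS => y.
  case: (ltrgt0P (G p 0 i)) Gp0 => // ? _; rewrite ltr_norml => /andP[? ?].
    by apply/idP; lra.
  by apply/negbTE; rewrite -leNgt; lra.
move=> /nbhs_ballP[e /= e0 He].
(* beyond [M] the cells have diameter less than [e / 2] *)
have [M M0 HM] : exists2 M : nat, (0 < M)%N & 2 / M%:R < e / 2.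
  pose M := (Num.trunc (4 / e)).+1.
  exists M => //; rewrite ltr_pdivrMr ?ltr0n//.
  have := truncnS_gt (4 / e).
  rewrite -/M ltr_pdivrMr//; lra.
have [y [[m Mm <-] py]] : [set x m | m in [set m | (M <= m)%N]] `&` ball p (e / 2) !=set0.
  apply: clp; last by apply: nbhsx_ballx; rewrite divr_gt0.
  by exists M => // m /= Mm; exists m.
have [w [w' [cw cw']]] := (vP m).2 i.
have near u : in_cube (v m) finset.setT u -> h m.+1 i u = (0 < G p 0 i).
  move=> cu; apply: He; split => // a j; rewrite (ord1 a) -ball_normE /=.
  have [_ /(_ 0 j)] := py; rewrite -ball_normE /= => pj.
  have N0 : (0 : R) < m.+1%:R by rewrite ltr0n.
  have : `|x m 0 j - grid_point m.+1 u 0 j| <= 2 / m.+1%:R.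
    rewrite !mxE.
    have -> : (v m j)%:R * 2 / m.+1%:R - 1 - ((u j)%:R * 2 / m.+1%:R - 1) =
        ((v m j)%:R - (u j)%:R) * (2 / m.+1%:R) :> R by ring.
    rewrite normrM [`|2 / _|]gtr0_norm ?divr_gt0// ler_piMl ?divr_ge0//.
    have /andP[c1 c2] := cu j; move: c2; rewrite inE => c2.
    have : ((v m j)%:R : R) <= (u j)%:R by rewrite ler_nat.
    have : ((u j)%:R : R) <= (v m j + 1)%:R by rewrite ler_nat.
    rewrite natrD ler_norml => ? ?; apply/andP; split; lra.
  have : 2 / m.+1%:R <= (2 / M%:R : R).
    by rewrite ler_pM2l// lef_pV2 ?posrE ?ltr0n// ler_nat leqW.
  have := ler_normD (p 0 j - x m 0 j) (x m 0 j - grid_point m.+1 u 0 j).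
  rewrite addrA subrK => h1 h2 h3; apply: le_lt_trans h1 _.
  by rewrite [e]splitr ltrD//; exact: le_lt_trans (le_trans h3 h2) HM.
by rewrite !near ?eqxx.
Qed.

(** Read along the radii of the ball, the homotopy would extend the identity of
    the sphere to a map without zeros; prolonged by [x / |x|] outside the ball,
    this map points outwards on the faces of the cube. *)
Lemma sphere_identity_essential (H : R * vec -> vec) (c : vec) :
  {within `[0, 1]%classic `*` sphere R n, continuous H} ->
  (forall t x, 0 <= t <= 1 -> sphere R n x -> H (t, x) <> 0) ->
  (forall x, sphere R n x -> H (0, x) = x) ->
  (forall x, sphere R n x -> H (1, x) = c) -> False.
Proof.
move=> cH H0 Hid Hc.
(* [1] for [|x| <= 1/2], where the map is constant, and [0] for [|x| >= 1];
   being constant near the origin it is continuous there *)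
pose time (x : vec) : R := Num.max 0 (Num.min 1 (2 - 2 * l2 x)).
have time01 x : 0 <= time x <= 1.
  by rewrite le_max lexx /= ge_max ler01 ge_min lexx.
pose G x := if l2 x <= 1 / 2 then c else H (time x, unit_vec x).
have xs (x : vec) : x != 0 -> sphere R n (unit_vec x).
  by move=> x0; apply/sphereP; exact: l2_unit_vec.
have ctime : continuous time.
  move=> x; apply: (@cvg_maxr _ _ (nbhs x) _); first exact: cvg_cst.
  rewrite (_ : (fun y => _) = (fun y => - Num.max (- 1) (- (2 - 2 * l2 y)))).
    rewrite -[Num.min 1 _]opprK oppr_min; apply: cvgN.
    apply: (@cvg_maxr _ _ (nbhs x) _); first exact: cvg_cst.
    apply: cvgN; apply: cvgB; first exact: cvg_cst.
    by apply: cvgM; [exact: cvg_cst|exact: continuous_l2].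
  by apply/funext => y; rewrite -oppr_min opprK.
have G_H (x : vec) : x != 0 -> G x = H (time x, unit_vec x).
  move=> x0; rewrite /G; case: ifPn => // x2.
  have -> : time x = 1.
    rewrite /time min_l ?max_r ?ler01//; lra.
  by rewrite Hc//; exact: xs.
have l20 : l2 (0 : vec) = 0 by apply/eqP; rewrite l2_eq0.
have cG : continuous G.
  move=> x; have [x0|x0] := eqVneq x 0.
    have nx : \forall y \near x, l2 y < 1 / 2.
      have /cvgrPdist_lt/(_ (1 / 2)) := @continuous_l2 R n.+1 x.
      rewrite x0 l20 divr_gt0// => /(_ isT); apply: filterS => y.
      by rewrite sub0r normrN ger0_norm ?l2_ge0.
    have Gx : G x = c by rewrite /G x0 l20 divr_ge0.
    move=> O /nbhs_singleton; rewrite Gx => Oc.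
    by apply: filterS nx => y /ltW y2; rewrite /= /G y2.
  have nx : \forall y \near x, y != 0.
    have lx : 0 < l2 x by rewrite l2_gt0.
    have /cvgrPdist_lt/(_ _ lx) := @continuous_l2 R n.+1 x.
    apply: filterS => y; apply: contraTneq => ->.
    by rewrite l20 subr0 ger0_norm ?ltxx// ltW.
  have cHx : {within [set y : vec | y != 0], continuous (H \o (fun y => (time y, unit_vec y)))}.
    apply: (within_continuous_comp _ cH) => [|y /= y0].
      apply/subspace_continuousP => y /= y0.
      apply: cvg_within_filter.
      apply: (@cvg_pair _ _ _ (nbhs y) (nbhs (time y)) (nbhs (unit_vec y))).
        exact: ctime.
      exact: continuous_unit_vec.
    by split => /=; [rewrite in_itv /= time01|exact: xs].
  move=> O; rewrite (G_H _ x0) => Ox.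
  have /subspace_continuousP/(_ x x0 O Ox) := cHx.
  rewrite /within /nbhs /=; apply: filterS2 nx => y y0 Oy.
  by rewrite /= (G_H _ y0); exact: Oy y0.
have Gface (x : vec) i : `|x 0 i| = 1 -> G x = unit_vec x.
  move=> xi; have lx : 1 <= l2 x by rewrite -xi l2_coord.
  have x0 : x != 0 by rewrite -l2_gt0 (lt_le_trans ltr01).
  rewrite G_H//; have -> : time x = 0.
    by rewrite /time max_l// ge_min; apply/orP; right; lra.
  by rewrite Hid//; exact: xs.
have [||x Gx] := @outward_map_zero G cG.
- move=> x i xi; rewrite (Gface _ i) ?xi ?normr1// mxE xi mulr1 invr_gt0.
  by rewrite (lt_le_trans ltr01)// -(normr1 R) -xi l2_coord.
- move=> x i xi; rewrite (Gface _ i) ?xi ?normrN1// mxE xi mulrN1 oppr_le0.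
  by rewrite invr_ge0 l2_ge0.
move: Gx; rewrite /G; case: ifPn => x2.
  pose e1 : vec := delta_mx 0 0.
  have s1 : sphere R n e1.
    rewrite /sphere /= (bigD1 ord0)//= mxE !eqxx expr1n big1 ?addr0// => i i0.
    by rewrite mxE (negbTE i0) andbF expr0n.
  by rewrite -(Hc _ s1); apply: H0 => //; rewrite ler01 lexx.
apply: H0 => //; apply: xs; rewrite -l2_gt0; move: x2; rewrite -ltNge; apply: lt_trans.
by rewrite divr_gt0.
Qed.

End Essential_identity.

(** * Geometry of the tubes *)

Section Tube_geometry.
Variables (R : realType) (k : nat).
Implicit Types (z : Cspace R k.+1) (x y : 'rV[R]_k.+1).

Lemma reV_real_embed n (x : 'rV[R]_n) : reV (real_embed x) = x.
Proof. by apply/rowP => i; rewrite !mxE. Qed.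

Lemma imV_real_embed n (x : 'rV[R]_n) : imV (real_embed x) = 0.
Proof. by apply/rowP => i; rewrite !mxE. Qed.

Lemma reVN n (z : Cspace R n) : reV (- z) = - reV z.
Proof. by apply/rowP => i; rewrite !mxE cReN. Qed.
Lemma imVN n (z : Cspace R n) : imV (- z) = - imV z.
Proof. by apply/rowP => i; rewrite !mxE cImN. Qed.
Lemma reVZ n (a : R) (z : Cspace R n) : reV ((a%:C : Cplx R) *: z) = a *: reV z.
Proof. by apply/rowP => i; rewrite !mxE cReM /= mul0r subr0. Qed.
Lemma imVZ n (a : R) (z : Cspace R n) : imV ((a%:C : Cplx R) *: z) = a *: imV z.
Proof. by apply/rowP => i; rewrite !mxE cImM /= mul0r addr0. Qed.

Definition pole : 'rV[R]_k.+1 := delta_mx 0 0.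

Lemma l2_pole : l2 pole = 1.
Proof.
apply/sphereP; rewrite /sphere /= (bigD1 ord0)//= mxE !eqxx expr1n big1 ?addr0//.
by move=> i i0; rewrite mxE (negbTE i0) andbF expr0n.
Qed.

Lemma unit_vecK n (x : 'rV[R]_n) : x != 0 -> l2 x *: unit_vec x = x.
Proof. by move=> x0; rewrite /unit_vec scalerA divff ?scale1r// l2_eq0. Qed.

Lemma enorm_real_embed n (x : 'rV[R]_n) : enorm (real_embed x) = l2 x.
Proof.
rewrite enormE reV_real_embed imV_real_embed /l2 big_split_ord /=.
rewrite [X in _ + X]big1 ?addr0; last by move=> i _; rewrite row_mxEr mxE expr0n.
by congr Num.sqrt; apply: eq_bigr => i _; rewrite row_mxEl.
Qed.

(** The squared distance from [z] to the sphere is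
    [|Im z|^2 + (|Re z| - 1)^2], attained at [Re z / |Re z|]. *)
Lemma tubeP (r : R) z : 0 < r ->
  tube k r z <-> l2 (imV z) ^+ 2 + (l2 (reV z) - 1) ^+ 2 < r ^+ 2.
Proof.
move=> r0; split=> [[x [u [a [/sphereP x1 u1 /andP[a0 ar] ->]]]]|zr].
  have d1 : `|l2 (reV (real_embed x + a%:C *: u)) - 1| <= a * l2 (reV u).
    rewrite -x1; apply: le_trans (l2B_dist _ _) _.
    by rewrite reVD reV_real_embed reVZ addrAC subrr add0r l2Z ger0_norm.
  have d2 : l2 (imV (real_embed x + a%:C *: u)) = a * l2 (imV u).
    by rewrite imVD imV_real_embed add0r imVZ l2Z ger0_norm.
  apply: (@le_lt_trans _ _ (a ^+ 2)); last by rewrite ltr_sqr ?nnegrE// ltW.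
  have -> : a ^+ 2 = (a * l2 (imV u)) ^+ 2 + (a * l2 (reV u)) ^+ 2.
    by rewrite !exprMn -mulrDr addrC -enorm_sqr u1 expr1n mulr1.
  rewrite d2 lerD2l -real_normK ?num_real// ler_sqr ?nnegrE//.
  by rewrite mulr_ge0// l2_ge0.
have [x x1 xz] : exists2 x : 'rV[R]_k.+1, l2 x = 1 & l2 (reV z - x) = `|l2 (reV z) - 1|.
  have [z0|z0] := eqVneq (reV z) 0.
    exists pole; first exact: l2_pole.
    have l20 : l2 (0 : 'rV[R]_k.+1) = 0 by apply/eqP; rewrite l2_eq0.
    by rewrite z0 !sub0r l2N l20 sub0r normrN l2_pole normr1.
  exists (unit_vec (reV z)); first exact: l2_unit_vec.
  rewrite -{1}(unit_vecK z0) -{2}[unit_vec _]scale1r -scalerBl l2Z.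
  by rewrite l2_unit_vec// mulr1.
pose w := z - real_embed x.
have wr : enorm w < r.
  rewrite -ltr_sqr ?nnegrE ?enorm_ge0//; last exact: ltW.
  rewrite enorm_sqr /w reVD imVD reVN imVN reV_real_embed imV_real_embed subr0 xz.
  by rewrite real_normK ?num_real// addrC.
have [w0|w0] := eqVneq w 0.
  exists x, (real_embed pole), 0; split; [exact/sphereP| | |].
  - by rewrite enorm_real_embed l2_pole.
  - by rewrite lexx r0.
  - by rewrite scale0r addr0; apply/eqP; rewrite -subr_eq0 -/w w0.
exists x, (((enorm w)^-1)%:C *: w), (enorm w); split; [exact/sphereP| | |].
- rewrite enormZ cmodR ger0_norm ?invr_ge0 ?enorm_ge0//.
  by rewrite mulVf// enorm_eq0.
- by rewrite enorm_ge0 wr.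
- rewrite scalerA -rmorphM /= divff ?enorm_eq0// scale1r /w addrC subrK//.
Qed.

Lemma tube_mono (r s : R) z : r <= s -> tube k r z -> tube k s z.
Proof.
move=> rs [x [u [a [x1 u1 /andP[a0 ar] ->]]]].
by exists x, u, a; rewrite a0 (lt_le_trans ar rs).
Qed.

Lemma sphere_sub_tube (r : R) x : 0 < r -> sphere R k x -> tube k r (real_embed x).
Proof.
move=> r0 /sphereP x1; apply/tubeP => //.
rewrite imV_real_embed reV_real_embed x1 subrr expr0n addr0.
have -> : l2 (0 : 'rV[R]_k.+1) = 0 by apply/eqP; rewrite l2_eq0.
by rewrite expr0n exprn_gt0.
Qed.

Lemma tube_reV_neq0 (r : R) z : 0 < r <= 1 -> tube k r z -> reV z != 0.
Proof.
move=> /andP[r0 r1] /tubeP => /(_ r0) zr; apply/eqP => z0; move: zr.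
have -> : l2 (reV z) = 0 by apply/eqP; rewrite l2_eq0 z0.
rewrite sub0r sqrrN expr1n.
have : r ^+ 2 <= 1 by rewrite expr_le1// ltW.
have := sqr_ge0 (l2 (imV z)); lra.
Qed.

Definition tube_proj z : 'rV[R]_k.+1 := unit_vec (reV z).

Lemma sphere_tube_proj (r : R) z : 0 < r <= 1 -> tube k r z -> sphere R k (tube_proj z).
Proof. by move=> r1 /(tube_reV_neq0 r1) z0; apply/sphereP; exact: l2_unit_vec. Qed.

(** At parameter [t] the squared distance to the sphere has been multiplied by
    [t^2]. *)
Lemma tube_segment (r t : R) z : 0 < r <= 1 -> 0 <= t <= 1 -> tube k r z ->
  tube k r (real_embed (tube_proj z) + t%:C *: (z - real_embed (tube_proj z))).
Proof.
move=> r1 /andP[t0 t1] zr; have z0 := tube_reV_neq0 r1 zr.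
have r0 : 0 < r by case/andP: r1.
move/tubeP : (zr) => /(_ r0) zr'; apply/tubeP => //.
apply: le_lt_trans zr'.
rewrite imVD reVD imVZ reVZ imVD reVD imVN reVN imV_real_embed reV_real_embed.
rewrite add0r subr0 l2Z ger0_norm//.
have -> : tube_proj z + t *: (reV z - tube_proj z) =
    (1 + t * (l2 (reV z) - 1)) *: tube_proj z.
  rewrite -{1}(unit_vecK z0) -/(tube_proj z) -{3}[tube_proj z]scale1r -scalerBl.
  by rewrite scalerA -{1}[tube_proj z]scale1r -scalerDl.
have lz := l2_ge0 (reV z).
rewrite l2Z l2_unit_vec// mulr1 ger0_norm; last by nra.
rewrite addrAC subrr add0r !exprMn -mulrDr ler_piMl ?addr_ge0 ?sqr_ge0//.
by rewrite expr_le1.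
Qed.

Lemma tube_addl (r s : R) z w : tube k r z -> enorm w <= s - r -> 0 < s -> tube k s (z + w).
Proof.
move=> [x [u [a [/sphereP x1 u1 /andP[a0 ar] ->]]]] ws s0.
pose v := (a%:C : Cplx R) *: u + w.
have vs : enorm v < s.
  apply: le_lt_trans (ler_enormD _ _) _; rewrite enormZ u1 mulr1 cmodR ger0_norm//.
  by lra.
rewrite -addrA -/v; apply/tubeP => //.
have d1 : `|l2 (reV (real_embed x + v)) - 1| <= l2 (reV v).
  rewrite -x1; apply: le_trans (l2B_dist _ _) _.
  by rewrite reVD reV_real_embed addrAC subrr add0r.
rewrite imVD imV_real_embed add0r.
apply: (@le_lt_trans _ _ (enorm v ^+ 2)); last by rewrite ltr_sqr ?nnegrE ?enorm_ge0// ltW.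
rewrite enorm_sqr [leLHS]addrC lerD2r -real_normK ?num_real// ler_sqr ?nnegrE//.
exact: l2_ge0.
Qed.

Lemma tube_bounded (r : R) z : tube k r z -> enorm z <= 1 + r.
Proof.
move=> [x [u [a [/sphereP x1 u1 /andP[a0 ar] ->]]]].
apply: le_trans (ler_enormD _ _) _; rewrite enorm_real_embed x1 enormZ u1 mulr1.
by rewrite cmodR ger0_norm// lerD2l ltW.
Qed.

End Tube_geometry.

(** * Homotopies in the tubes *)

Lemma cvg_coord (K : numFieldType) n (U : Type) (F : set_system U)
    (f : U -> 'rV[K]_n) (l : 'rV[K]_n) i :
  f @ F --> l -> f x 0 i @[x --> F] --> l 0 i.
Proof.
move=> fl; apply: (@cvg_comp _ _ _ f (fun v : 'rV[K]_n => v 0 i) _ (nbhs l) _ fl).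
exact: coord_continuous.
Qed.

Section Homotopy_in_tube.
Variables (R : realType) (k : nat).
Local Notation vec := 'rV[R]_k.+1.
Local Notation cyl := (`[0, 1]%classic `*` sphere R k).

Lemma continuous_real_embed n : continuous (@real_embed R n).
Proof.
move=> x; apply: (@cvg_row _ _ (nbhs x) _) => i.
apply: cvg_cplx.
  rewrite (_ : (fun y => _) = (fun y : 'rV[R]_n => y 0 i)); last by apply/funext => y; rewrite mxE.
  by rewrite mxE /=; exact: coord_continuous.
rewrite (_ : (fun y => _) = (fun y : 'rV[R]_n => 0)); last by apply/funext => y; rewrite mxE.
by rewrite mxE /=; exact: cvg_cst.
Qed.

Lemma continuous_tube_proj (z : Cspace R k.+1) : reV z != 0 ->
  {for z, continuous (@tube_proj R k)}.
Proof.
move=> z0; apply: (@continuous_comp _ _ _ (@reV R k.+1) (@unit_vec R k.+1)).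
  exact: continuous_reV.
exact: continuous_unit_vec.
Qed.

Lemma within_tube_proj (r : R) (T : topologicalType) (A : set T) (f : T -> Cspace R k.+1) :
  0 < r <= 1 -> {within A, continuous f} -> (forall x, A x -> tube k r (f x)) ->
  {within A, continuous (fun x => tube_proj (f x))}.
Proof.
move=> r1 cf fA; apply: (within_continuous_comp cf _ fA).
apply/subspace_continuousP => z zr; apply: cvg_within_filter.
exact/continuous_tube_proj/(tube_reV_neq0 r1 zr).
Qed.

(** A map into the tube may be pushed along segments to its projection on the
    sphere, so a contraction of the projection suffices. The two homotopies are
    run one after the other by a single formula, the first during
    [0 <= t <= 1/2] and the second during [1/2 <= t <= 1]. *)
Lemma contract_projection (r : R) (f : vec -> Cspace R k.+1) (G : R * vec -> vec) (c : vec) :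
  0 < r <= 1 -> sphere_map (k:=k) (tube k r) f -> {within cyl, continuous G} ->
  (forall p, cyl p -> sphere R k (G p)) ->
  (forall x, sphere R k x -> G (0, x) = tube_proj (f x)) ->
  (forall x, sphere R k x -> G (1, x) = c) ->
  homotopic_to_cst (k:=k) (tube k r) f.
Proof.
move=> r1 [cf fU] cG GS G0 G1; have r0 : 0 < r by case/andP: r1.
pose tau (t : R) := Num.max 0 (2 * t - 1).
pose sig (t : R) := Num.max 0 (1 - 2 * t).
have ctau : continuous tau.
  move=> t; apply: (@cvg_maxr _ _ (nbhs t) _); first exact: cvg_cst.
  apply: cvgB; last exact: cvg_cst.
  by apply: cvgM; [exact: cvg_cst|exact: cvg_id].
have csig : continuous sig.
  move=> t; apply: (@cvg_maxr _ _ (nbhs t) _); first exact: cvg_cst.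
  apply: cvgB; first exact: cvg_cst.
  by apply: cvgM; [exact: cvg_cst|exact: cvg_id].
have ftube x : sphere R k x -> tube k r (f x) by move=> Sx; apply: fU; exists x.
pose H (p : R * vec) : Cspace R k.+1 := real_embed (G (tau p.1, p.2)) +
  ((sig p.1)%:C : Cplx R) *: (f p.2 - real_embed (tube_proj (f p.2))).
have tau01 t : 0 <= t <= 1 -> 0 <= tau t <= 1.
  by move=> /andP[t0 t1]; rewrite /tau le_max lexx /= ge_max ler01 /=; lra.
have cfst : {within cyl, continuous (fun p : R * vec => f p.2)}.
  apply: (within_continuous_comp _ cf); last by move=> p [].
  by apply/subspace_continuousP => p _; apply: cvg_within_filter; exact: cvg_snd.
have cpf : {within cyl, continuous (fun p : R * vec => tube_proj (f p.2))}.
  by apply: (within_tube_proj r1 cfst) => p [_ /ftube].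
have cGt : {within cyl, continuous (fun p : R * vec => G (tau p.1, p.2))}.
  apply: (within_continuous_comp _ cG); last first.
    move=> p [/= p1 p2]; split => //=; move: p1; rewrite !in_itv /=; exact: tau01.
  apply/subspace_continuousP => p _; apply: cvg_within_filter.
  apply: (@cvg_pair _ _ _ (nbhs p) (nbhs (tau p.1)) (nbhs p.2)).
    by apply: (@continuous_comp _ _ _ fst tau); [exact: cvg_fst|exact: ctau].
  exact: cvg_snd.
exists H, (real_embed c); split.
- apply/subspace_continuousP => p Cp.
  have FF : Filter (within cyl (nbhs p)) by apply: within_filter.
  have cs : sig q.1 @[q --> within cyl (nbhs p)] --> sig p.1.
    apply: cvg_within_filter.
    by apply: (@continuous_comp _ _ _ fst sig); [exact: cvg_fst|exact: csig].
  have cGi (i : 'I_k.+1) : G (tau q.1, q.2) 0 i @[q --> within cyl (nbhs p)] --> G (tau p.1, p.2) 0 i.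
    have /subspace_continuousP/(_ p Cp) cGp := cGt.
    exact: cvg_coord cGp.
  have cPi (i : 'I_k.+1) : tube_proj (f q.2) 0 i @[q --> within cyl (nbhs p)] --> tube_proj (f p.2) 0 i.
    have /subspace_continuousP/(_ p Cp) cPp := cpf.
    exact: cvg_coord cPp.
  have cfi (i : 'I_k.+1) : (f q.2 0 i : Cplx R) @[q --> within cyl (nbhs p)] --> (f p.2 0 i : Cplx R).
    have /subspace_continuousP/(_ p Cp) cfp := cfst.
    exact: (@cvg_coord R[i] _ _ _ _ _ i cfp).
  apply: cvg_row => i; apply: cvg_cplx.
  + rewrite (_ : (fun x => _) = (fun q : R * vec => G (tau q.1, q.2) 0 i +
        sig q.1 * (complex.Re (f q.2 0 i) - tube_proj (f q.2) 0 i))); last first.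
      by apply/funext => q; rewrite !mxE !cReD cReM !cReD !cReN /= mul0r subr0.
    rewrite [X in _ --> X](_ : _ = G (tau p.1, p.2) 0 i +
        sig p.1 * (complex.Re (f p.2 0 i) - tube_proj (f p.2) 0 i)); last first.
      by rewrite !mxE !cReD cReM !cReD !cReN /= mul0r subr0.
    apply: cvgD; first exact: cGi.
    apply: cvgM; first exact: cs.
    apply: cvgB; last exact: cPi.
    exact: (@cvg_comp _ _ _ _ (fun z : Cplx R => complex.Re z : R) _ _ _ (cfi i) (@continuous_cRe R _)).
  + rewrite (_ : (fun x => _) = (fun q : R * vec =>
        sig q.1 * complex.Im (f q.2 0 i))); last first.
      by apply/funext => q; rewrite !mxE !cImD cImM !cImD !cImN /= mul0r addr0 add0r subr0.
    rewrite [X in _ --> X](_ : _ = sig p.1 * complex.Im (f p.2 0 i)); last first.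
      by rewrite !mxE !cImD cImM !cImD !cImN /= mul0r addr0 add0r subr0.
    apply: cvgM; first exact: cs.
    exact: (@cvg_comp _ _ _ _ (fun z : Cplx R => complex.Im z : R) _ _ _ (cfi i) (@continuous_cIm R _)).
- move=> _ [[t x] [/= t01 Sx] <-]; move: t01; rewrite in_itv /= => /andP[t0 t1].
  have fx := ftube _ Sx; rewrite /H /=.
  have [t2|t2] := leP t (1 / 2).
    have -> : tau t = 0 by rewrite /tau max_l//; lra.
    have -> : sig t = 1 - 2 * t by rewrite /sig max_r//; lra.
    by rewrite G0//; apply: tube_segment => //; apply/andP; split; lra.
  have -> : sig t = 0 by rewrite /sig max_l//; lra.
  rewrite scale0r addr0; apply: sphere_sub_tube => //; apply: GS.
  by split => //=; rewrite in_itv /=; apply: tau01; rewrite t0 t1.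
- move=> x Sx; rewrite /H /= /tau /sig mulr0 sub0r subr0.
  rewrite max_l ?lerN10// max_r ?ler01// G0// scale1r addrC subrK//.
- move=> x Sx; rewrite /H /=.
  have -> : tau 1 = 1 by rewrite /tau max_r//; lra.
  have -> : sig 1 = 0 by rewrite /sig max_l//; lra.
  by rewrite scale0r addr0 G1.
Qed.

(** A contraction in the larger tube, projected to the sphere, contracts the
    projection of [f]. *)
Lemma null_homotopic_smaller_tube (r s : R) (f : vec -> Cspace R k.+1) :
  0 < r -> r <= s -> s <= 1 -> sphere_map (k:=k) (tube k r) f ->
  homotopic_to_cst (k:=k) (tube k s) f -> homotopic_to_cst (k:=k) (tube k r) f.
Proof.
move=> r0 rs s1 fr [H [c [cH HU H0 H1]]].
have s01 : 0 < s <= 1 by rewrite (lt_le_trans r0 rs).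
have Hs p : cyl p -> tube k s (H p) by move=> Cp; apply: HU; exists p.
apply: (@contract_projection r f (fun p => tube_proj (H p)) (tube_proj c)) => //.
- by rewrite r0 (le_trans rs s1).
- exact: within_tube_proj s01 cH Hs.
- by move=> p /Hs; exact: sphere_tube_proj.
- by move=> x Sx; rewrite H0.
- by move=> x Sx; rewrite H1.
Qed.

(** The segment from [tube_proj (f x)] to [- p] avoids the origin, so it can be
    projected to the sphere. *)
Lemma null_homotopic_missing_point (r : R) (f : vec -> Cspace R k.+1) (p : vec) :
  0 < r <= 1 -> sphere_map (k:=k) (tube k r) f -> sphere R k p ->
  (forall x, sphere R k x -> tube_proj (f x) <> p) ->
  homotopic_to_cst (k:=k) (tube k r) f.
Proof.
move=> r1 fr /sphereP p1 fp; have [cf fU] := fr.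
have ftube x : sphere R k x -> tube k r (f x) by move=> Sx; apply: fU; exists x.
pose g (q : R * vec) : vec := (1 - q.1) *: tube_proj (f q.2) - q.1 *: p.
have g0 q : cyl q -> g q != 0.
  case: q => t x [/= t01 Sx]; apply/eqP => gt; apply: (fp _ Sx).
  move: t01; rewrite in_itv /= => /andP[t0 t1].
  have E : (1 - t) *: tube_proj (f x) = t *: p by apply/eqP; rewrite -subr_eq0 -[X in X == _]/(g (t, x)) gt.
  have := congr1 (@l2 R k.+1) E; rewrite (l2Z (1 - t)) (l2Z t) p1.
  have /sphereP -> := sphere_tube_proj r1 (ftube _ Sx).
  rewrite !mulr1 ger0_norm ?subr_ge0// ger0_norm// => tt.
  have tn0 : t != 0 by apply/eqP => t0'; move: tt; rewrite t0' subr0 => /eqP; rewrite oner_eq0.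
  by move: E; rewrite tt; exact: scalerI.
have cpf : {within cyl, continuous (fun q : R * vec => tube_proj (f q.2))}.
  apply: (@within_tube_proj r) => //; last by move=> q [_ /ftube].
  apply: (within_continuous_comp _ cf); last by move=> q [].
  by apply/subspace_continuousP => q _; apply: cvg_within_filter; exact: cvg_snd.
have cg : {within cyl, continuous g}.
  apply/subspace_continuousP => q Cq.
  have FF : Filter (within cyl (nbhs q)) by apply: within_filter.
  have c1 : (u.1 : R) @[u --> within cyl (nbhs q)] --> q.1.
    by apply: cvg_within_filter; exact: cvg_fst.
  apply: cvg_row => i.
  rewrite (_ : (fun x => _) = (fun u : R * vec => (1 - u.1) * tube_proj (f u.2) 0 i - u.1 * p 0 i)); last first.
    by apply/funext => u; rewrite !mxE.
  rewrite [X in _ --> X](_ : _ = (1 - q.1) * tube_proj (f q.2) 0 i - q.1 * p 0 i); last first.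
    by rewrite !mxE.
  apply: cvgB; last by apply: cvgM => //; exact: cvg_cst.
  apply: cvgM; first by apply: cvgB => //; exact: cvg_cst.
  have /subspace_continuousP/(_ q Cq) cPp := cpf.
  exact: cvg_coord cPp.
apply: (@contract_projection r f (fun q => unit_vec (g q)) (unit_vec (- p)) r1 fr).
- apply: (within_continuous_comp (B := [set v : vec | v != 0]) cg _ g0).
  apply/subspace_continuousP => v /= v0; apply: cvg_within_filter.
  exact: continuous_unit_vec.
- by move=> q /g0 gq; apply/sphereP; exact: l2_unit_vec.
- move=> x Sx; rewrite /g /= subr0 scale1r scale0r subr0 /unit_vec.
  have /sphereP -> := sphere_tube_proj r1 (ftube _ Sx).
  by rewrite invr1 scale1r.
- by move=> x Sx; rewrite /g /= subrr scale0r scale1r sub0r.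
Qed.

Lemma sphere_essential_in_tube (s : R) : 0 < s <= 1 ->
  ~ homotopic_to_cst (k:=k) (tube k s) (@real_embed R k.+1).
Proof.
move=> s01 [H [c [cH HU H0 H1]]].
have Hs p : cyl p -> tube k s (H p) by move=> Cp; apply: HU; exists p.
apply: (@sphere_identity_essential R k (fun p => tube_proj (H p)) (tube_proj c)).
- exact: within_tube_proj s01 cH Hs.
- move=> t x t01 Sx Ht0.
  have Ct : cyl (t, x) by split => //=; rewrite in_itv.
  have /sphereP := sphere_tube_proj s01 (Hs _ Ct).
  have l20 : l2 (0 : vec) = 0 by apply/eqP; rewrite l2_eq0.
  by rewrite Ht0 l20 => /eqP; rewrite eq_sym oner_eq0.
- move=> x Sx; rewrite H0// /tube_proj reV_real_embed /unit_vec.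
  by move/sphereP: Sx => ->; rewrite invr1 scale1r.
- by move=> x Sx; rewrite H1.
Qed.

End Homotopy_in_tube.

(** * Hausdorff measures *)

Section Hausdorff_image.
Local Open Scope ereal_scope.
Variable R : realType.

Lemma diam_ge0 (T : Type) (d : T -> T -> \bar R) (A : set T) : 0 <= diam d A.
Proof. by rewrite /diam le_max lexx. Qed.

Lemma diam_ub (T : Type) (d : T -> T -> \bar R) (A : set T) x y :
  A x -> A y -> d x y <= diam d A.
Proof.
move=> Ax Ay; rewrite /diam le_max; apply/orP; right.
by apply: ereal_sup_ubound; exists (x, y).
Qed.

Lemma diam_le (T : Type) (d : T -> T -> \bar R) (A : set T) (b : \bar R) : 0 <= b ->
  (forall x y, A x -> A y -> d x y <= b) -> diam d A <= b.
Proof.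
move=> b0 Ab; rewrite /diam ge_max b0 /=; apply: ge_ereal_sup.
by move=> _ [[x y] [/= Ax Ay] <-]; exact: Ab.
Qed.

Lemma lee_expZ (c : R) (a b : \bar R) k : 0 <= a -> 0 <= b -> a <= c%:E * b ->
  a ^+ k <= (c ^+ k)%:E * b ^+ k.
Proof.
move=> a0 b0 ab; elim: k => [|k IH]; first by rewrite !expe0 expr0 mule1.
by rewrite !expeS exprS EFinM muleACA lee_pmul// expe_ge0.
Qed.

Lemma hausdorff_image (T T' : Type) (d : T -> T -> \bar R) (d' : T' -> T' -> \bar R)
    (g : T -> T') (A : set T) (c : R) k : (0 < c)%R ->
  (forall x y, A x -> A y -> d' (g x) (g y) <= c%:E * d x y) ->
  hausdorff d' k (g @` A) <= (c ^+ k)%:E * hausdorff d k A.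
Proof.
move=> c0 gc; apply: ge_ereal_sup => _ [e /= e0 <-].
have ck0 : (0 < c ^+ k)%R by rewrite exprn_gt0.
apply: (@le_trans _ _ ((c ^+ k)%:E * ereal_inf [set (\sum_(0 <= i <oo) diam d (F i) ^+ k)%E
      | F in [set F : nat -> set T | A = \bigcup_i F i /\
                forall i, (diam d (F i) < (e / c)%:E)%E]])); last first.
  rewrite lee_pmul2l ?lte_fin//; apply: ereal_sup_ubound.
  by exists (e / c)%R => //=; rewrite divr_gt0.
rewrite -lee_pdivrMl//; apply: le_ereal_inf_tmp => _ [F [AF Fe] <-].
rewrite lee_pdivrMl//.
have dF i : diam d' (g @` F i) <= c%:E * diam d (F i).
  apply: diam_le => [|_ _ [x Fx <-] [y Fy <-]].
    by rewrite mule_ge0// ?diam_ge0// lee_fin ltW.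
  apply: le_trans (gc _ _ _ _) _; [by rewrite AF; exists i|by rewrite AF; exists i|].
  by rewrite lee_pmul2l ?lte_fin// diam_ub.
apply: (@le_trans _ _ (\sum_(0 <= i <oo) diam d' (g @` F i) ^+ k)).
  apply: ereal_inf_lbound; exists (fun i => g @` F i) => //; split.
    by rewrite AF image_bigcup.
  move=> i; apply: le_lt_trans (dF i) _.
  by rewrite -lte_pdivlMl// -EFinM mulrC; exact: Fe.
rewrite -nneseriesZl; last by move=> i _; rewrite expe_ge0// diam_ge0.
apply: lee_nneseries => [i _|i _]; first by rewrite expe_ge0// diam_ge0.
exact: lee_expZ (diam_ge0 _ _) (diam_ge0 _ _) (dF i).
Qed.
End Hausdorff_image.

Section Cube_lower_bound.
Variables (R : realType) (k : nat).
Local Notation vec := 'rV[R]_k.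

Lemma card_le_sum_cover (I : finType) (J : eqType) (D : seq J) (S : J -> {set I}) :
  (forall g, exists2 i, i \in D & g \in S i) -> (#|I| <= \sum_(i <- D) #|S i|)%N.
Proof.
move=> cov; rewrite -sum1_card.
under [leqRHS]eq_bigr do rewrite -sum1_card big_mkcond.
rewrite exchange_big /=; apply: leq_sum => g _.
have [i iD gi] := cov g.
by rewrite (big_rem i)//= gi leq_addr.
Qed.

Lemma card_close_set (N q : nat) (S : {set {ffun 'I_k -> 'I_N}}) :
  (forall g g' j, g \in S -> g' \in S -> (g j <= g' j + q)%N) ->
  (#|S| <= q.+1 ^ k)%N.
Proof.
move=> close.
(* residues modulo [q + 1] separate numbers at distance at most [q] *)
pose f (g : {ffun 'I_k -> 'I_N}) : {ffun 'I_k -> 'I_q.+1} := [ffun j => inord (g j %% q.+1)].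
rewrite -(@card_in_imset _ _ f).
  apply: leq_trans (max_card _) _.
  by rewrite card_ffun !card_ord.
move=> g g' gS gS' /ffunP fgg'; apply/ffunP => j; apply/val_inj.
have := congr1 val (fgg' j); rewrite !ffunE /= !inordK ?ltn_mod// => /eqP mod_eq.
have c1 := close _ _ j gS gS'; have c2 := close _ _ j gS' gS.
wlog le : g g' gS gS' fgg' mod_eq c1 c2 / (g j <= g' j)%N.
  move=> H; have [le|/ltnW le] := leqP (g j) (g' j); first exact: H.
  by apply/esym; apply: (H g' g) => //; rewrite eq_sym.
move: mod_eq; rewrite eq_sym eqn_mod_dvd// => /dvdnP[[|m] E].
  by apply/eqP; rewrite eqn_leq le /=; move/eqP: E; rewrite mul0n subn_eq0.
have : (g' j - g j <= q)%N by rewrite leq_subLR.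
by rewrite E mulSn; lia.
Qed.

(** Counting the points of a fine grid: a set of diameter [L] contains at most
    about [(N L / a) ^ k] of the [N ^ k] points. *)
Lemma cube_finite_cover (a : R) (D : seq nat) (O : nat -> set vec) (L : nat -> R) :
  0 < a -> (forall i, 0 < L i) ->
  (forall i x y j, O i x -> O i y -> `|x 0 j - y 0 j| <= L i) ->
  (forall x : vec, (forall j, 0 <= x 0 j <= a) -> exists2 i, i \in D & O i x) ->
  a ^+ k <= 2 ^+ k * \sum_(i <- D) L i ^+ k.
Proof.
move=> a0 L0 OL cov.
(* so fine that rounding [L i * N / a] up at most doubles it *)
have [N N0 ND] : exists2 N : nat, (0 < N)%N & forall i, i \in D -> a / L i <= N%:R.
  pose N := (\max_(i <- D) (Num.trunc (a / L i)).+1)%N.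
  exists N.+1 => // i iD; apply/ltW; apply: lt_le_trans (truncnS_gt _) _.
  by rewrite ler_nat; apply: leqW; rewrite /N (big_rem i)//= leq_maxl.
have NR : 0 < (N%:R : R) by rewrite ltr0n.
pose pt (g : {ffun 'I_k -> 'I_N}) : vec := \row_j (a * (g j)%:R / N%:R).
pose S i := [set g : {ffun 'I_k -> 'I_N} | `[< O i (pt g) >]]%SET.
have cov' g : exists2 i, i \in D & g \in S i.
  have [|i iD Oi] := cov (pt g); last by exists i => //; rewrite inE; apply/asboolP.
  move=> j; rewrite mxE divr_ge0 ?mulr_ge0 ?(ltW a0)//= ler_pdivrMr// ler_pM2l//.
  by rewrite ler_nat ltnW.
pose q i := Num.trunc (L i * N%:R / a).
have q0 i : 0 <= L i * N%:R / a by rewrite divr_ge0// ?mulr_ge0// ltW.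
have cardS i : (#|S i| <= (q i).+1 ^ k)%N.
  apply: card_close_set => g g' j; rewrite !inE => /asboolP/asboolP gi /asboolP/asboolP gi'.
  have := OL _ _ _ j gi gi'; rewrite !mxE => Hd.
  have [le|lt] := leqP (g j) (g' j); first by rewrite (leq_trans le)// leq_addr.
  rewrite -leq_subLR -(ler_nat R) natrB ?(ltnW lt)//.
  have : (g j)%:R - (g' j)%:R <= L i * N%:R / a :> R.
    rewrite ler_pdivlMr// -ler_pdivrMr//; apply: le_trans Hd.
    apply: le_trans (ler_norm _); rewrite le_eqVlt; apply/orP; left; apply/eqP.
    by field; rewrite gt_eqF.
  rewrite -natrB ?(ltnW lt)// => H; rewrite ler_nat /q.
  by rewrite truncn_ge_nat.
have := card_le_sum_cover cov'; rewrite card_ffun !card_ord => le1.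
have : ((N ^ k)%:R : R) <= \sum_(i <- D) ((2 * L i * N%:R / a) ^+ k).
  apply: le_trans (_ : _ <= (\sum_(i <- D) #|S i|)%:R) _; first by rewrite ler_nat.
  rewrite natr_sum big_seq [leRHS]big_seq; apply: ler_sum => i iD.
  apply: le_trans (_ : _ <= ((q i).+1 ^ k)%:R) _; first by rewrite ler_nat.
  rewrite natrX lerXn2r ?nnegrE//; first by rewrite !mulr_ge0 ?invr_ge0 ?ltW.
  have qle : (q i)%:R <= L i * N%:R / a by rewrite truncn_le.
  have : 1 <= L i * N%:R / a.
    by rewrite ler_pdivlMr// mul1r mulrC -ler_pdivrMr//; exact: ND.
  rewrite -natr1 -!mulrA; lra.
rewrite natrX => le2.
have E : \sum_(i <- D) (2 * L i * N%:R / a) ^+ k = (N%:R / a) ^+ k * (2 ^+ k * \sum_(i <- D) L i ^+ k).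
  rewrite !mulr_sumr; apply: eq_bigr => i _.
  by rewrite -!exprMn; congr (_ ^+ _); ring.
move: le2; rewrite E expr_div_n mulrAC -[leLHS]mulr1 -mulrA ler_pM2l ?exprn_gt0//.
by rewrite ler_pdivlMr ?exprn_gt0// mul1r.
Qed.

Lemma expr_slack (x n : R) : 0 <= x -> 0 < n -> exists2 y, x < y & y ^+ k <= x ^+ k + n.
Proof.
move=> x0 n0.
have cX : (fun y : R => y ^+ k) @ x --> x ^+ k by exact: exprn_continuous.
have /cvgrPdist_lt/(_ _ n0)/nbhs_ballP[e /= e0 He] := cX.
exists (x + e / 2); first by rewrite ltrDl divr_gt0.
have := He (x + e / 2); rewrite -ball_normE /= opprD addrA subrr add0r normrN.
rewrite ger0_norm ?divr_ge0 ?(ltW e0)// => H.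
have {H} := H ltac:(lra); rewrite distrC => /ltW/(le_trans (ler_norm _)); lra.
Qed.

(** The sets of a cover are enlarged to open sets, at an arbitrarily small
    total cost, so that compactness leaves finitely many of them. *)
Lemma cube_cover_sum (a : R) (E : nat -> set vec) (dl : nat -> R) : 0 < a ->
  (forall i, 0 <= dl i) ->
  (forall i x y j, E i x -> E i y -> `|x 0 j - y 0 j| <= dl i) ->
  (forall x : vec, (forall j, 0 <= x 0 j <= a) -> exists i, E i x) ->
  (((a / 6) ^+ k / 2)%:E <= \sum_(0 <= i <oo) (dl i ^+ k)%:E)%E.
Proof.
move=> a0 dl0 Edl cov; pose n := (a / 6) ^+ k / 2.
have n0 : 0 < n by rewrite divr_gt0// exprn_gt0// divr_gt0.
have slack i : exists l, dl i < l /\ l ^+ k <= dl i ^+ k + n / 2 ^+ i.+1.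
  by have [|l] := expr_slack (dl0 i) (_ : 0 < n / 2 ^+ i.+1); [rewrite divr_gt0// exprn_gt0|exists l].
have [l lP] := choice slack.
have l0 i : 0 < l i by exact: le_lt_trans (dl0 i) (lP i).1.
pose O i := [set x : vec | exists2 y, E i y & forall j, `|y 0 j - x 0 j| < l i].
have oO i : open (O i).
  rewrite openE => x [y Ey xy].
  have H (j : 'I_k) : \forall x' \near x, `|y 0 j - (x' : vec) 0 j| < l i.
    apply: (@nbhs_row _ _ _ _ (l i - `|y 0 j - x 0 j|)); first by rewrite subr_gt0.
    move=> x' /(_ j); rewrite ltrBrDl => xx'; apply: le_lt_trans xx'.
    by have := ler_normD (y 0 j - x 0 j) (x 0 j - x' 0 j); rewrite addrA subrK.
  by apply: filterS (filter_forall _ H) => x' x'P; exists y.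
have Oj i x x' j : O i x -> O i x' -> `|x 0 j - x' 0 j| <= 3 * l i.
  move=> [y Ey xy] [y' Ey' xy'].
  have := Edl _ _ _ j Ey Ey'; have := xy j; have := xy' j; have := (lP i).1.
  have -> : x 0 j - x' 0 j = (y 0 j - y' 0 j) + (y' 0 j - x' 0 j) - (y 0 j - x 0 j) by ring.
  move=> h1 h2 h3 h4; apply: le_trans (ler_normB _ _) _.
  have := ler_normD (y 0 j - y' 0 j) (y' 0 j - x' 0 j); lra.
pose K : set vec := [set y | forall i, `[0, a]%classic ((y : vec) ord0 i)].
have cK : compact K.
  have := @rV_compact R k (fun=> `[0, a]%classic).
  by apply=> i; exact: segment_compact.
move: cK; rewrite compact_cover => /(_ nat setT O (fun i _ => oO i)).
have KO : K `<=` cover setT O.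
  move=> x Kx; have [|i Ei] := cov x.
    by move=> j; have := Kx j; rewrite /= in_itv.
  by exists i => //; exists x => // j; rewrite subrr normr0.
move=> /(_ KO)[D0 _ KD]; pose D : seq nat := finmap.enum_fset D0.
have : a ^+ k <= 2 ^+ k * \sum_(i <- D) (3 * l i) ^+ k.
  apply: (cube_finite_cover a0 _ Oj); first by move=> i; rewrite mulr_gt0.
  move=> x xa; have Kx : K x by move=> j; rewrite /= in_itv /=; exact: xa.
  have [i iD Oi] := KD _ Kx.
  by exists i.
have -> : 2 ^+ k * \sum_(i <- D) (3 * l i) ^+ k = 6 ^+ k * \sum_(i <- D) l i ^+ k.
  rewrite !mulr_sumr; apply: eq_bigr => i _.
  by rewrite -!exprMn mulrA; congr ((_ * _) ^+ _); ring.
rewrite mulrC -ler_pdivrMr ?exprn_gt0// -expr_div_n => aD.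
have : (((a / 6) ^+ k)%:E <= \sum_(0 <= i <oo) (dl i ^+ k)%:E + n%:E)%E.
  apply: le_trans (epsilon_trick _ _ (ltW n0)); last by move=> i; rewrite lee_fin exprn_ge0.
  pose M := (\max_(i <- D) i.+1)%N.
  apply: le_trans (nneseries_lim_ge M _); last first.
    by move=> i _; rewrite -EFinD lee_fin addr_ge0 ?exprn_ge0// divr_ge0// ltW.
  under eq_bigr do rewrite -EFinD.
  rewrite sumEFin lee_fin; apply: le_trans aD _.
  rewrite [leRHS](bigID (fun i => i \in D)) /=.
  have -> : \sum_(i <- D) l i ^+ k = \sum_(0 <= i < M | i \in D) l i ^+ k.
    rewrite -[RHS]big_filter; apply: perm_big; apply: uniq_perm.
    - exact: finmap.fset_uniq.
    - by rewrite filter_uniq// iota_uniq.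
    - move=> i; rewrite mem_filter mem_index_iota /=; case: (boolP (i \in D)) => //= iD.
      by rewrite /M (big_rem i)//= leq_max ltnSn.
  apply: ler_wpDr.
    by apply: sumr_ge0 => i _; rewrite addr_ge0 ?exprn_ge0// divr_ge0// ltW.
  by apply: ler_sum => i _; rewrite natrX; exact: (lP i).2.
set S := (\sum_(0 <= i <oo) _)%E; have S0 : (0 <= S)%E.
  by apply: nneseries_ge0 => i _ _; rewrite lee_fin exprn_ge0.
case: S S0 => [s|_ _|//]; last by rewrite leey.
by rewrite -EFinD !lee_fin => _; rewrite /n; lra.
Qed.

End Cube_lower_bound.

Section Hausdorff_bounds.
Variables (R : realType) (k : nat).

Lemma hausdorff_ge_cube (T : Type) (d : T -> T -> \bar R) (A : set T)
    (y : T -> 'rV[R]_k) (C a : R) : 0 < C -> 0 < a ->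
  (forall p q j, A p -> A q -> (`|y p 0 j - y q 0 j|%:E <= C%:E * d p q)%E) ->
  (forall v : 'rV[R]_k, (forall j, 0 <= v 0 j <= a) -> exists2 p, A p & y p = v) ->
  (((C ^+ k)^-1 * ((a / 6) ^+ k / 2))%:E <= hausdorff d k A)%E.
Proof.
move=> C0 a0 yC ya.
apply: (@le_trans _ _ (ereal_inf [set (\sum_(0 <= i <oo) diam d (F i) ^+ k)%E
      | F in [set F : nat -> set T | A = \bigcup_i F i /\
                forall i, (diam d (F i) < 1%:E)%E]])); last first.
  by apply: ereal_sup_ubound; exists 1 => //=.
apply: le_ereal_inf_tmp => _ [F [AF F1] <-].
rewrite EFinM lee_pdivrMl ?exprn_gt0//.
have FA i p : F i p -> A p by rewrite AF => Fp; exists i.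
have dfin i : (fine (diam d (F i)))%:E = diam d (F i).
  rewrite fineK// ge0_fin_numE ?diam_ge0//; exact: lt_trans (F1 i) (ltry _).
have fin0 i : 0 <= fine (diam d (F i)) by rewrite fine_ge0// diam_ge0.
rewrite -nneseriesZl; last by move=> i _; rewrite expe_ge0// diam_ge0.
have := @cube_cover_sum R k a (fun i => y @` F i) (fun i => C * fine (diam d (F i))) a0.
have -> : (\sum_(0 <= i <oo) ((C * fine (diam d (F i))) ^+ k)%:E =
    \sum_(0 <= i <oo) (C ^+ k)%:E * diam d (F i) ^+ k)%E.
  by apply: eq_eseriesr => i _; rewrite -{2}dfin -EFin_expe exprMn EFinM.
apply.
- by move=> i; rewrite mulr_ge0// ltW.
- move=> i _ _ j [p Fp <-] [q Fq <-]; rewrite -lee_fin EFinM dfin.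
  apply: le_trans (yC _ _ _ (FA _ _ Fp) (FA _ _ Fq)) _.
  by rewrite lee_pmul2l ?lte_fin// diam_ub.
- move=> v /ya[p]; rewrite AF => -[i _ Fp] <-; by exists i, p.
Qed.

Section Sphere_patches.
Variable N : nat.
Local Notation index := ('I_k.+1 * bool * {ffun 'I_k -> 'I_(2 * N).+1})%type.

(** The coordinates in the intervals of length [1/N] determine the remaining one
    up to sign; bounded away from zero, it depends on them in a Lipschitz
    manner. *)
Definition patch (u : index) : set 'rV[R]_k.+1 := [set x | [/\ sphere R k x,
  k.+1%:R^-1 <= `|x 0 u.1.1|, (0 < x 0 u.1.1) = u.1.2
  & forall i, Num.trunc (N%:R * (x 0 (lift u.1.1 i) + 1)) = u.2 i :> nat]].

Lemma patch_cover x : sphere R k x -> exists u, patch u x.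
Proof.
move=> Sx; have /sphereP x1 := Sx.
have [j xj] : exists j : 'I_k.+1, k.+1%:R^-1 <= `|x 0 j|.
  apply: contrapT => /forallNP small.
  have lt j : `|x 0 j| < k.+1%:R^-1 by rewrite ltNge; apply/negP; exact: small.
  have := ler_l2_sum x; rewrite x1 leNgt => /negP; apply.
  apply: (@lt_le_trans _ _ (\sum_(i < k.+1) k.+1%:R^-1)).
    by apply: ltr_sum => //; apply/hasP; exists ord0; rewrite ?mem_index_enum.
  by rewrite sumr_const card_ord -[leLHS]mulr_natr mulVf// pnatr_eq0.
have b (i : 'I_k) : (Num.trunc (N%:R * (x 0 (lift j i) + 1))%R < (2 * N).+1)%N.
  have := l2_coord x (lift j i); rewrite x1 ler_norml => /andP[x0 x2].
  rewrite ltnS -(ler_nat R); apply: le_trans (_ : _ <= N%:R * (x 0 (lift j i) + 1)) _.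
    by rewrite truncn_le ?mulr_ge0//; lra.
  by rewrite mulnC natrM ler_wpM2l//; lra.
exists (j, 0 < x 0 j, [ffun i => Ordinal (b i)]); split => //= i.
by rewrite ffunE.
Qed.

Definition patch_size : R := k%:R + (k * k.+1)%:R.

Lemma patch_diam u x y : (0 < N)%N -> patch u x -> patch u y -> l2 (x - y) <= patch_size / N%:R.
Proof.
move=> N0; case: u => [[j b] m] [/= Sx xj xb xm] [/= Sy yj yb ym].
have NR : 0 < (N%:R : R) by rewrite ltr0n.
have kR : 0 < (k.+1%:R : R) by rewrite ltr0n.
have co (i : 'I_k) : `|x 0 (lift j i) - y 0 (lift j i)| <= N%:R^-1.
  have t0 (z : 'rV[R]_k.+1) : sphere R k z -> 0 <= N%:R * (z 0 (lift j i) + 1).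
    move=> /sphereP z1; have := l2_coord z (lift j i); rewrite z1 ler_norml.
    by move=> /andP[? ?]; rewrite mulr_ge0//; lra.
  have /andP[x0 x1] := truncn_itv (t0 _ Sx); have /andP[y0 y1] := truncn_itv (t0 _ Sy).
  rewrite xm -natr1 in x0 x1; rewrite ym -natr1 in y0 y1.
  rewrite -[leRHS]mul1r ler_pdivlMr// -[X in _ * X]gtr0_norm// -normrM.
  by rewrite ler_norml; apply/andP; split; lra.
have big1 (z : 'rV[R]_k.+1) i : sphere R k z -> `|z 0 i| <= 1.
  by move=> /sphereP <-; exact: l2_coord.
have sq (i : 'I_k) : `|x 0 (lift j i) ^+ 2 - y 0 (lift j i) ^+ 2| <= 2 / N%:R.
  rewrite subr_sqr normrM mulrC ler_pM//.
  by apply: le_trans (ler_normD _ _) _; have := big1 _ (lift j i) Sx; have := big1 _ (lift j i) Sy; lra.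
have sumE (z : 'rV[R]_k.+1) : sphere R k z -> z 0 j ^+ 2 = 1 - \sum_(i < k) z 0 (lift j i) ^+ 2.
  by rewrite /sphere /= (bigD1_ord j)//= => <-; rewrite addrK.
have cj : `|x 0 j - y 0 j| <= (k * k.+1)%:R / N%:R.
  have : `|x 0 j - y 0 j| * (2 / k.+1%:R) <= (2 * k%:R) / N%:R.
    apply: (@le_trans _ _ (`|x 0 j ^+ 2 - y 0 j ^+ 2|)).
      rewrite subr_sqr normrM ler_wpM2l//; move: xj yj.
      set q : R := _^-1 => xj yj.
      have [x0|x0] := boolP (0 < x 0 j).
        have y0 : 0 < y 0 j by rewrite yb -xb.
        rewrite (gtr0_norm x0) in xj; rewrite (gtr0_norm y0) in yj.
        have xy0 : 0 < x 0 j + y 0 j by rewrite addr_gt0.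
        rewrite (gtr0_norm xy0) -[_ / _]/(2 * q); lra.
      have y0 : ~~ (0 < y 0 j) by rewrite yb -xb.
      move: x0 y0; rewrite -!leNgt => x0 y0.
      rewrite (ler0_norm x0) in xj; rewrite (ler0_norm y0) in yj.
      have xy0 : x 0 j + y 0 j <= 0 by lra.
      rewrite (ler0_norm xy0) -[_ / _]/(2 * q); lra.
    rewrite (sumE _ Sx) (sumE _ Sy).
    have -> : 1 - \sum_(i < k) x 0 (lift j i) ^+ 2 - (1 - \sum_(i < k) y 0 (lift j i) ^+ 2)
      = \sum_(i < k) - (x 0 (lift j i) ^+ 2 - y 0 (lift j i) ^+ 2).
      by rewrite sumrN sumrB; ring.
    apply: le_trans (ler_norm_sum _ _ _) _.
    apply: (@le_trans _ _ (\sum_(i < k) 2 / N%:R)).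
      by apply: ler_sum => i _; rewrite normrN.
    rewrite sumr_const card_ord -[leLHS]mulr_natr.
    by rewrite le_eqVlt; apply/orP; left; apply/eqP; ring.
  rewrite natrM ler_pdivlMr// => H.
  rewrite ler_pdivlMr//.
  have -> : `|x 0 j - y 0 j| * N%:R =
      `|x 0 j - y 0 j| * (2 / k.+1%:R) * N%:R * (k.+1%:R / 2) by field; rewrite gt_eqF.
  apply: le_trans (ler_wpM2r _ H) _; first by rewrite divr_ge0// ltW.
  by rewrite le_eqVlt; apply/orP; left; apply/eqP; field.
apply: le_trans (ler_l2_sum _) _.
rewrite (bigD1_ord j)//= /patch_size mulrDl addrC !mxE lerD//.
apply: (@le_trans _ _ (\sum_(i < k) N%:R^-1)).
  by apply: ler_sum => i _; rewrite !mxE co.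
by rewrite sumr_const card_ord -[leLHS]mulr_natr mulrC.
Qed.
End Sphere_patches.

(** The sum of the [k]-th powers of the diameters of about [N^k] patches of
    diameter about [1/N] is bounded independently of [N]. *)
Lemma hausdorff_sphere_finite (d : 'rV[R]_k.+1 -> 'rV[R]_k.+1 -> \bar R) (C eta : R) :
  (0 < k)%N -> 0 < C -> 0 < eta ->
  (forall x y, sphere R k x -> sphere R k y -> l2 (x - y) < eta ->
     (d x y <= (C * l2 (x - y))%:E)%E) ->
  (hausdorff d k (sphere R k) < +oo)%E.
Proof.
move=> k0 C0 eta0 dC; pose c := patch_size.
have c0 : 0 < c by rewrite /c /patch_size ltr_pwDl ?ltr0n.
pose B : R := (k.+1 * 2)%:R * (3 * (C * c)) ^+ k.
apply: (@le_lt_trans _ _ B%:E); last exact: ltry.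
apply: ge_ereal_sup => _ [e /= e0 <-].
(* so that the patches are smaller than [eta], and [C] times that than [e] *)
pose N := (Num.trunc (c / eta + C * c / e)).+1.
have N0 : (0 < N)%N by [].
have NR : 0 < (N%:R : R) by rewrite ltr0n.
have Nlt : c / eta + C * c / e < N%:R by exact: truncnS_gt.
have p1 : 0 < c / eta by rewrite divr_gt0.
have p2 : 0 < C * c / e by rewrite divr_gt0// mulr_gt0.
have N1 : c / N%:R < eta.
  have : c / eta < N%:R by lra.
  by rewrite (ltr_pdivrMr _ _ eta0) (ltr_pdivrMr _ _ NR) mulrC.
have N2 : C * (c / N%:R) < e.
  have : C * c / e < N%:R by lra.
  by rewrite mulrA (ltr_pdivrMr _ _ e0) (ltr_pdivrMr _ _ NR) (mulrC e).
pose I := ('I_k.+1 * bool * {ffun 'I_k -> 'I_(2 * N).+1})%type.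
pose F n : set 'rV[R]_k.+1 := if insub n is Some u then @patch N (enum_val (u : 'I_#|{: I}|)) else set0.
have Cc0 : 0 <= C * (c / N%:R) by rewrite mulr_ge0 ?divr_ge0// ltW.
have dF n : (diam d (F n) <= (C * (c / N%:R))%:E)%E.
  apply: diam_le; first by rewrite lee_fin.
  rewrite /F; case: insub => [u|//] x y ux uy.
  have xy := patch_diam N0 ux uy.
  have Sx : sphere R k x by case: ux.
  have Sy : sphere R k y by case: uy.
  have xe := le_lt_trans xy N1.
  by apply: (le_trans (dC _ _ Sx Sy xe)); rewrite lee_fin ler_pM2l.
apply: (@le_trans _ _ (\sum_(0 <= n <oo) diam d (F n) ^+ k)%E).
  apply: ereal_inf_lbound; exists F => //; split.
    apply/seteqP; split=> [x Sx|x [n _]].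
      have [u xu] := patch_cover N Sx.
      exists (enum_rank u : nat) => //; rewrite /F.
      by rewrite valK enum_rankK.
    by rewrite /F; case: insub => [u []|].
  by move=> n; apply: le_lt_trans (dF n) _; rewrite lte_fin.
rewrite (@nneseries_split _ _ 0 #|{: I}|); last by move=> n _; rewrite expe_ge0// diam_ge0.
rewrite eseries0 ?adde0; last first.
  move=> n; rewrite add0n => nI _; rewrite /F insubN -?leqNgt//.
  have -> : diam d set0 = 0%E.
    by apply/eqP; rewrite eq_le diam_ge0 andbT; apply: diam_le.
  by apply/eqP; rewrite expe_eq0 k0 eqxx.
apply: (@le_trans _ _ (\sum_(0 <= n < 0 + #|{: I}|) ((C * (c / N%:R)) ^+ k)%:E)%E).
  apply: lee_sum => n _; rewrite -[leRHS]mule1.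
  have := @lee_expZ R (C * (c / N%:R)) (diam d (F n)) 1 k.
  rewrite -EFin_expe expr1n; apply; [exact: diam_ge0|exact: lee01|].
  by rewrite mule1.
rewrite sumEFin lee_fin sumr_const_nat add0n subn0 !card_prod card_ffun !card_ord card_bool.
rewrite -[leLHS]mulr_natl natrM -mulrA /B ler_wpM2l//.
rewrite natrX -exprMn lerXn2r ?nnegrE ?mulr_ge0 ?invr_ge0 ?(ltW C0) ?(ltW c0)//.
have -> : (2 * N).+1%:R * (C * (c / N%:R)) = ((2 * N).+1%:R / N%:R) * (C * c) :> R by ring.
rewrite ler_wpM2r ?mulr_ge0 ?(ltW C0) ?(ltW c0)// ler_pdivrMr// -natrM ler_nat; lia.
Qed.

End Hausdorff_bounds.

(** * Discs and Moebius maps *)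

Section Artanh.
Variable R : realType.
Implicit Types t x h : R.

(** The Poincare distance from [0] to [t]. *)
Definition artanh t : R := ln ((1 + t) / (1 - t)) / 2.
Definition th x : R := (expR (2 * x) - 1) / (expR (2 * x) + 1).

Lemma ln_le_sub1 x : 0 < x -> ln x <= x - 1.
Proof.
move=> x0; rewrite -ler_expR lnK//.
by have := expR_ge1Dx (x - 1); lra.
Qed.

Lemma artanh_le t : 0 <= t < 1 -> artanh t <= t / (1 - t).
Proof.
move=> /andP[t0 t1]; have d0 : 0 < 1 - t by rewrite subr_gt0.
have q0 : 0 < (1 + t) / (1 - t) by rewrite divr_gt0// ltr_wpDr.
have -> : t / (1 - t) = ((1 + t) / (1 - t) - 1) / 2 by field; rewrite gt_eqF.
by rewrite /artanh ler_pM2r// ln_le_sub1.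
Qed.

Lemma artanh_ge t : 0 <= t < 1 -> t / (1 + t) <= artanh t.
Proof.
move=> /andP[t0 t1]; have d0 : 0 < 1 - t by rewrite subr_gt0.
have e0 : 0 < 1 + t by rewrite ltr_wpDr.
have q0 : 0 < (1 - t) / (1 + t) by rewrite divr_gt0.
have := ln_le_sub1 q0; rewrite -[ln ((1 - t) / (1 + t))]opprK -lnV ?posrE// invf_div.
have -> : (1 - t) / (1 + t) - 1 = - (2 * (t / (1 + t))) by field; rewrite gt_eqF.
rewrite /artanh; lra.
Qed.

Lemma le_artanh t : 0 <= t < 1 -> t <= 2 * artanh t.
Proof.
move=> /andP[t0 t1]; have := artanh_ge (introT andP (conj t0 t1)).
have : t / 2 <= t / (1 + t).
  by rewrite ler_wpM2l// lef_pV2 ?posrE//; lra.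
lra.
Qed.

Lemma artanh_ge0 t : 0 <= t < 1 -> 0 <= artanh t.
Proof.
by move=> tt; have := le_artanh tt; case/andP: tt => t0 _; lra.
Qed.

Lemma th_bounds x : 0 <= x -> 0 <= th x < 1.
Proof.
move=> x0; have : expR 0 <= expR (2 * x) by rewrite ler_expR; lra.
rewrite expR0 => e1.
rewrite /th ltr_pdivrMr; last lra.
by rewrite divr_ge0//=; lra.
Qed.

Lemma artanh_th x : 0 <= x -> artanh (th x) = x.
Proof.
move=> x0; rewrite /artanh /th; have := expR_gt0 (2 * x).
have : ln (expR (2 * x)) = 2 * x by rewrite expRK.
move: (expR _) => E lnE E0; have E1 : E + 1 != 0 by rewrite gt_eqF// ltr_wpDr.
have -> : 1 + (E - 1) / (E + 1) = 2 * E / (E + 1) by field.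
have -> : 1 - (E - 1) / (E + 1) = 2 / (E + 1) by field.
have -> : 2 * E / (E + 1) / (2 / (E + 1)) = E by field.
by rewrite lnE; field.
Qed.

Lemma th_artanh t : 0 <= t < 1 -> th (artanh t) = t.
Proof.
move=> /andP[t0 t1]; rewrite /th /artanh.
have d0 : 0 < 1 - t by rewrite subr_gt0.
have -> : 2 * (ln ((1 + t) / (1 - t)) / 2) = ln ((1 + t) / (1 - t)) by field.
have d1 : 1 - t != 0 by rewrite gt_eqF.
rewrite lnK ?posrE ?divr_gt0//; last lra.
have -> : (1 + t) / (1 - t) - 1 = 2 * t / (1 - t) by field.
have -> : (1 + t) / (1 - t) + 1 = 2 / (1 - t) by field.
by field.
Qed.

Lemma thD x h : th (x + h) = (th h + th x) / (1 + th x * th h).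
Proof.
rewrite /th mulrDr expRD.
have := expR_gt0 (2 * x); have := expR_gt0 (2 * h).
move: (expR (2 * x)) (expR (2 * h)) => A B B0 A0.
have AB0 : 0 < A * B by rewrite mulr_gt0.
have A1 : A + 1 != 0 by rewrite gt_eqF// ltr_wpDr.
have B1 : B + 1 != 0 by rewrite gt_eqF// ltr_wpDr.
have AB1 : A * B + 1 != 0 by rewrite gt_eqF// ltr_wpDr.
have -> : 1 + (A - 1) / (A + 1) * ((B - 1) / (B + 1)) =
    2 * (A * B + 1) / ((A + 1) * (B + 1)) by field; rewrite A1 B1.
have -> : (B - 1) / (B + 1) + (A - 1) / (A + 1) =
    2 * (A * B - 1) / ((A + 1) * (B + 1)) by field; rewrite A1 B1.
by field; rewrite A1 B1 AB1.
Qed.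

Lemma th0 : th 0 = 0.
Proof. by rewrite /th mulr0 expR0 subrr mul0r. Qed.

Lemma th_le x : 0 <= x -> th x <= 2 * x.
Proof. by move=> x0; have := le_artanh (th_bounds x0); rewrite artanh_th. Qed.

End Artanh.

Section Moebius.
Variable R : realType.

Definition moebius (a e z : R[i]) : R[i] := (e * z + a) / (1 + conjc a * (e * z)).

Lemma moebius_identity (a z : R[i]) :
  cmod (1 + conjc a * z) ^+ 2 - cmod (z + a) ^+ 2 = (1 - cmod a ^+ 2) * (1 - cmod z ^+ 2).
Proof.
rewrite !cmod_sqr; case: a z => a1 a2 [z1 z2] /=; ring.
Qed.

Lemma moebius_disc (a e z : R[i]) : disc a -> cmod e = 1 -> disc z ->
  1 + conjc a * (e * z) != 0 /\ disc (moebius a e z).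
Proof.
rewrite /disc /= => a1 e1 z1.
have ez : cmod (e * z) < 1 by rewrite cmodM e1 mul1r.
have := moebius_identity a (e * z).
have sq (w : R[i]) : cmod w < 1 -> 0 < 1 - cmod w ^+ 2.
  by move=> w1; rewrite subr_gt0 expr_lt1// cmod_ge0.
have := mulr_gt0 (sq _ a1) (sq _ ez); move=> /[swap] <-; rewrite subr_gt0 => lt.
have nz : 1 + conjc a * (e * z) != 0.
  by apply/eqP => E0; move: lt; rewrite E0 cmod0 expr0n ltNge sqr_ge0.
split => //; rewrite /moebius cmodM cmodV ltr_pdivrMr ?cmod_gt0// mul1r.
by rewrite -ltr_sqr ?nnegrE ?cmod_ge0.
Qed.

Lemma moebius_holomorphic (a e : R[i]) : disc a -> cmod e = 1 ->
  holomorphic_on (@disc R) (fun z : Cplx R => moebius a e z : Cplx R).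
Proof.
move=> a1 e1 z z1; have [nz _] := moebius_disc a1 e1 z1.
apply: differentiableM.
  by apply: differentiableD => //; apply: differentiableM.
apply: (@differentiableV _ _ (fun t : Cplx R => 1 + conjc a * (e * t) : Cplx R)) => //.
Qed.

Variable n : nat.
Implicit Types (U : set (Cspace R n)) (phi : Cplx R -> Cspace R n).

Definition disc_in U phi := holomorphic_on (@disc R) phi /\ phi @` (@disc R) `<=` U.

Lemma disc_in_moebius U phi (a e : R[i]) : disc_in U phi -> disc a -> cmod e = 1 ->
  disc_in U (fun z => phi (moebius a e z)).
Proof.
move=> [hphi pU] a1 e1; split.
  move=> z z1; apply: (@differentiable_comp _ _ _ _ (fun z : Cplx R => moebius a e z : Cplx R) phi).
    exact: moebius_holomorphic.
  by apply: hphi; exact: (moebius_disc a1 e1 z1).2.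
move=> _ [z z1 <-]; apply: pU; exists (moebius a e z) => //.
exact: (moebius_disc a1 e1 z1).2.
Qed.

(** The unit disc is homogeneous and isotropic: a Moebius map takes [0] to [a]
    and a point of the positive real axis to [b]. *)
Lemma disc_normal_form U phi (a b : R[i]) : disc_in U phi -> disc a -> disc b ->
  exists (psi : Cplx R -> Cspace R n) (t : R), [/\ disc_in U psi, 0 <= t < 1,
    psi 0 = phi a, psi t%:C = phi b & poincare a b = artanh t].
Proof.
move=> pU a1 b1; pose w := (b - a) / (1 - conjc a * b).
have a1' : 0 < 1 - cmod a ^+ 2 by rewrite subr_gt0 expr_lt1// cmod_ge0.
have Na : disc (- a) by rewrite /disc /= cmodN.
have ca : conjc (- a) = - conjc a by case: (a) => ? ?; simpc.
have [nz wd] := moebius_disc Na (cmod1 R) b1.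
have wE : moebius (- a) 1 b = w by rewrite /moebius /w mul1r ca mulNr.
rewrite wE in wd; rewrite mul1r ca mulNr in nz.
pose t := cmod w; have tP : 0 <= t < 1 by rewrite /t cmod_ge0.
pose e : R[i] := if t == 0 then 1 else w / t%:C.
have e1 : cmod e = 1.
  rewrite /e; case: eqVneq => [_|t0]; first exact: cmod1.
  rewrite cmodM cmodV cmodR ger0_norm; last by case/andP: tP.
  by rewrite -/t divff.
have et : e * t%:C = w.
  rewrite /e; case: eqVneq => [t0|t0].
    by rewrite t0 mulr0; apply/esym/eqP; rewrite -cmod_eq0 -/t t0.
  by rewrite divfK// -cmod_eq0 cmodR normr_eq0.
exists (fun z => phi (moebius a e z)), t; split => //.
- exact: disc_in_moebius.
- by rewrite /moebius mulr0 add0r mulr0 addr0 divr1.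
- congr phi; rewrite /moebius et.
  have aa : 1 - a * conjc a != 0.
    rewrite -cmod_gt0; apply: lt_le_trans a1' _.
    have -> : 1 - a * conjc a = (1 - cmod a ^+ 2)%:C.
      by rewrite cmod_sqr; case: (a) => ? ?; simpc => /=; congr (_ +i* _); ring.
    by rewrite cmodR ler_norm.
  have -> : w + a = b * (1 - a * conjc a) / (1 - conjc a * b) by rewrite /w; field.
  have -> : 1 + conjc a * w = (1 - a * conjc a) / (1 - conjc a * b) by rewrite /w; field.
  by rewrite invf_div mulrA divfK// mulfK.
- rewrite /poincare /artanh.
  have -> : cmod ((a - b) / (1 - conjc a * b)) = t by rewrite /t /w !cmodM -cmodN opprB.
  by [].
Qed.

End Moebius.

(** * The Kobayashi distance *)

Section Kobayashi_distance.
Variables (R : realType) (n : nat).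
Implicit Types (U V : set (Cspace R n)) (p q : Cspace R n).

Lemma kobayashi_disc U (phi : Cplx R -> Cspace R n) (a b : R[i]) :
  disc_in U phi -> disc a -> disc b ->
  (kobayashi U (phi a) (phi b) <= (poincare a b)%:E)%E.
Proof.
move=> [hphi pU] a1 b1; apply: ereal_inf_lbound.
exists 1%N, (fun j => if j is 0%N then phi a else phi b), (fun=> phi), (fun=> a), (fun=> b).
by split => // [[|j]//|]; rewrite big_ord1.
Qed.

Lemma kobayashi_refl U p : (kobayashi U p p <= 0)%E.
Proof.
apply: ereal_inf_lbound.
exists 0%N, (fun=> p), (fun=> fun=> p), (fun=> 0), (fun=> 0).
by split => //; rewrite big_ord0.
Qed.

Lemma kobayashi_triangle U p q w (x y : R) :
  (kobayashi U p q <= x%:E)%E -> (kobayashi U q w <= y%:E)%E ->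
  (kobayashi U p w <= (x + y)%:E)%E.
Proof.
move=> pq qw; apply/lee_addgt0Pr => e e0; rewrite -EFinD.
have e2 : 0 < e / 2 by rewrite divr_gt0.
have lt1 : (kobayashi U p q < (x + e / 2)%:E)%E.
  by apply: le_lt_trans pq _; rewrite lte_fin ltrDl.
have lt2 : (kobayashi U q w < (y + e / 2)%:E)%E.
  by apply: le_lt_trans qw _; rewrite lte_fin ltrDl.
have [_ [m1 [x1 [phi1 [a1 [b1 [p1 q1 H1 ->]]]]]]] := ereal_inf_lt lt1.
rewrite lte_fin => S1.
have [_ [m2 [x2 [phi2 [a2 [b2 [p2 q2 H2 ->]]]]]]] := ereal_inf_lt lt2.
rewrite lte_fin => S2.
(* concatenation of the two chains *)
pose cat (T : Type) (f g : nat -> T) j := if (j < m1)%N then f j else g (j - m1)%N.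
apply: (@le_trans _ _ (\sum_(j < m1 + m2) poincare (cat _ a1 a2 j) (cat _ b1 b2 j))%:E).
  apply: ereal_inf_lbound.
  exists (m1 + m2)%N, (cat _ x1 x2), (cat _ phi1 phi2), (cat _ a1 a2), (cat _ b1 b2).
  split => //.
  - by rewrite /cat; move: q1; case: (m1) => [|m] //= q1; rewrite p2 -q1 p1.
  - by rewrite /cat ltnNge leq_addr /= addKn.
  move=> j; rewrite /cat; have [jm1 _|jm1 jm2] := ltnP j m1.
    have [? ? ? ? nx] := H1 j jm1; split => //; rewrite nx.
    case: ltnP => // m1j; have <- : m1 = j.+1 by apply/eqP; rewrite eqn_leq m1j jm1.
    by rewrite subnn p2 q1.
  have [? ? ? ? nx] : _ := H2 (j - m1)%N ltac:(by rewrite ltn_subLR).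
  split => //; rewrite nx ltnNge (leq_trans jm1) //= subSn//.
rewrite lee_fin big_split_ord /=.
have -> : \sum_(i < m1) poincare (cat _ a1 a2 i) (cat _ b1 b2 i) = \sum_(i < m1) poincare (a1 i) (b1 i).
  by apply: eq_bigr => i _; rewrite /cat ltn_ord.
have -> : \sum_(i < m2) poincare (cat _ a1 a2 (m1 + i)%N) (cat _ b1 b2 (m1 + i)%N) = \sum_(i < m2) poincare (a2 i) (b2 i).
  by apply: eq_bigr => i _; rewrite /cat ltnNge leq_addr /= addKn.
lra.
Qed.

(** The Kobayashi distance is the largest of the distances that it has to
    dominate on holomorphic discs. *)
Lemma kobayashi_dominates U (rho : Cspace R n -> Cspace R n -> \bar R) (c : R) :
  0 < c -> (forall p, (rho p p <= 0)%E) ->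
  (forall p q w x y, (rho p q <= x%:E)%E -> (rho q w <= y%:E)%E ->
     (rho p w <= (x + y)%:E)%E) ->
  (forall phi a b, disc_in U phi -> disc a -> disc b ->
     (rho (phi a) (phi b) <= (c * poincare a b)%:E)%E) ->
  forall p q, (rho p q <= c%:E * kobayashi U p q)%E.
Proof.
move=> c0 rho0 rhoD rhoP p q; rewrite -lee_pdivrMl//; apply: le_ereal_inf_tmp.
move=> _ [m [x [phi [a [b [xp xq H ->]]]]]]; rewrite lee_pdivrMl//.
rewrite -xp -xq -EFinM; elim: m {q xq} H => [|m IH] H.
  by rewrite big_ord0 mulr0.
rewrite big_ord_recr /= mulrDr; apply: (rhoD _ (x m)).
  by apply: IH => j jm; apply: H; exact: ltnW.
by have [? ? [am bm] <- <-] := H m (ltnSn m); exact: rhoP.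
Qed.

(** Up to the parameter [1/2] this is the Lipschitz estimate; beyond, the
    distance of two points of [U] is at most [2 M] and the Poincare distance
    is at least [1/4]. *)
Lemma kobayashi_lower_bound U (M : R) : 0 < M -> (forall z, U z -> enorm z <= M) ->
  forall p q i, ((cmod (p 0 i - q 0 i))%:E <= (32 * M)%:E * kobayashi U p q)%E.
Proof.
move=> M0 UM p q i.
apply: (@kobayashi_dominates U (fun p q => (cmod (p 0 i - q 0 i))%:E) (32 * M)).
- by rewrite mulr_gt0.
- by move=> z; rewrite subrr cmod0.
- move=> z z' z'' x y; rewrite !lee_fin => zz' z'z''.
  have -> : z 0 i - z'' 0 i = (z 0 i - z' 0 i) + (z' 0 i - z'' 0 i) by rewrite addrA subrK.
  by apply: le_trans (ler_cmodD _ _) _; exact: lerD.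
move=> phi a b pU a1 b1; rewrite lee_fin.
have [psi [t [[hpsi psiU] /andP[t0 t1] <- <- ->]]] := disc_normal_form pU a1 b1.
have pM z : disc z -> cmod (psi z 0 i) <= M.
  move=> z1; apply: le_trans (cmod_le_enorm _ _) _; apply: UM; apply: psiU.
  by exists z.
apply: (@le_trans _ _ (16 * M * t)); last first.
  have := le_artanh (introT andP (conj t0 t1)) => tt.
  have -> : 32 * M * artanh t = 16 * M * (2 * artanh t) by ring.
  by rewrite ler_pM2l// mulr_gt0.
rewrite -cmodN opprB; have [t2|t2] := leP t (1 / 2).
  have hc : holomorphic_on (@disc R) (fun z : Cplx R => psi z 0 i : Cplx R).
    move=> z z1; apply: (@differentiable_comp _ _ _ _ psi (fun w : Cspace R n => w 0 i : Cplx R)).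
      exact: hpsi.
    exact: differentiable_coord.
  have := bounded_holomorphic_lipschitz hc pM (introT andP (conj (lexx 0) t0)) t2.
  by rewrite subr0.
have d0 : @disc R 0 by rewrite /disc /= cmod0.
have dt : @disc R t%:C by rewrite /disc /= cmodR ger0_norm.
apply: le_trans (ler_cmodD _ _) _; rewrite cmodN.
have := pM _ d0; have := pM _ dt; nra.
Qed.

End Kobayashi_distance.

Section Kobayashi_tube.
Variables (R : realType) (k : nat).

(** Complex lines through [x] meet the tube in a set that contains a disc of
    radius [s]. *)
Lemma kobayashi_sphere_upper (s : R) (x y : 'rV[R]_k.+1) : 0 < s ->
  sphere R k x -> sphere R k y -> l2 (x - y) < s / 2 ->
  (kobayashi (tube k s) (real_embed x) (real_embed y) <= (2 / s * l2 (x - y))%:E)%E.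
Proof.
move=> s0 Sx Sy xy; set e := l2 (x - y) in xy *.
pose v : Cspace R k.+1 := ((s / e)%:C : Cplx R) *: real_embed (y - x).
pose phi (z : Cplx R) : Cspace R k.+1 := real_embed x + z *: v.
have e0 : 0 <= e by exact: l2_ge0.
have ev : enorm v <= s.
  rewrite enormZ cmodR enorm_real_embed -opprB l2N -/e.
  have [->|en0] := eqVneq e 0; first by rewrite mulr0 ltW.
  by rewrite ger0_norm ?divr_ge0 ?(ltW s0)// divfK.
have dphi : disc_in (tube k s) phi.
  split.
    by move=> z _; apply: differentiableD.
  move=> _ [z z1 <-]; rewrite /disc /= in z1.
  have r0 : 0 < s - cmod z * s.
    by rewrite subr_gt0 gtr_pMl.
  apply: (tube_addl (sphere_sub_tube r0 Sx)) => //.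
  by rewrite enormZ opprB addrCA subrr addr0 ler_wpM2l ?cmod_ge0.
pose t := e / s; have t2 : t < 1 / 2 by rewrite /t ltr_pdivrMr//; lra.
have t0 : 0 <= t by rewrite divr_ge0// ltW.
have d0 : @disc R 0 by rewrite /disc /= cmod0.
have dt : @disc R t%:C by rewrite /disc /= cmodR ger0_norm//; lra.
have p0 : phi 0 = real_embed x by rewrite /phi scale0r addr0.
have pt : phi t%:C = real_embed y.
  rewrite /phi /v scalerA -rmorphM /=.
  have [en0|en0] := eqVneq e 0.
    have -> : y = x by apply/eqP; rewrite eq_sym -subr_eq0 -l2_eq0 -/e en0.
    have -> : real_embed (x - x) = 0.
      by apply/rowP => i; rewrite !mxE subrr.
    by rewrite scaler0 addr0.
  have -> : t * (s / e) = 1 by rewrite /t; field; rewrite en0 gt_eqF.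
  rewrite scale1r; apply/rowP => i; rewrite !mxE.
  by rewrite -rmorphD /= addrCA subrr addr0.
have := kobayashi_disc dphi d0 dt; rewrite p0 pt => /le_trans; apply.
rewrite lee_fin.
have -> : poincare 0 (t%:C) = artanh t.
  rewrite /poincare /artanh conjc0 mul0r subr0 divr1 sub0r cmodN cmodR.
  by rewrite ger0_norm.
have t01 : 0 <= t < 1 by rewrite t0; lra.
apply: le_trans (artanh_le t01) _.
have -> : 2 / s * e = 2 * t by rewrite /t; ring.
rewrite ler_pdivrMr; last lra.
nra.
Qed.


(** The gain from [T_r] to [T_s] on a small piece of a disc: the disc
    [psi + z v] still lies in [T_s] when [|v| <= s - r], and [v] can be chosen
    so that [psi t] is reached at [c t] already. *)
Lemma kobayashi_tube_piece (r s L c t : R) (psi : Cplx R -> Cspace R k.+1) :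
  0 < r -> r < s -> 0 < c < 1 -> L * (1 - c) <= (s - r) * c -> 0 <= t <= (1 - c) / 4 ->
  disc_in (tube k r) psi ->
  (forall x y, 0 <= x <= y -> y <= 1 / 2 -> enorm (psi y%:C - psi x%:C) <= L * (y - x)) ->
  (kobayashi (tube k s) (psi 0)%R (psi t%:C)%R <= ((1 + c) / 2 * artanh t)%:E)%E.
Proof.
move=> r0 rs /andP[c0 c1] Lc /andP[t0 tc] [hpsi psiU] psiL.
pose v : Cspace R k.+1 := (((c * t)^-1)%:C : Cplx R) *: (psi t%:C - psi (c * t)%:C).
pose phi (z : Cplx R) : Cspace R k.+1 := psi z + z *: v.
have t1 : t < 1 / 4 by nra.
have ct0 : 0 <= c * t by rewrite mulr_ge0// ltW.
have ctt : c * t <= t by rewrite ler_piMl// ltW.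
have vs : enorm v <= s - r.
  rewrite enormZ cmodR ger0_norm ?invr_ge0//.
  have [->|tn0] := eqVneq t 0; first by rewrite mulr0 invr0 mul0r; lra.
  have tpos : 0 < t by rewrite lt_def tn0.
  rewrite mulrC ler_pdivrMr ?mulr_gt0//.
  apply: le_trans (psiL _ _ _ _) _; [by rewrite ct0|lra|].
  have -> : L * (t - c * t) = L * (1 - c) * t by ring.
  by rewrite (mulrA (s - r)) ler_pM2r.
have dphi : disc_in (tube k s) phi.
  split.
    by move=> z z1; apply: differentiableD => //; exact: hpsi.
  move=> _ [z z1 <-].
  apply: (@tube_addl _ _ r); [by apply: psiU; exists z| |exact: lt_trans rs].
  rewrite enormZ; rewrite /disc /= in z1; apply: le_trans vs.
  by rewrite ler_piMl ?enorm_ge0// ltW.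
have d0 : @disc R 0 by rewrite /disc /= cmod0.
have dt : @disc R (c * t)%:C by rewrite /disc /= cmodR ger0_norm//; lra.
have p0 : phi 0 = psi 0 by rewrite /phi scale0r addr0.
have pt : phi (c * t)%:C = psi t%:C.
  rewrite /phi /v scalerA -rmorphM /=.
  have [->|tn0] := eqVneq t 0; first by rewrite !mulr0 mul0r scale0r addr0.
  by rewrite divff ?mulf_neq0// ?gt_eqF// scale1r addrC subrK.
have := kobayashi_disc dphi d0 dt; rewrite p0 pt => /le_trans; apply.
rewrite lee_fin.
have -> : poincare 0 ((c * t)%:C) = artanh (c * t).
  rewrite /poincare /artanh conjc0 mul0r subr0 divr1 sub0r cmodN cmodR.
  by rewrite ger0_norm.
have ct1 : 0 <= c * t < 1 by rewrite ct0; lra.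
have t01 : 0 <= t < 1 by rewrite t0; lra.
apply: le_trans (artanh_le ct1) _.
apply: (@le_trans _ _ ((1 + c) / 2 * (t / (1 + t)))); last first.
  by rewrite ler_pM2l ?artanh_ge//; lra.
rewrite mulrA ler_pdivrMr; last lra.
rewrite mulrAC ler_pdivlMr; last lra.
have -> : (1 + c) / 2 * t * (1 - c * t) = t * ((1 + c) / 2 * (1 - c * t)) by ring.
have -> : c * t * (1 + t) = t * (c * (1 + t)) by ring.
rewrite ler_wpM2l//.
nra.
Qed.

(** The piece estimate applies to short steps only, so a geodesic of the disc is
    cut into equal steps, each of them moved to the origin by a Moebius map. *)
Lemma kobayashi_tube_contraction (r s : R) : 0 < r -> r < s ->
  exists2 c : R, 0 < c < 1 & forall p q,
    (kobayashi (tube k s) p q <= c%:E * kobayashi (tube k r) p q)%E.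
Proof.
move=> r0 rs; have sr : 0 < s - r by rewrite subr_gt0.
pose M := 1 + r; have M0 : 0 < M by rewrite /M; lra.
pose L := k.+1%:R * (16 * M).
have L0 : 0 < L by rewrite !mulr_gt0.
(* the solution of [L (1 - c) = (s - r) c] *)
pose c := L / (L + (s - r)).
have Lsr : 0 < L + (s - r) by rewrite addr_gt0.
have c01 : 0 < c < 1 by rewrite divr_gt0//= ltr_pdivrMr//; lra.
have Lc : L * (1 - c) <= (s - r) * c.
  by rewrite le_eqVlt; apply/orP; left; apply/eqP; rewrite /c; field; rewrite gt_eqF.
case/andP: (c01) => c0 c1.
exists ((1 + c) / 2); first by apply/andP; split; lra.
apply: kobayashi_dominates; first lra.
- exact: kobayashi_refl.
- exact: kobayashi_triangle.
move=> phi a b pU a1 b1.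
have [psi [t [dpsi t01 <- <- ->]]] := disc_normal_form pU a1 b1.
(* [th h <= 2 h], so steps of length [h0] end before [(1 - c) / 4] *)
pose h0 := (1 - c) / 8.
have h00 : 0 < h0 by rewrite divr_gt0// subr_gt0.
have piece (x h : R) : 0 <= x -> 0 <= h <= h0 ->
    (kobayashi (tube k s) (psi (th x)%:C)%R (psi (th (x + h))%:C)%R <= ((1 + c) / 2 * h)%:E)%E.
  move=> x0 /andP[hh0 hh].
  have /andP[x1 x2] := th_bounds x0; have h1 := th_bounds hh0.
  have dx : @disc R (th x)%:C by rewrite /disc /= cmodR ger0_norm.
  have dpsi' := disc_in_moebius dpsi dx (cmod1 R).
  have E0 : moebius (th x)%:C 1 0 = (th x)%:C.
    by rewrite /moebius !mulr0 add0r addr0 divr1.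
  have Eh : moebius (th x)%:C 1 (th h)%:C = (th (x + h))%:C.
    rewrite /moebius !mul1r conjc_real thD.
    move: (th x) (th h) => A B.
    by rewrite fmorph_div !rmorphD rmorphM rmorph1.
  have := @kobayashi_tube_piece r s L c (th h) _ r0 rs c01 Lc _ dpsi'.
  rewrite E0 Eh artanh_th//; apply.
    by case/andP: h1 => -> _ /=; apply: le_trans (th_le hh0) _; rewrite /h0 in hh; lra.
  move=> u w uw w2; apply: le_trans (enorm_le_sum _) _.
  rewrite /L -mulrA mulr_natl; apply: (@le_trans _ _ (\sum_(i < k.+1) (16 * M * (w - u)))).
    apply: ler_sum => i _; rewrite !mxE.
    have [hol tub] := dpsi'.
    apply: (@bounded_holomorphic_lipschitz _ (fun z : Cplx R => psi (moebius (th x)%:C 1 z) 0 i : Cplx R)) => //.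
      move=> z z1; apply: (@differentiable_comp _ _ _ _ (fun z : Cplx R => psi (moebius (th x)%:C 1 z)) (fun w : Cspace R k.+1 => w 0 i : Cplx R)).
        exact: hol.
      exact: differentiable_coord.
    move=> z z1; apply: le_trans (cmod_le_enorm _ _) _; apply: tube_bounded.
    by apply: tub; exists z.
  by rewrite sumr_const card_ord.
have steps (m : nat) (h : R) : 0 <= h <= h0 ->
    (kobayashi (tube k s) (psi 0)%R (psi (th (m%:R * h))%:C)%R <= ((1 + c) / 2 * (m%:R * h))%:E)%E.
  move=> hh; elim: m => [|m IH].
    by rewrite mul0r th0 mulr0; exact: kobayashi_refl.
  have -> : m.+1%:R * h = m%:R * h + h by rewrite -natr1 mulrDl mul1r.
  rewrite mulrDr; apply: kobayashi_triangle IH _; apply: piece => //.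
  by rewrite mulr_ge0//; case/andP: hh.
have X0 := artanh_ge0 t01.
pose m := (Num.trunc (artanh t / h0)).+1.
have mR : 0 < (m%:R : R) by rewrite ltr0n.
have := steps m (artanh t / m%:R).
have -> : m%:R * (artanh t / m%:R) = artanh t by field; rewrite gt_eqF.
rewrite th_artanh//; apply.
rewrite divr_ge0 ?(ltW mR)//= ler_pdivrMr// mulrC -ler_pdivrMr//.
exact/ltW/truncnS_gt.
Qed.

End Kobayashi_tube.

(** * The radius of a strongly pseudoconvex tube is less than 1 *)

Section Radius_bound.
Variables (R : realType) (k : nat).
Local Notation Cn := (Cspace R k.+1).

Lemma nbhs_cspace n (p : Cspace R n) (A : set (Cspace R n)) : nbhs p A ->
  exists2 d : R, 0 < d & forall z, enorm (z - p) < d -> A z.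
Proof.
move=> /nbhs_ballP[e /= /gt0_complex[d d0 ->] dA]; exists d => // z zp.
apply: dA; split; first by rewrite ltcR.
move=> i j; rewrite (ord1 i) -ball_normE /= distrC normCE ltcR.
by apply: le_lt_trans zp; have := cmod_le_enorm (z - p) j; rewrite !mxE.
Qed.

Lemma on_line_derive n (rho : Cspace R n -> R) (z v : Cspace R n) (t : R) :
  derivable (on_line rho (z + t%:C *: v) v) 0 1 ->
  is_derive t 1 (on_line rho z v) (rderive v rho (z + t%:C *: v)).
Proof.
move=> dv; apply: is_derive_remainder => e e0.
have d0 : is_derive (0 : R) 1 (on_line rho (z + t%:C *: v) v) (rderive v rho (z + t%:C *: v)).
  exact: (DeriveDef dv (esym (derive1E _ _))).
have [d dpos Hd] := derive_remainder d0 e0; exists d => // u ud.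
have := Hd _ ud; rewrite add0r.
have E (x : R) : on_line rho (z + t%:C *: v) v x = on_line rho z v (t + x).
  rewrite /on_line; congr rho; apply/rowP => i.
  by rewrite !mxE rmorphD mulrDl addrA.
by rewrite !E addr0.
Qed.

Variables (s : R) (rho : Cn -> R) (W : set Cn) (p : Cn).
Hypotheses (s1 : 1 <= s) (rp : reV p = 0) (ip : l2 (imV p) ^+ 2 = s ^+ 2 - 1).
Hypothesis defW : local_defining (tube k s) p W rho.

Let s0 : 0 < s. Proof. by rewrite (lt_le_trans ltr01). Qed.

Let deriv0 (v : Cn) : is_derive (0 : R) 1 (on_line rho p v) (rderive v rho p).
Proof.
have [_ Wp smooth _ _] := defW; have [_ /(_ v)[dv _]] := smooth 1%N.
have := @on_line_derive _ rho p v 0; rewrite scale0r addr0; apply.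
exact: dv.
Qed.

Let rho_p : 0 <= rho p.
Proof.
have [_ Wp _ /(_ p Wp) tubeW _] := defW.
rewrite leNgt; apply/negP => /tubeW /tubeP => /(_ s0).
have -> : l2 (reV p) = 0 by rewrite rp; apply/eqP; rewrite l2_eq0.
by rewrite ip sub0r sqrrN expr1n subrK ltxx.
Qed.

Let real_line_in_tube (x : 'rV[R]_k.+1) (t : R) : 0 < `|t| * l2 x < 2 ->
  tube k s (p + t%:C *: real_embed x).
Proof.
move=> /andP[x0 x2]; apply/tubeP => //.
rewrite reVD rp add0r reVZ reV_real_embed imVD imVZ imV_real_embed scaler0 addr0.
rewrite ip l2Z; nra.
Qed.

Let near_W : exists2 d : R, 0 < d & forall z, enorm (z - p) < d -> W z.
Proof.
have [oW Wp _ _ _] := defW; apply: nbhs_cspace; exact: open_nbhs_nbhs.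
Qed.

(** All points of a real line through [p] near [p], except [p], lie in the tube,
    so [rho] has a maximum at [p] on that line. *)
Let real_derivative0 (x : 'rV[R]_k.+1) : rderive (real_embed x) rho p = 0.
Proof.
have [d d0 dW] := near_W; have [_ _ _ tubeW _] := defW.
set D := rderive _ _ _; apply: contrapT => /eqP D0.
have D2 : 0 < `|D| / 2 by rewrite divr_gt0// normr_gt0.
have [d' d'0 Hd] := derive_remainder (deriv0 (real_embed x)) D2.
have l0 := l2_ge0 x.
have l1 : 0 < l2 x + 1 by rewrite ltr_wpDl.
pose u := Num.min (d / 2 / (l2 x + 1)) (Num.min (d' / 2) (1 / (l2 x + 1))).
have u0 : 0 < u by rewrite !lt_min !divr_gt0.
have [u1 u2 u3] : [/\ u * (l2 x + 1) <= d / 2, u <= d' / 2 & u * (l2 x + 1) <= 1].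
  by split; rewrite -?ler_pdivlMr// !ge_min lexx ?orbT.
pose t := Num.sg D * u.
have tu : `|t| = u by rewrite normrM normr_sg D0 mul1r gtr0_norm.
have := Hd t; rewrite tu add0r => /(_ ltac:(lra)).
have Dt : D * t = `|D| * u by rewrite /t mulrA (mulrC D) -normrEsg.
rewrite -/D Dt /on_line scale0r addr0.
have rt : rho (p + t%:C *: real_embed x) <= rho p.
  have [x0|x0] := eqVneq x 0.
    have -> : real_embed x = 0 by rewrite x0; apply/rowP => i; rewrite !mxE.
    by rewrite scaler0 addr0.
  apply/ltW; apply: lt_le_trans rho_p.
  apply/tubeW.
    apply: dW; rewrite addrAC subrr add0r enormZ cmodR tu enorm_real_embed; nra.
  by apply: real_line_in_tube; rewrite tu mulr_gt0 ?l2_gt0//=; nra.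
have Du : 0 < `|D| * u by rewrite mulr_gt0// normr_gt0.
rewrite ler_norml => /andP[+ _]; lra.
Qed.

(** Let the derivative along [v] be positive. As the real derivatives vanish at
    [p], it may be computed along [v] plus a real vector, for which [rho] grows
    linearly too. But the real vector can be chosen so large that the ray
    enters the tube: near its conical point the tube contains a cone around
    the real directions. *)
Let derivative_le0 (v : Cn) : rderive v rho p <= 0.
Proof.
rewrite leNgt; apply/negP => m0; set m := rderive v rho p in m0.
have [_ Wp smooth tubeW _] := defW; have [_ /(_ v)[dv [cv _]]] := smooth 1%N.
have [d d0 dW] := near_W.
have [d' d'0 dv'] : exists2 d : R, 0 < d & forall z, enorm (z - p) < d -> m / 2 <= rderive v rho z.
  apply: nbhs_cspace.
  have /cvgrPdist_lt/(_ (m / 2)) := cv _ Wp; rewrite divr_gt0// => /(_ isT).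
  by apply: filterS => z; rewrite ltr_norml -/m => /andP[_ ?]; lra.
pose b := l2 (imV v); pose B := l2 (imV p).
have b0 : 0 <= b by exact: l2_ge0.
have B0 : 0 <= B by exact: l2_ge0.
(* [v + w] has real part [K pole], and [K > |Im p| |Im v|] makes the
   first-order term of the squared distance to the sphere equal to [- 2 t] *)
pose K := B * b + 1; have K1 : 1 <= K by rewrite lerDr mulr_ge0.
pose w : 'rV[R]_k.+1 := K *: pole R k - reV v.
have m4 : 0 < m / 4 by rewrite divr_gt0.
have [d2 d20 Hw] := derive_remainder (deriv0 (real_embed w)) m4.
pose E := enorm (real_embed w) + enorm v + 1.
have E1 : 1 <= E by rewrite lerDr addr_ge0 ?enorm_ge0.
have E0 : 0 < E by exact: lt_le_trans E1.
pose Q := b ^+ 2 + K ^+ 2.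
have Q0 : 0 < Q by rewrite ltr_wpDl ?sqr_ge0// exprn_gt0// (lt_le_trans ltr01).
pose t := Num.min (Num.min d d' / (2 * E)) (Num.min (d2 / 2) (1 / Q)).
have dd0 : 0 < Num.min d d' by rewrite lt_min d0.
have t0 : 0 < t by rewrite /t !lt_min !divr_gt0// mulr_gt0.
have [t1 t2 t3] : [/\ t * (2 * E) <= Num.min d d', t <= d2 / 2 & t * Q <= 1].
  by split; rewrite -?ler_pdivlMr ?mulr_gt0// !ge_min lexx ?orbT.
have tE : t * E < Num.min d d'.
  have : 0 < t * E by rewrite mulr_gt0.
  by move: t1; rewrite mulrCA => t1; lra.
have close (u : R) : 0 <= u <= t ->
    enorm (p + t%:C *: real_embed w + u%:C *: v - p) < Num.min d d'.
  move=> /andP[u0 ut]; apply: le_lt_trans tE.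
  have -> : p + t%:C *: real_embed w + u%:C *: v - p = t%:C *: real_embed w + u%:C *: v.
    by rewrite -[p + _ + _]addrA addrAC subrr add0r.
  apply: le_trans (ler_enormD _ _) _; rewrite !enormZ !cmodR (gtr0_norm t0) (ger0_norm u0).
  have := enorm_ge0 v; have := enorm_ge0 (real_embed w); rewrite /E; nra.
pose z := p + t%:C *: real_embed w.
have zt_tube : tube k s (z + t%:C *: v).
  apply/tubeP => //.
  have -> : reV (z + t%:C *: v) = (t * K) *: pole R k.
    rewrite !reVD rp add0r !reVZ reV_real_embed /w scalerBr subrK scalerA//.
  have -> : imV (z + t%:C *: v) = imV p + t *: imV v.
    by rewrite !imVD !imVZ imV_real_embed scaler0 addr0.
  have tK : 0 <= t * K by rewrite mulr_ge0 ?ltW// (lt_le_trans ltr01).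
  rewrite l2Z l2_pole mulr1 ger0_norm//.
  have lim : l2 (imV p + t *: imV v) <= B + t * b.
    by apply: le_trans (ler_l2D _ _) _; rewrite l2Z gtr0_norm.
  have lim2 : l2 (imV p + t *: imV v) ^+ 2 <= (B + t * b) ^+ 2.
    by rewrite ler_sqr ?nnegrE ?l2_ge0// addr_ge0 ?mulr_ge0// ltW.
  have sE : s ^+ 2 = B ^+ 2 + 1 by rewrite /B ip subrK.
  apply: le_lt_trans (lerD lim2 (lexx _)) _.
  have -> : (B + t * b) ^+ 2 + (t * K - 1) ^+ 2 = s ^+ 2 - t * (2 - t * Q).
    by rewrite sE /Q /K; ring.
  by rewrite gtrBl mulr_gt0//; lra.
have Wz (u : R) : 0 <= u <= t -> W (z + u%:C *: v).
  by move=> /close; rewrite lt_min => /andP[+ _]; exact: dW.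
have neg : rho (z + t%:C *: v) < 0.
  by apply/tubeW => //; apply: Wz; rewrite lexx ltW.
have dline (u : R) : 0 <= u <= t -> is_derive u 1 (on_line rho z v) (rderive v rho (z + u%:C *: v)).
  by move=> /Wz Wu; apply: on_line_derive; exact: dv.
have cline : {within `[0, t], continuous (on_line rho z v)}.
  apply: derivable_within_continuous => u; rewrite in_itv /= => ut.
  by have [] := dline u ut.
have dline' (u : R) : u \in `]0, t[%R -> is_derive u 1 (on_line rho z v) (rderive v rho (z + u%:C *: v)).
  by rewrite in_itv /= => /andP[u0 ut]; apply: dline; rewrite !ltW.
have [u ut] := MVT_segment (ltW t0) dline' cline.
rewrite subr0 /on_line scale0r addr0 => mvt.
have low : m / 2 <= rderive v rho (z + u%:C *: v).
  apply: dv'; have := close u; rewrite in_itv /= in ut => /(_ ut).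
  by rewrite lt_min => /andP[].
have := Hw t; rewrite add0r (gtr0_norm t0) real_derivative0 mul0r subr0.
rewrite {2}/on_line scale0r addr0 => /(_ ltac:(lra)).
rewrite /on_line -/z ler_norml => /andP[zlow _].
have := rho_p; have : m / 2 * t <= rderive v rho (z + u%:C *: v) * t by rewrite ler_pM2r.
have : 0 < m * t by rewrite mulr_gt0.
lra.
Qed.

(** The derivatives along [v] and [- v] are opposite and both nonpositive. *)
Lemma no_defining_function : False.
Proof.
have [_ Wp _ _ /(_ p Wp)[v /eqP]] := defW; apply.
apply/eqP; rewrite eq_le derivative_le0 /= leNgt; apply/negP => v0.
have /(_ v) H := deriv0.
have v2 : 0 < - rderive v rho p / 4 by rewrite divr_gt0// oppr_gt0.
have [d d0 Hd] := derive_remainder H v2.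
have [d' d'0 Hd'] := derive_remainder (deriv0 (- v)) v2.
pose t := Num.min d d' / 2.
have dd : 0 < Num.min d d' by rewrite lt_min d0.
have t0 : 0 < t by rewrite divr_gt0.
have [td td'] : t < d /\ t < d'.
  have : Num.min d d' <= d by rewrite ge_min lexx.
  have : Num.min d d' <= d' by rewrite ge_min lexx orbT.
  rewrite /t; lra.
have := Hd (- t); rewrite normrN (gtr0_norm t0) add0r => /(_ td).
have := Hd' t; rewrite (gtr0_norm t0) add0r => /(_ td').
rewrite /on_line !scale0r addr0 rmorphN scaleNr scalerN.
rewrite !ler_norml => /andP[a1 a2] /andP[a3 a4].
have := derivative_le0 (- v); have : 0 < - rderive v rho p * t by rewrite mulr_gt0// oppr_gt0.
move: (rderive (- v) rho p) a1 a2 => y a1 a2 h y0.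
have : y * t <= 0 by rewrite mulr_le0_ge0// ltW.
lra.
Qed.
End Radius_bound.

(** For [s >= 1] the point [p = i sqrt (s^2 - 1) pole] is at distance [s] from
    the whole sphere and is a boundary point of the tube. *)
Lemma strongly_pseudoconvex_tube_lt1 (R : realType) (k : nat) (s : R) : 0 < s ->
  strongly_pseudoconvex (tube k s) -> s < 1.
Proof.
move=> s0 [_ spc]; rewrite ltNge; apply/negP => s1.
pose b := Num.sqrt (s ^+ 2 - 1).
have b2 : b ^+ 2 = s ^+ 2 - 1 by rewrite sqr_sqrtr// subr_ge0 expr_ge1// ltW.
pose p : Cspace R k.+1 := \row_i ((0 +i* (b * pole R k 0 i))%C : Cplx R).
have rp : reV p = 0 by apply/rowP => i; rewrite !mxE.
have ip' : imV p = b *: pole R k by apply/rowP => i; rewrite !mxE.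
have ip : l2 (imV p) ^+ 2 = s ^+ 2 - 1.
  by rewrite ip' l2Z l2_pole mulr1 real_normK ?num_real.
have pnot : ~ tube k s p.
  move=> /tubeP => /(_ s0); have -> : l2 (reV p) = 0 by rewrite rp; apply/eqP; rewrite l2_eq0.
  by rewrite ip sub0r sqrrN expr1n subrK ltxx.
have [|W [rho [defW _]]] := spc p; last exact: no_defining_function s1 rp ip defW.
split; last by move=> /interior_subset.
move=> A /nbhs_cspace[d d0 dA].
pose t := Num.min (d / 2) 1.
have t0 : 0 < t by rewrite lt_min divr_gt0//=.
have td : t <= d / 2 by rewrite ge_min lexx.
have t1 : t <= 1 by rewrite ge_min lexx orbT.
exists (p + t%:C *: real_embed (pole R k)); split.
  apply/tubeP => //.
  rewrite reVD rp add0r reVZ reV_real_embed imVD imVZ imV_real_embed scaler0 addr0.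
  rewrite ip l2Z l2_pole mulr1 gtr0_norm//; nra.
apply: dA; rewrite addrAC subrr add0r enormZ cmodR enorm_real_embed l2_pole mulr1.
by rewrite gtr0_norm//; lra.
Qed.

(** * Comparison of the invariants *)

Section Biholomorphic_invariance.
Variables (R : realType) (n : nat).
Implicit Types U V : set (Cspace R n).

Lemma biholomorphic_sym U V : biholomorphic U V -> biholomorphic V U.
Proof. by move=> [F [G [hF hG FU GV [GF FG]]]]; exists G, F; split. Qed.

Lemma kobayashi_holomorphic U V (F : Cspace R n -> Cspace R n) p q :
  holomorphic_on U F -> F @` U `<=` V ->
  (kobayashi V (F p) (F q) <= kobayashi U p q)%E.
Proof.
move=> hF FU; rewrite -[leRHS]mul1e.
apply: (@kobayashi_dominates R n U (fun p q => kobayashi V (F p) (F q)) 1) => //.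
- by move=> z; exact: kobayashi_refl.
- by move=> z w y a b; exact: kobayashi_triangle.
move=> phi a b [hphi phiU] a1 b1; rewrite mul1r.
apply: (@kobayashi_disc _ _ V (F \o phi)) => //; split.
  move=> z z1; apply: differentiable_comp; first exact: hphi.
  by apply: hF; apply: phiU; exists z.
move=> _ [z z1 <-]; apply: FU; exists (phi z) => //.
by apply: phiU; exists z.
Qed.

Lemma holomorphic_within_continuous U (F : Cspace R n -> Cspace R n) :
  holomorphic_on U F -> {within U, continuous F}.
Proof.
move=> hF; apply/subspace_continuousP => z Uz; apply: cvg_within_filter.
exact/differentiable_continuous/hF.
Qed.

Lemma ell_biholomorphic k U V : biholomorphic U V -> (ell k V <= ell k U)%E.
Proof.
move=> [F [G [hF hG FU GV [GF FG]]]]; apply: le_ereal_inf_tmp.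
move=> _ [f [[cf fU] fin ess] <-].
have fx x : sphere R k x -> U (f x) by move=> Sx; apply: fU; exists x.
have Fx z : U z -> V (F z) by move=> Uz; apply: FU; exists z.
have Hle : (hausdorff_kob k V ((F \o f) @` sphere R k) <= hausdorff_kob k U (f @` sphere R k))%E.
  rewrite -image_comp -[leRHS]mul1e -(expr1n _ k) /hausdorff_kob.
  apply: hausdorff_image => // z w _ _; rewrite mul1e.
  exact: kobayashi_holomorphic.
apply: (le_trans _ Hle); apply: ereal_inf_lbound; exists (F \o f); last by [].
split.
- split; last by move=> _ [x Sx <-]; apply: Fx; exact: fx.
  exact: within_continuous_comp cf (holomorphic_within_continuous hF) fx.
- exact: le_lt_trans Hle fin.
move=> [H [c [cH HV H0 H1]]]; apply: ess.
have Hx p : (`[0, 1]%classic `*` sphere R k) p -> V (H p) by move=> Cp; apply: HV; exists p.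
exists (G \o H), (G c); split.
- exact: within_continuous_comp cH (holomorphic_within_continuous hG) Hx.
- by move=> _ [p Cp <-]; apply: GV; exists (H p) => //; exact: Hx.
- by move=> x Sx; rewrite /= H0//= GF//; exact: fx.
- by move=> x Sx; rewrite /= H1.
Qed.

End Biholomorphic_invariance.

Section Ell_of_tubes.
Variables (R : realType) (k : nat).
Local Notation vec := 'rV[R]_k.+1.

Lemma unit_vec_lipschitz (m : R) (a b : vec) i : 0 < m -> m <= l2 a -> b != 0 ->
  `|unit_vec a 0 i - unit_vec b 0 i| <= 2 / m * l2 (a - b).
Proof.
move=> m0 ma b0; have la : 0 < l2 a by exact: lt_le_trans ma.
have lb : 0 < l2 b by rewrite l2_gt0.
have -> : unit_vec a 0 i - unit_vec b 0 i =
    ((a - b) 0 i + b 0 i / l2 b * (l2 b - l2 a)) / l2 a.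
  by rewrite !mxE; field; rewrite !gt_eqF.
rewrite normrM normfV (gtr0_norm la) ler_pdivrMr//.
have h1 : `|(a - b) 0 i + b 0 i / l2 b * (l2 b - l2 a)| <= 2 * l2 (a - b).
  apply: le_trans (ler_normD _ _) _.
  have := l2_coord (a - b) i.
  have : `|b 0 i / l2 b * (l2 b - l2 a)| <= 1 * l2 (a - b).
    rewrite normrM ler_pM//; last by rewrite distrC; exact: l2B_dist.
    by rewrite normrM normfV (gtr0_norm lb) ler_pdivrMr// mul1r l2_coord.
  lra.
apply: le_trans h1 _; have l0 := l2_ge0 (a - b).
have -> : 2 / m * l2 (a - b) * l2 a = 2 * l2 (a - b) * (l2 a / m) by ring.
by rewrite ler_peMr ?mulr_ge0// ler_pdivlMr// mul1r.
Qed.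

(** The map [y] below, the projection to the sphere followed by the projection
    to the last [k] coordinates, is Lipschitz for the Kobayashi distance. A
    point of a small cube is the value of [y] at a point of the image of [f],
    as [f] would be null-homotopic if its projection missed a point. *)
Lemma ell_tube_gt0 (r : R) : (0 < k)%N -> 0 < r -> r < 1 -> (0 < ell k (tube (R:=R) k r))%E.
Proof.
move=> k0 r0 r1; have r01 : 0 < r <= 1 by rewrite r0 ltW.
have m0 : 0 < 1 - r by rewrite subr_gt0.
pose M := 1 + r; have M0 : 0 < M by rewrite /M; lra.
pose C : R := 2 / (1 - r) * (k.+1%:R * (32 * M)).
have C0 : 0 < C by rewrite !mulr_gt0 ?invr_gt0.
pose a : R := k.+1%:R^-1; have a0 : 0 < a by rewrite invr_gt0.
pose y (z : Cspace R k.+1) : 'rV[R]_k := \row_j (tube_proj z 0 (lift ord0 j)).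
apply: (@lt_le_trans _ _ ((C ^+ k)^-1 * ((a / 6) ^+ k / 2))%:E).
  by rewrite lte_fin mulr_gt0 ?invr_gt0 ?exprn_gt0// divr_gt0 ?exprn_gt0// divr_gt0.
apply: le_ereal_inf_tmp => _ [f [fr fin ess] <-]; have [cf fU] := fr.
apply: (@hausdorff_ge_cube _ _ _ _ _ y).
- exact: C0.
- exact: a0.
- move=> p q j [x1 Sx1 px] [x2 Sx2 qx].
  have Tp : tube k r p by rewrite -px; apply: fU; exists x1.
  have Tq : tube k r q by rewrite -qx; apply: fU; exists x2.
  have kob := kobayashi_lower_bound M0 (@tube_bounded R k r) p q.
  case: (kobayashi (tube k r) p q) kob => [d kob|_|kob].
  rewrite -EFinM lee_fin [y p 0 j]mxE [y q 0 j]mxE.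
  have lp : 1 - r <= l2 (reV p).
    have lt := (tubeP p r0).1 Tp; have i2 := sqr_ge0 (l2 (imV p)).
    have : (l2 (reV p) - 1) ^+ 2 < r ^+ 2 by lra.
    rewrite -[_ ^+ 2]real_normK ?num_real// ltr_sqr ?nnegrE ?(ltW r0)//.
    by rewrite ltr_norml => /andP[? _]; lra.
  have := unit_vec_lipschitz (lift ord0 j) m0 lp (tube_reV_neq0 r01 Tq).
  rewrite /tube_proj => /le_trans; apply.
  rewrite /C -[leRHS]mulrA ler_pM2l ?divr_gt0//.
  apply: le_trans (ler_l2_sum _) _.
  apply: (@le_trans _ _ (\sum_(i < k.+1) (32 * M * d))).
    apply: ler_sum => i _; apply: le_trans (_ : _ <= cmod (p 0 i - q 0 i)) _.
      by rewrite !mxE -cReN -cReD ler_Re_cmod.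
    by have := kob i; rewrite -EFinM lee_fin.
  by rewrite sumr_const card_ord -[leLHS]mulr_natl mulrA.
  + by rewrite gt0_muley ?lte_fin// leey.
  + by have := kob ord0; rewrite gt0_muleNy ?lte_fin ?mulr_gt0.
move=> v va.
have sv : \sum_(j < k) v 0 j ^+ 2 <= 1.
  apply: (@le_trans _ _ (\sum_(j < k) a)).
    apply: ler_sum => j _; have /andP[v0 v1] := va j.
    have a1 : a <= 1 by rewrite invf_le1// ler1n.
    by rewrite expr2; nra.
  by rewrite sumr_const card_ord -[leLHS]mulr_natl ler_pdivrMr// mul1r ler_nat.
pose x : vec := \row_i (if unlift ord0 i is Some j then v 0 j else Num.sqrt (1 - \sum_(j < k) v 0 j ^+ 2)).
have Sx : sphere R k x.
  have xv : \sum_(j < k) x 0 (lift ord0 j) ^+ 2 = \sum_(j < k) v 0 j ^+ 2.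
    by apply: eq_bigr => j _; rewrite mxE liftK.
  rewrite /sphere /= big_ord_recl xv mxE unlift_none sqr_sqrtr ?subr_ge0//.
  by rewrite subrK.
have [u [Su ux]] : exists u, sphere R k u /\ tube_proj (f u) = x.
  apply: contrapT => nox; apply: ess.
  apply: (null_homotopic_missing_point r01 fr Sx) => u Su ux.
  by apply: nox; exists u.
exists (f u); first by exists u.
by apply/rowP => j; rewrite mxE ux mxE liftK.
Qed.

Lemma real_embed_sphere_finite (s : R) : (0 < k)%N -> 0 < s ->
  (hausdorff_kob k (tube k s) (@real_embed R k.+1 @` sphere R k) < +oo)%E.
Proof.
move=> k0 s0; rewrite /hausdorff_kob.
apply: (@le_lt_trans _ _ ((1 ^+ k)%:E * hausdorff (fun x y : vec =>
    kobayashi (tube k s) (real_embed x) (real_embed y)) k (sphere R k))%E).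
  by apply: hausdorff_image => // x y _ _; rewrite mul1e.
rewrite expr1n mul1e; apply: (@hausdorff_sphere_finite _ _ _ (2 / s) (s / 2)) => //.
- by rewrite divr_gt0.
- by rewrite divr_gt0.
by move=> x y Sx Sy xy; exact: kobayashi_sphere_upper.
Qed.

Lemma ell_tube_ltoo (s : R) : (0 < k)%N -> 0 < s -> s < 1 ->
  (ell k (tube (R:=R) k s) < +oo)%E.
Proof.
move=> k0 s0 s1; apply: le_lt_trans (real_embed_sphere_finite k0 s0).
apply: ereal_inf_lbound; exists (@real_embed R k.+1); last by [].
split.
- split; last by move=> _ [x Sx <-]; exact: sphere_sub_tube.
  by apply: continuous_subspaceT; exact: continuous_real_embed.
- exact: real_embed_sphere_finite.
- by apply: sphere_essential_in_tube; rewrite s0 ltW.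
Qed.

Lemma ell_tube_contraction (r s : R) : 0 < r -> r < s -> s < 1 ->
  exists2 c : R, 0 < c < 1 & (ell k (tube k s) <= (c ^+ k)%:E * ell k (tube k r))%E.
Proof.
move=> r0 rs s1; have [c c01 contr] := @kobayashi_tube_contraction R k r s r0 rs.
have c0 : 0 < c by case/andP: c01.
exists c => //; rewrite -lee_pdivrMl ?exprn_gt0//; apply: le_ereal_inf_tmp.
move=> _ [f [fr fin ess] <-]; have [cf fU] := fr.
have Hle : (hausdorff_kob k (tube k s) (f @` sphere R k)
    <= (c ^+ k)%:E * hausdorff_kob k (tube k r) (f @` sphere R k))%E.
  rewrite -[X in hausdorff_kob k (tube k s) X]image_id.
  by apply: hausdorff_image => // p q _ _; exact: contr.
rewrite lee_pdivrMl ?exprn_gt0//; apply: (le_trans _ Hle).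
apply: ereal_inf_lbound; exists f; last by [].
split.
- split => //; apply: subset_trans fU _ => z; apply: tube_mono; exact: ltW.
- apply: le_lt_trans Hle _; rewrite lte_mul_pinfty ?lee_fin ?exprn_ge0 ?ltW//.
move=> /(null_homotopic_smaller_tube r0 (ltW rs) (ltW s1) fr); exact: ess.
Qed.

End Ell_of_tubes.

Theorem theorem9p2 (R : realType) (k : nat) (r s : R)
  (hk : (1 < k)%N) (hr : (0 < r)%R) (hrs : (r < s)%R)
  (hTr : strongly_pseudoconvex (tube k r))
  (hTs : strongly_pseudoconvex (tube k s)) :
  (ell k (tube k s) < ell k (tube k r))%E /\
  ~ biholomorphic (tube k r) (tube k s).
Proof.
have k0 : (0 < k)%N by exact: ltnW.
have s0 : 0 < s by exact: lt_trans hrs.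
have s1 := strongly_pseudoconvex_tube_lt1 s0 hTs.
have lt : (ell k (tube k s) < ell k (tube k r))%E.
  have [c /andP[c0 c1] le] := ell_tube_contraction k hr hrs s1.
  have fin := ell_tube_ltoo k0 s0 s1.
  have pos := ell_tube_gt0 k0 hr (lt_trans hrs s1).
  case: (ell k (tube k r)) le pos => [e| |] // le pos.
  apply: le_lt_trans le _; rewrite -EFinM lte_fin gtr_pMl//.
  by rewrite expr_lt1// ltW.
split=> // /biholomorphic_sym/(ell_biholomorphic k).
by rewrite leNgt lt.
Qed.
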